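(* Let $d,k\in\mathbb{N}$, $T>0$, $I=[0,T]$, and let $f:I\times\mathbb{R}^d\times\mathbb{R}^k\to\mathbb{R}^d$, the random variable $X_0$, the $\mathbb{R}^k$-valued noise $\{Y_t\}_{t\in I}$ and the function $L$ satisfy the Standing Hypothesis stated in the context. Let $\{X_t\}_{t\in I}$ be the pathwise solution of the random ODE $\frac{\mathrm{d}X_t}{\mathrm{d}t}=f(t,X_t,Y_t)$, $X_t|_{t=0}=X_0$, and, for each $N\in\mathbb{N}$, let $\{X^N_{t_j}\}_{j=0,\ldots,N}$ be the Euler approximation with time step $\Delta t_N=T/N$ and initial value $X_0^N$ (see the context). Suppose that $$\mathbb{E}[\|X_0\|]<\infty,\qquad \int_0^T\mathbb{E}[\|f(t,0,Y_t)\|]\,\mathrm{d}t<\infty,\qquad \sup_{\eta\ge 0}L(\eta)\le c_L<\infty$$ for some constant $c_L\ge 0$ (so that $f$ is globally Lipschitz continuous in $x$ with constant $c_L$, uniformly in $(t,y)$); that for some constant $c_0\ge 0$ $$\mathbb{E}[\|X_0-X_0^N\|]\le c_0\,\Delta t_N\qquad\text{for all }N\in\mathbb{N};$$ and that $f=f(t,x,y)$ is continuously differentiable with respect to $t$ and twice continuously differentiable with respect to $y$, with $$\|\partial_t f(t,x,y)\|\le c_1+c_2\|x\|+c_3\|y\|,\qquad \|D_yf(t,x,y)\|\le c_4,\qquad \|D_{yy}f(t,x,y)\|\le c_7$$ for all $(t,x,y)\in I\times\mathbb{R}^d\times\mathbb{R}^k$ and suitable constants $c_1,c_2,c_3,c_4,c_7\ge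 0$. Assume that the semi-martingale noise is decomposed as $Y_t=Y_0+F_t+Z_t$, where $\{F_t\}_{t\in I}$ is a finite-variation process, $\{Z_{t\wedge T}\}_{t\ge 0}$ is a martingale, $F_0=Z_0=0$, and $$\mathbb{E}[\|Y_0\|]<\infty,\qquad \mathbb{E}\big[V(\{F_t\}_{t\in I};I)^2\big]<\infty,\qquad \mathbb{E}[\|Z_T\|^2]<\infty.$$ Then the Euler scheme is strongly convergent of order $1$, i.e. there is a constant $c\ge 0$, independent of $N$, such that $$\max_{j=0,\ldots,N}\mathbb{E}\big[\|X_{t_j}-X_{t_j}^N\|\big]\le c\,\Delta t_N\qquad\text{for all }N\in\mathbb{N}.$$
   Context: $\|\cdot\|$ denotes the Euclidean norm of vectors and the corresponding operator norm of matrices (and of the bilinear map $D_{yy}f(t,x,y)$). Standing Hypothesis: (1) $f=f(t,x,y)$ is continuous in $(t,x,y)\in I\times\mathbb{R}^d\times\mathbb{R}^k$, with values in $\mathbb{R}^d$. (2) $\|f(t,x_1,y)-f(t,x_2,y)\|\le L(\|y\|)\|x_1-x_2\|$ for all $t\in I$, $y\in\mathbb{R}^k$, $x_1,x_2\in\mathbb{R}^d$, where $L=L(\eta)$ is a monotonic nondecreasing real-valued function defined for $\eta\ge 0$. (3) $\{Y_t\}_{t\in I}$ is an adapted $\mathbb{R}^k$-valued semi-martingale (in particular with càdlàg sample paths, i.e. right-continuous with left limits) on a filtered probability space $(\Omega,\mathcal{F},(\mathcal{F}_t)_{t\ge 0},\mathbb{P})$ that is complete ($\mathcal{F}_0$ contains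 all $\mathbb{P}$-null sets) and has a right-continuous filtration. (4) $X_0$ is a ($\mathbb{R}^d$-valued) random variable on $(\Omega,\mathcal{F},\mathbb{P})$. Pathwise solution: for almost every $\omega\in\Omega$, $t\mapsto X_t(\omega)$ is the unique solution on $I$ of $X_t(\omega)=X_0(\omega)+\int_0^t f(s,X_s(\omega),Y_s(\omega))\,\mathrm{d}s$; this defines a stochastic process $\{X_t\}_{t\in I}$. Euler approximation: for $N\in\mathbb{N}$, $\Delta t_N=T/N$, $t_j=t_j^N=j\Delta t_N$, starting from a random variable $X_0^N$, set $X^N_{t_j}=X^N_{t_{j-1}}+\Delta t_N\,f(t_{j-1},X^N_{t_{j-1}},Y_{t_{j-1}})$ for $j=1,\ldots,N$. A finite-variation (FV) process is a càdlàg process whose sample paths almost surely have finite total variation on compact subsets $K\subset I$, where $V(\{F_t\}_{t\in I};K)=\sup\sum_{j=1}^n\|F_{t_j}-F_{t_{j-1}}\|$, the supremum being over all $n\in\mathbb{N}$ and $t_0<\cdots<t_n$ in $K$. Also $t\wedge T=\min\{t,T\}$, and martingales are with respect to the filtration $(\mathcal{F}_t)_{t\ge0}$. *)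

(* Defs.v *)
From HB Require Import structures.
From mathcomp Require Import all_boot all_order all_algebra.
From mathcomp Require Import all_classical all_reals all_analysis.
Set Implicit Arguments.
Unset Strict Implicit.
Unset Printing Implicit Defensive.
Import Order.TTheory GRing.Theory Num.Theory.
Import numFieldNormedType.Exports.
Local Open Scope classical_set_scope.
Local Open Scope ring_scope.

(* Vectors of R^n are row vectors 'rV[R]_n.  The library norm of 'rV[R]_n is
   the max norm: it induces the same topology, hence the same limits and
   derivatives, but every quantitative bound is expressed with [enorm]. *)
Definition enorm (R : realType) (n : nat) (v : 'rV[R]_n) : R :=
  Num.sqrt (\sum_(i < n) v 0 i ^+ 2).

Definition opnorm (R : realType) (n m : nat) (A : 'rV[R]_n -> 'rV[R]_m)
  : \bar R :=
  ereal_sup [set (enorm (A v))%:E | v in [set v | enorm v <= 1]].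

Definition opnorm2 (R : realType) (n m : nat)
  (B : 'rV[R]_n -> 'rV[R]_n -> 'rV[R]_m) : \bar R :=
  ereal_sup [set (enorm (B uv.1 uv.2))%:E |
             uv in [set uv | enorm uv.1 <= 1 /\ enorm uv.2 <= 1]].

(* The filter [within `[0, T] t^'] makes these derivatives one-sided at 0 and T. *)
Section derivative_on_interval.
Context (R : realType) (V : normedModType R) (T : R).

Definition diff_quotient (g : R -> V) (t s : R) : V := (s - t)^-1 *: (g s - g t).

Definition derivable_in (g : R -> V) (t : R) : Prop :=
  cvg (diff_quotient g t @ within `[0, T] t^').

Definition derive_in (g : R -> V) (t : R) : V :=
  lim (diff_quotient g t @ within `[0, T] t^').

Definition C1_in (g : R -> V) : Prop :=
  (forall t, t \in `[0, T] -> derivable_in g t) /\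
  {within `[0, T], continuous (derive_in g)}.

End derivative_on_interval.

(* D^2 g (y) (u, v) is the derivative at y in direction u of y |-> D g (y) v;
   with row vectors, D g (y) v = v *m 'J g y. *)
Definition diff2 (R : realType) (n m : nat) (g : 'rV[R]_n -> 'rV[R]_m)
  (y u v : 'rV[R]_n) : 'rV[R]_m := v *m 'd (jacobian g) y u.

(* In finite dimension, continuity of y |-> D^2 g (y) amounts to continuity of
   its value at each u. *)
Definition C2 (R : realType) (n m : nat) (g : 'rV[R]_n -> 'rV[R]_m) : Prop :=
  [/\ forall y, differentiable g y,
      forall y, differentiable (jacobian g) y &
      forall u, continuous (fun y => 'd (jacobian g) y u)].

Section paths.
Context (R : realType) (n : nat).
Implicit Types (g : R -> 'rV[R]_n) (T : R).

Definition cadlag g T : Prop :=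
  (forall t, 0 <= t < T -> g s @[s --> t^'+] --> g t) /\
  (forall t, 0 < t <= T -> cvg (g s @[s --> t^'-])).

Definition variation_on (K : set R) g : \bar R :=
  ereal_sup [set v | exists (p : nat) (t : nat -> R),
    [/\ forall j, (j <= p)%N -> K (t j),
        forall j, (j < p)%N -> t j < t j.+1 &
        v = (\sum_(j < p) enorm (g (t j.+1) - g (t j)))%:E]].

End paths.

(* A process is a function of all t : R, of which only the values on [0, T] (or
   on [0, +oo[ where no T is given) matter. *)
Section processes.
Context (d0 : measure_display) (Omega : measurableType d0) (R : realType).
Context (P : probability Omega R).

Definition random_vector (n : nat) (X : Omega -> 'rV[R]_n) : Prop :=
  forall i, measurable_fun setT (fun w => X w 0 i).

Definition measurable_wrt (G : set_system Omega) (X : Omega -> R) : Prop :=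
  forall B : set R, measurable B -> G (X @^-1` B).

(* The [negligible] sets of the library are the subsets of measurable sets of
   probability 0, so that the last clause entails the completeness of P. *)
Definition usual_filtration (Filt : R -> set_system Omega) : Prop :=
  [/\ forall t, 0 <= t -> sigma_algebra setT (Filt t) /\ Filt t `<=` measurable,
      forall s t, 0 <= s -> s <= t -> Filt s `<=` Filt t,
      forall t, 0 <= t -> Filt t = \bigcap_(s in [set s | t < s]) Filt s &
      P.-negligible `<=` Filt 0].

(* W is a version of the conditional expectation E[X | G]. *)
Definition is_cond_exp (G : set_system Omega) (X W : Omega -> R) : Prop :=
  [/\ P.-integrable setT (EFin \o X), P.-integrable setT (EFin \o W),
      measurable_wrt G W &
      forall A, G A -> \int[P]_(w in A) W w = \int[P]_(w in A) X w].

Context (Filt : R -> set_system Omega).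

Definition martingale (n : nat) (M : R -> Omega -> 'rV[R]_n) : Prop :=
  forall s t, 0 <= s -> s <= t -> forall i,
    is_cond_exp (Filt s) (fun w => M t w 0 i) (fun w => M s w 0 i).

Definition adapted (T : R) (n : nat) (Y : R -> Omega -> 'rV[R]_n) : Prop :=
  forall t, t \in `[0, T] -> forall i, measurable_wrt (Filt t) (fun w => Y t w 0 i).

Definition cadlag_process (T : R) (n : nat) (Y : R -> Omega -> 'rV[R]_n) : Prop :=
  {ae P, forall w, cadlag (Y ^~ w) T}.

Definition FV_process (T : R) (n : nat) (F : R -> Omega -> 'rV[R]_n) : Prop :=
  cadlag_process T F /\
  {ae P, forall w, forall K, compact K -> K `<=` `[0, T] ->
    (variation_on K (F ^~ w) < +oo)%E}.

Definition stopping_time (tau : Omega -> \bar R) : Prop :=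
  (forall w, 0 <= tau w)%E /\
  (forall t, 0 <= t -> Filt t [set w | (tau w <= t%:E)%E]).

Definition local_martingale (T : R) (n : nat) (M : R -> Omega -> 'rV[R]_n) : Prop :=
  [/\ adapted T M, cadlag_process T M &
      exists tau : nat -> Omega -> \bar R,
        [/\ forall j, stopping_time (tau j),
            {ae P, forall w, forall j, (tau j w <= tau j.+1 w)%E},
            {ae P, forall w, tau j w @[j --> \oo] --> +oo%E} &
            forall j, martingale
              (fun t w => M (fine (mine (Num.min t T)%:E (tau j w))) w)]].

Definition decomposition (T : R) (n : nat) (Y F Z : R -> Omega -> 'rV[R]_n) : Prop :=
  {ae P, forall w, [/\ F 0 w = 0, Z 0 w = 0 &
    forall t, t \in `[0, T] -> Y t w = Y 0 w + F t w + Z t w]}.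

Definition semimartingale (T : R) (n : nat) (Y : R -> Omega -> 'rV[R]_n) : Prop :=
  [/\ adapted T Y, cadlag_process T Y &
      exists F Z : R -> Omega -> 'rV[R]_n,
        [/\ FV_process T F, local_martingale T Z & decomposition T Y F Z]].

End processes.

Section rode.
Context (R : realType) (d k : nat).
Implicit Types (f : R -> 'rV[R]_d -> 'rV[R]_k -> 'rV[R]_d) (T : R).

Definition standing_hypothesis (d0 : measure_display)
    (Omega : measurableType d0) (P : probability Omega R)
    (Filt : R -> set_system Omega) T f (L : R -> R)
    (Y : R -> Omega -> 'rV[R]_k) (X0 : Omega -> 'rV[R]_d) : Prop :=
  [/\ {within [set z : R * 'rV[R]_d * 'rV[R]_k | z.1.1 \in `[0, T]],
        continuous (fun z => f z.1.1 z.1.2 z.2)},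
      (forall a b, 0 <= a -> a <= b -> L a <= L b) /\
      (forall t x1 x2 y, t \in `[0, T] ->
         enorm (f t x1 y - f t x2 y) <= L (enorm y) * enorm (x1 - x2)),
      usual_filtration P Filt,
      semimartingale P Filt T Y &
      random_vector X0].

Definition solves T f (x0 : 'rV[R]_d) (y : R -> 'rV[R]_k) (x : R -> 'rV[R]_d)
    : Prop :=
  (forall i, lebesgue_measure.-integrable `[0, T]
     (fun s => (f s (x s) (y s) 0 i)%:E)) /\
  (forall t, t \in `[0, T] -> forall i,
     x t 0 i = x0 0 i + \int[lebesgue_measure]_(s in `[0, t]) f s (x s) (y s) 0 i).

Definition unique_solution T f (x0 : 'rV[R]_d) (y : R -> 'rV[R]_k)
    (x : R -> 'rV[R]_d) : Prop :=
  solves T f x0 y x /\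
  forall z, solves T f x0 y z -> forall t, t \in `[0, T] -> z t = x t.

Definition pathwise_solution (d0 : measure_display)
    (Omega : measurableType d0) (P : probability Omega R) T f
    (X0 : Omega -> 'rV[R]_d) (Y : R -> Omega -> 'rV[R]_k)
    (X : R -> Omega -> 'rV[R]_d) : Prop :=
  {ae P, forall w, unique_solution T f (X0 w) (Y ^~ w) (X ^~ w)}.

Definition step T (N : nat) : R := T / N%:R.

Definition mesh T (N j : nat) : R := j%:R * step T N.

Fixpoint euler T f (N : nat) (x0 : 'rV[R]_d) (y : R -> 'rV[R]_k) (j : nat)
    : 'rV[R]_d :=
  if j is j'.+1 then
    let x := euler T f N x0 y j' in
    x + step T N *: f (mesh T N j') x (y (mesh T N j'))
  else x0.

End rode.

(* Main.v *)
Require Import Defs.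
From HB Require Import structures.
From mathcomp Require Import all_boot all_order all_algebra.
From mathcomp Require Import all_classical all_reals all_analysis.
From mathcomp Require Import measurable_realfun ring lra zify.
Set Implicit Arguments.
Unset Strict Implicit.
Unset Printing Implicit Defensive.
Import Order.TTheory GRing.Theory Num.Theory.
Import numFieldNormedType.Exports.
Local Open Scope classical_set_scope.
Local Open Scope ring_scope.

(** Compare the scheme with [N] steps with the scheme with [N * m] steps, both
started at the same point [x], and let [h] be the coarse step.  From a coarse
node [t] to a fine node [s] inside the same block, [f] changes by a Lipschitz
multiple of the current error, by [O(h)] from the drift and from time, by a
multiple of the increment of [F], by a multiple of the square of the increment
of [Z], and by the linear term [D_y f(t, X_t, Y_t) (Z_s - Z_t)].  Summed with
weight [h], the increments of [F] cost [h] times the total variation, and the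
squares cost [h] times the energy E|Z_T|^2, because martingale increments are
orthogonal ([refinement_error], [remainder_moment]).  For a deterministic [x]
the linear terms add up to [h] times a martingale transform, of bounded second
moment, and Gronwall's inequality gives the order 1.

The initial values are arbitrary random variables, which may anticipate the
noise, so the linear part [M(x)] has to be bounded at a random point [x].  This
is done by a bound that holds for all points of a dyadic grid at once,
[|M(x)| <= c (Q + 1 + |x|)] with an integrable [Q] whose expectation depends
neither on the mesh of the grid nor on [N] and [m] ([mart_field_chaining]).  Its
proof is a chaining argument.  As [D_yy f] is bounded, [D_y f] is 1/2-Hoelder in
[x] ([partial_holder]), so the increment of [M] between a grid point of level
[k] and its parent of level [k - 1] has coefficients of size [2^(-k/2)].  All
these increments together form one vector valued martingale transform, whose
size is measured by a weighted [l^(2q)] norm.  The square of that norm is smooth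
([wnorm2_smooth]): along a martingale its expectation grows at most like the sum
of the squared sizes of the jumps, with a constant that does not see the number
of coordinates ([E_wnorm2_transform]).  With [q] large compared to the dimension
the weights can be chosen summable, and the contributions of the levels decay
geometrically.

Three reductions remain.  The Euler map is Lipschitz in its starting point
([euler_lipschitz]), so the two initial values may be replaced by a common
rounding of [X_0] to a grid, at a cost of order [h] ([grid_round_approx],
[expected_refinement_any]).  When [m] tends to infinity, the fine scheme
converges to the solution along almost every path, because a cadlag path has
only finitely many oscillations larger than a given size ([euler_cvg_path]).
Fatou's lemma ([fatou_le_ae]) then transfers the bound to the solution. *)

(** * Euclidean norm and mean value inequalities *)

Section euclidean_norm.
Context (R : realType).

Lemma sum_mul_sq_le (I : finType) (a b : I -> R) :
  (\sum_i a i * b i) ^+ 2 <= (\sum_i a i ^+ 2) * (\sum_i b i ^+ 2).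
Proof.
set A := \sum_i a i ^+ 2; set B := \sum_i b i ^+ 2; set C := \sum_i a i * b i.
have B0 : 0 <= B by apply: sumr_ge0 => i _; rewrite sqr_ge0.
(* the component of [a] orthogonal to [b], scaled by [B] *)
have : 0 <= \sum_i (B * a i - C * b i) ^+ 2.
  by apply: sumr_ge0 => i _; rewrite sqr_ge0.
have -> : \sum_i (B * a i - C * b i) ^+ 2 = B * (A * B - C ^+ 2).
  transitivity (\sum_i (B ^+ 2 * a i ^+ 2 + (- (2 * B * C)) * (a i * b i)
                        + C ^+ 2 * b i ^+ 2)).
    by apply: eq_bigr => i _; ring.
  by rewrite !big_split /= -!mulr_sumr -/A -/B -/C; ring.
move=> h; rewrite -subr_ge0; move: B0; rewrite le_eqVlt => /predU1P[B0|B0].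
  suff -> : C = 0 by rewrite -B0 mulr0 expr0n /= subr0.
  rewrite /C big1 // => i _.
  have /eqP : b i ^+ 2 = 0.
    have := psumr_eq0P (fun i _ => sqr_ge0 (b i)) (esym B0).
    by apply.
  by rewrite sqrf_eq0 => /eqP ->; rewrite mulr0.
by move: h; rewrite pmulr_rge0.
Qed.

Context (n : nat).
Implicit Types u v : 'rV[R]_n.

Lemma enorm_ge0 v : 0 <= enorm v. Proof. exact: sqrtr_ge0. Qed.

Lemma enorm_sq v : enorm v ^+ 2 = \sum_i v 0 i ^+ 2.
Proof. by rewrite sqr_sqrtr// sumr_ge0// => i _; rewrite sqr_ge0. Qed.

Lemma dot_le_enorm u v : \sum_i u 0 i * v 0 i <= enorm u * enorm v.
Proof.
apply: le_trans (ler_norm _) _; rewrite -(@ler_sqr _ `|_|)// ?nnegrE//; last first.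
  by rewrite mulr_ge0 // enorm_ge0.
by rewrite exprMn !enorm_sq real_normK ?num_real// sum_mul_sq_le.
Qed.

Lemma enorm0 : enorm (0 : 'rV[R]_n) = 0.
Proof. by rewrite /enorm big1 ?sqrtr0// => i _; rewrite mxE expr0n. Qed.

Lemma enormN v : enorm (- v) = enorm v.
Proof. by congr Num.sqrt; apply: eq_bigr => i _; rewrite mxE sqrrN. Qed.

Lemma enormB u v : enorm (u - v) = enorm (v - u).
Proof. by rewrite -enormN opprB. Qed.

Lemma enormZ a v : enorm (a *: v) = `|a| * enorm v.
Proof.
rewrite -sqrtr_sqr -sqrtrM ?sqr_ge0//; congr Num.sqrt.
by rewrite mulr_sumr; apply: eq_bigr => i _; rewrite mxE exprMn.
Qed.

Lemma enormD u v : enorm (u + v) <= enorm u + enorm v.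
Proof.
rewrite -ler_sqr ?nnegrE ?addr_ge0 ?enorm_ge0// sqrrD !enorm_sq.
under eq_bigr do rewrite mxE sqrrD.
rewrite !big_split /= lerD2r lerD2l.
by rewrite mulr2n lerD// dot_le_enorm.
Qed.

Lemma enorm_sum (I : Type) (r : seq I) (Q : pred I) (g : I -> 'rV[R]_n) :
  enorm (\sum_(i <- r | Q i) g i) <= \sum_(i <- r | Q i) enorm (g i).
Proof.
elim/big_rec2: _ => [|i y x _ h]; first by rewrite enorm0.
by apply: le_trans (enormD _ _) _; rewrite lerD2l.
Qed.

Lemma enorm_dist_triangle u v w :
  enorm (u - w) <= enorm (u - v) + enorm (v - w).
Proof. by rewrite -[u - w](subrKA v); exact: enormD. Qed.

Lemma le_coord_enorm v i : `|v 0 i| <= enorm v.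
Proof.
rewrite -sqrtr_sqr ler_wsqrtr// (bigD1 i)//= lerDl.
by rewrite sumr_ge0// => j _; rewrite sqr_ge0.
Qed.

Lemma enorm_le_sum v : enorm v <= \sum_i `|v 0 i|.
Proof.
have S0 : 0 <= \sum_i `|v 0 i| by apply: sumr_ge0.
rewrite -ler_sqr ?nnegrE ?enorm_ge0// enorm_sq expr2 mulr_suml.
apply: ler_sum => i _; rewrite -(real_normK (num_real _)) expr2 ler_wpM2l//.
by rewrite (bigD1 i)//= lerDl sumr_ge0.
Qed.

Lemma enorm_delta (i : 'I_n) : enorm (delta_mx 0 i : 'rV[R]_n) = 1.
Proof.
rewrite /enorm (bigD1 i)//= mxE !eqxx expr1n big1 ?addr0 ?sqrtr1// => j ji.
by rewrite mxE (negbTE ji) andbF expr0n.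
Qed.

End euclidean_norm.

Section mean_value.
Context (R : realType).

(** The scalar mean value theorem, applied to the inner product of [g] with the
fixed vector [g b - g a], gives the constant [M] in the Euclidean norm without a
factor depending on the dimension. *)
Lemma mvt_enorm n (g dg : R -> 'rV[R]_n) (a b M : R) : a <= b ->
  (forall x, x \in `]a, b[ -> forall i,
     is_derive x 1 (fun s => g s 0 i) (dg x 0 i)) ->
  (forall i, {within `[a, b], continuous (fun s => g s 0 i)}) ->
  (forall x, x \in `]a, b[ -> enorm (dg x) <= M) ->
  enorm (g b - g a) <= M * (b - a).
Proof.
rewrite le_eqVlt => /predU1P[->|ab] gd gc dgM.
  by rewrite !subrr enorm0 mulr0.
set u := g b - g a.
pose phi s := \sum_i u 0 i * g s 0 i.
have phiE : phi = \sum_i (fun s => u 0 i * g s 0 i).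
  by apply/funext => s; rewrite fct_sumE.
have [x xab E] : exists2 x, x \in `]a, b[ &
    phi b - phi a = (\sum_i u 0 i * dg x 0 i) * (b - a).
  apply: MVT => // [x xab|].
    rewrite phiE; apply: is_derive_sum => i.
    have dgi := gd x xab i.
    exact: (@is_deriveZ _ _ _ (fun s => g s 0 i) (u 0 i) x 1 (dg x 0 i)).
  rewrite phiE; elim/big_ind: _ => [|h1 h2 c1 c2|i _] x.
  - exact: cst_continuous.
  - exact: (continuousD (c1 x) (c2 x)).
  - by apply: continuousM; [exact: cst_continuous|exact: gc].
have M0 : 0 <= M by apply: le_trans (dgM _ xab); exact: enorm_ge0.
have : enorm u ^+ 2 <= enorm u * (M * (b - a)).
  rewrite enorm_sq mulrA.
  have -> : \sum_i u 0 i ^+ 2 = phi b - phi a.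
    by rewrite -sumrB; apply: eq_bigr => i _; rewrite -mulrBr expr2 /u !mxE.
  rewrite E ler_wpM2r ?subr_ge0 ?(ltW ab)//.
  apply: le_trans (dot_le_enorm _ _) _.
  by rewrite ler_wpM2l ?enorm_ge0// dgM.
have := enorm_ge0 u; rewrite le_eqVlt => /predU1P[<- _|u0].
  by rewrite mulr_ge0// subr_ge0 ltW.
by rewrite expr2 ler_pM2l.
Qed.

End mean_value.

Section derivatives.
Context (R : realType).

Lemma is_derive_coord (m n : nat) (M : R -> 'M[R]_(m, n)) (t : R) dM i j :
  is_derive t 1 M dM -> is_derive t 1 (fun s => M s i j) (dM i j).
Proof.
move=> [Mt <-]; split; first by move/derivable_mxP : Mt; exact.
by rewrite derive_mx// mxE.
Qed.

Lemma is_derive_line (U V : normedModType R) (G : U -> V) (p z : U) (r : R) :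
  differentiable G (p + r *: z) ->
  is_derive r 1 (fun s => G (p + s *: z)) ('d G (p + r *: z) z).
Proof.
move=> dG.
have E : (fun h : R => h^-1 *: (((fun s => G (p + s *: z)) \o shift r) (h *: 1)
            - G (p + r *: z))) =
         (fun h => h^-1 *: ((G \o shift (p + r *: z)) (h *: z) - G (p + r *: z))).
  apply/funext => h /=; congr (_ *: (G _ - _)).
  by rewrite scaler1 scalerDl addrCA.
split; rewrite /derivable /derive /= E.
  exact: diff_derivable.
by rewrite -deriveE.
Qed.

(** At an interior point the neighbourhoods within the interval are the usual
ones, so the one-sided derivative is the ordinary one. *)
Lemma is_derive_in (V : normedModType R) (T : R) (g : R -> V) (t : R) :
  t \in `]0, T[ -> derivable_in T g t -> is_derive t 1 g (derive_in T g t).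
Proof.
rewrite in_itv /= => /andP[t0 tT] gt.
suff H : (fun h : R => h^-1 *: ((g \o shift t) (h *: 1) - g t)) @ 0^' -->
    derive_in T g t.
  by split; [apply/cvg_ex; exists (derive_in T g t)|apply/cvg_lim].
have incl : (fun h => h + t) @ 0^' `=>` within `[0, T] t^'.
  move=> A; case=> e /= e0 eA.
  exists (Num.min e (Num.min t (T - t))).
    by rewrite /= !lt_min e0 t0 subr_gt0.
  move=> h /=; rewrite sub0r normrN !lt_min => /and3P[he ht hT] h0.
  apply: eA => /=.
  - by rewrite opprD addrCA subrr addr0 normrN.
  - by rewrite -subr_eq0 addrK.
  - rewrite in_itv /=; apply/andP; split.
      by move: ht; rewrite ltr_norml => /andP[+ _]; lra.
    by move: hT; rewrite ltr_norml => /andP[_]; lra.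
have PF : ProperFilter (within `[0, T] t^').
  apply: Build_ProperFilter_ex => A /incl /= A0.
  have [h Ah] := @filter_ex _ ((0 : R)^') (Proper_dnbhs_numFieldType _) _ A0.
  by exists (h + t).
move: gt => /cvg_ex[l gl].
rewrite /derive_in (cvg_lim _ gl)//.
have E : (fun h : R => h^-1 *: ((g \o shift t) (h *: 1) - g t)) =
         (diff_quotient g t \o (fun h => h + t)).
  by apply/funext => h /=; rewrite /diff_quotient scaler1 addrK.
by rewrite E; exact: cvg_comp gl.
Qed.

Lemma derivable_in_continuous (V : normedModType R) (T : R) (g : R -> V) :
  (forall t, t \in `[0, T] -> derivable_in T g t) ->
  {within `[0, T], continuous g}.
Proof.
move=> gT; apply/subspace_continuousP => t tT.
have /cvg_ex[l /cvgrPdist_lt /(_ 1 ltr01)[e /= e0 gl]] := gT _ tT.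
apply/cvgrPdist_lt => eps eps0.
have l0 : 0 < `|l| + 1 by rewrite ltr_wpDl.
exists (Num.min e (eps / (`|l| + 1))); first by rewrite /= lt_min e0 divr_gt0.
move=> s /=; rewrite lt_min => /andP[se sl] sT.
have [->|st] := eqVneq s t; first by rewrite subrr normr0.
have {}gl := gl s se st sT.
have -> : g t - g s = (t - s) *: diff_quotient g t s.
  rewrite /diff_quotient scalerA -[t - s]opprB mulNr divff ?subr_eq0//.
  by rewrite scaleN1r opprB.
rewrite normrZ; apply: le_lt_trans (_ : `|t - s| * (`|l| + 1) < _).
  rewrite ler_wpM2l// -[diff_quotient _ _ _](subrK l).
  by rewrite (le_trans (ler_normD _ _))// addrC lerD2l distrC ltW.
by rewrite -ltr_pdivlMr.
Qed.

Lemma within_continuous_coord (n : nat) (A : set R) (g : R -> 'rV[R]_n) i :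
  {within A, continuous g} -> {within A, continuous (fun s => g s 0 i)}.
Proof.
move=> gA x; have := gA x.
by move=> /(@cvg_comp _ _ _ _ (fun M : 'rV[R]_n => M 0 i) _ _ _); apply;
  exact: coord_continuous.
Qed.

End derivatives.

Section field_regularity.
Context (R : realType) (d k : nat) (T : R).
Variable f : R -> 'rV[R]_d -> 'rV[R]_k -> 'rV[R]_d.

(** The mean value inequality only asks for derivatives inside the interval; the
one-sided derivatives at the end points serve through continuity there. *)
Lemma lipschitz_time (x : 'rV[R]_d) (y : 'rV[R]_k) (M s t : R) :
  C1_in T (fun t => f t x y) ->
  (forall t, t \in `[0, T] -> enorm (derive_in T (fun s => f s x y) t) <= M) ->
  0 <= s -> s <= t -> t <= T ->
  enorm (f t x y - f s x y) <= M * (t - s).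
Proof.
move=> [fd _] fM s0 st tT.
have sub r : r \in `]s, t[ -> r \in `]0, T[.
  by rewrite !in_itv /= => /andP[? ?]; apply/andP; split; lra.
have sub' r : r \in `]s, t[ -> r \in `[0, T].
  by rewrite !in_itv /= => /andP[? ?]; apply/andP; split; lra.
apply: (@mvt_enorm _ _ (fun t => f t x y) (derive_in T (fun t => f t x y))) => //.
- move=> r rst i; apply: is_derive_coord.
  by apply: is_derive_in; [exact: sub|exact/fd/sub'].
- move=> i; apply: within_continuous_coord.
  apply: continuous_subspaceW (derivable_in_continuous fd).
  by move=> r /=; rewrite !in_itv /= => /andP[? ?]; apply/andP; split; lra.
- by move=> r rst; exact/fM/sub'.
Qed.

Lemma opnorm_le (n m : nat) (A : {linear 'rV[R]_n -> 'rV[R]_m}) c :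
  (opnorm A <= c%:E)%E -> forall v, enorm (A v) <= c * enorm v.
Proof.
move=> Ac v; have := enorm_ge0 v; rewrite le_eqVlt => /predU1P[v0|v0].
  suff -> : v = 0 by rewrite linear0 !enorm0 mulr0.
  apply/rowP => i; rewrite mxE; apply/eqP; rewrite -normr_le0 v0.
  exact: le_coord_enorm.
rewrite -ler_pdivrMr// mulrC -[X in X * _]gtr0_norm ?invr_gt0// -enormZ -linearZ.
rewrite -lee_fin; apply: le_trans Ac; apply: ereal_sup_ubound.
exists ((enorm v)^-1 *: v) => //=.
by rewrite enormZ gtr0_norm ?invr_gt0// mulVf// gt_eqF.
Qed.

(** On the diagonal, homogeneity of degree 2 reduces the bound to the unit ball. *)
Lemma opnorm2_diag_le (n m : nat) (B : 'rV[R]_n -> 'rV[R]_n -> 'rV[R]_m) c :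
  (forall a u v, B (a *: u) (a *: v) = a ^+ 2 *: B u v) ->
  (opnorm2 B <= c%:E)%E -> forall v, enorm (B v v) <= c * enorm v ^+ 2.
Proof.
move=> Bh Bc v; have := enorm_ge0 v; rewrite le_eqVlt => /predU1P[v0|v0].
  have -> : v = 0.
    apply/rowP => i; rewrite mxE; apply/eqP; rewrite -normr_le0 v0.
    exact: le_coord_enorm.
  by have := Bh 0 0 0; rewrite !scale0r expr0n /= scale0r => ->; rewrite !enorm0 expr0n mulr0.
rewrite -ler_pdivrMr ?exprn_gt0// mulrC -exprVn.
rewrite -[X in X * _]ger0_norm ?sqr_ge0// -enormZ -Bh.
rewrite -lee_fin; apply: le_trans Bc; apply: ereal_sup_ubound.
exists ((enorm v)^-1 *: v, (enorm v)^-1 *: v) => //=.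
by rewrite enormZ gtr0_norm ?invr_gt0// mulVf// gt_eqF.
Qed.

Lemma mvt_line (n m : nat) (G : 'rV[R]_n -> 'rV[R]_m)
  (dG : R -> 'rV[R]_m) (p z : 'rV[R]_n) (M : R) :
  (forall (r : R) i, is_derive r 1 (fun r => G (p + r *: z) 0 i) (dG r 0 i)) ->
  (forall r, r \in `]0, 1[ -> enorm (dG r) <= M) ->
  enorm (G (p + z) - G p) <= M.
Proof.
move=> Gd GM.
have := @mvt_enorm _ _ (fun r => G (p + r *: z)) dG 0 1 M ler01.
rewrite scale1r scale0r addr0 subr0 mulr1; apply => //.
move=> i; apply: continuous_subspaceT => r.
exact/differentiable_continuous/derivable1_diffP.
Qed.

Lemma lipschitz_space (n m : nat) (G : 'rV[R]_n -> 'rV[R]_m) (c : R) :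
  (forall y, differentiable G y) ->
  (forall y, (opnorm ('d G y) <= c%:E)%E) ->
  forall y y', enorm (G y - G y') <= c * enorm (y - y').
Proof.
move=> Gd Gc y y'.
have := @mvt_line _ _ G (fun r => 'd G (y' + r *: (y - y')) (y - y')) y' (y - y')
   (c * enorm (y - y')).
rewrite subrKC; apply.
  by move=> r i; apply: is_derive_coord; apply: is_derive_line.
by move=> r _; apply: opnorm_le.
Qed.

(** The mean value inequality twice: along the segment from [y] to [y + z], first
for ['d G] applied to [z], then for [G] minus its linear part. *)
Lemma taylor_space (n m : nat) (G : 'rV[R]_n -> 'rV[R]_m) (c : R) :
  (forall y, differentiable G y) -> (forall y, differentiable (jacobian G) y) ->
  (forall y, (opnorm2 (diff2 G y) <= c%:E)%E) ->
  forall y z, enorm (G (y + z) - G y - 'd G y z) <= c * enorm z ^+ 2.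
Proof.
move=> Gd Jd Gc y z.
have c0 : 0 <= c * enorm z ^+ 2.
  apply: le_trans (opnorm2_diag_le _ (Gc y) z); first exact: enorm_ge0.
  by move=> a u v; rewrite /diff2 linearZ -scalemxAl -scalemxAr scalerA.
have dJ p : 'd G p z = z *m jacobian G p by rewrite -deriveEjacobian// deriveE.
have D2 (r : R) i : is_derive r 1 (fun r => ('d G (y + r *: z) z) 0 i)
    ((diff2 G (y + r *: z) z z) 0 i).
  under eq_fun do rewrite dJ mxE.
  rewrite /diff2 mxE.
  rewrite (_ : (fun _ => _) = \sum_j (fun r => z 0 j * jacobian G (y + r *: z) j i)).
    apply: is_derive_sum => j.
    have h : is_derive r 1 (fun r => jacobian G (y + r *: z) j i)
       ('d (jacobian G) (y + r *: z) z j i).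
      by apply: is_derive_coord; exact: is_derive_line.
    exact: (is_deriveZ (z 0 j) h).
  by apply/funext => s; rewrite fct_sumE.
have D1 r : r \in `]0, 1[ -> enorm ('d G (y + r *: z) z - 'd G y z) <= c * enorm z ^+ 2.
  rewrite in_itv /= => /andP[r0 r1].
  have := @mvt_enorm _ _ (fun r => 'd G (y + r *: z) z)
    (fun r => diff2 G (y + r *: z) z z) 0 r (c * enorm z ^+ 2) (ltW r0).
  rewrite scale0r addr0 => H.
  apply: le_trans (H (fun s _ => D2 s) _ _) _.
  - move=> i; apply: continuous_subspaceT => s.
    by apply/differentiable_continuous/derivable1_diffP; case: (D2 s i).
  - move=> s srange; apply: opnorm2_diag_le => // a u v.
    by rewrite /diff2 linearZ -scalemxAl -scalemxAr scalerA.
  - by rewrite subr0 ler_piMr// ltW.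
have D0 (r : R) i : is_derive r 1 (fun r => (G (y + r *: z) - r *: 'd G y z) 0 i)
    (('d G (y + r *: z) z - 'd G y z) 0 i).
  have h1 : is_derive r 1 (fun r => G (y + r *: z) 0 i) ('d G (y + r *: z) z 0 i).
    by apply: is_derive_coord; exact: is_derive_line.
  have h2 := @is_deriveZ R _ _ id ('d G y z 0 i) r 1 1 (is_derive_id r 1).
  have := is_deriveB h1 h2; rewrite scaler1 !mxE.
  by congr (is_derive _ _ _ _); apply/funext => u; rewrite !mxE /= mulrC.
have := @mvt_enorm _ _ (fun r => G (y + r *: z) - r *: 'd G y z)
  (fun r => 'd G (y + r *: z) z - 'd G y z) 0 1 (c * enorm z ^+ 2) ler01.
rewrite !scale1r !scale0r addr0 !subr0 mulr1 addrAC; apply=> [i|//].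
apply: continuous_subspaceT => s.
by apply/differentiable_continuous/derivable1_diffP; case: (D0 s i).
Qed.

End field_regularity.

(** * Measurability, expectation and square integrability *)

Section measurability.
Context (R : realType) (d0 : measure_display) (Omega : measurableType d0).

Lemma measurable_floor_eq (X : Omega -> R) (z : int) :
  measurable_fun setT X -> measurable [set w | Num.floor (X w) = z].
Proof.
move=> mX.
have -> : [set w | Num.floor (X w) = z] = X @^-1` `[z%:~R, (z + 1)%:~R[.
  apply/seteqP; split=> w /=; rewrite in_itv /=.
    by move=> <-; exact: floor_itv.
  by move=> /floor_def.
by rewrite -[X in measurable X]setTI; exact: mX.
Qed.

(** Rounding [U] down to the grid of mesh [1 / m] leaves countably many values, so
any function of the rounded vector is measurable; Lipschitz continuity makes
these functions converge to [g \o U].  Measurability of the coordinates thus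
suffices, and no sigma-algebra on the vectors is involved. *)
Lemma measurable_lipschitz_comp (n : nat) (U : Omega -> 'rV[R]_n)
    (g : 'rV[R]_n -> R) (c : R) :
  random_vector U -> (forall u v, `|g u - g v| <= c * enorm (u - v)) ->
  measurable_fun setT (g \o U).
Proof.
move=> mU gc.
pose z (m : nat) w : 'rV[int]_n := \row_i Num.floor (m.+1%:R * U w 0 i).
pose v (m : nat) (q : 'rV[int]_n) : 'rV[R]_n := \row_i ((q 0 i)%:~R / m.+1%:R).
have mz m q : measurable [set w | z m w = q].
  have -> : [set w | z m w = q] =
      \bigcap_(i in setT) [set w | Num.floor (m.+1%:R * U w 0 i) = q 0 i].
    apply/seteqP; split=> w /=; first by move=> <- i _ /=; rewrite mxE.
    by move=> H; apply/rowP => i; rewrite mxE; exact: H.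
  apply: fin_bigcap_measurable; first exact: finite_finset.
  move=> i _; apply: measurable_floor_eq.
  by apply: measurable_funM => //; exact: mU.
apply: (@measurable_fun_cvg _ _ _ _ (fun m w => g (v m (z m w)))).
  move=> m _ B mB; rewrite setTI.
  have -> : (fun w => g (v m (z m w))) @^-1` B =
      \bigcup_q (if `[< B (g (v m q)) >] then [set w | z m w = q] else set0).
    apply/seteqP; split=> w /=.
      by move=> Bw; exists (z m w) => //; rewrite asboolT.
    by move=> [q _]; case: asboolP => // Bq /= ->.
  apply: countable_bigcupT_measurable => [|q]; first exact: countableP.
  by case: asboolP => // _; exact: mz.
move=> w _; apply/cvgrPdist_le => e e0.
have dvU m : enorm (U w - v m (z m w)) <= n%:R / m.+1%:R.
    apply: le_trans (enorm_le_sum _) _.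
    apply: le_trans (ler_sum _ (_ : forall i, true -> _ <= m.+1%:R^-1)) _.
      move=> i _; rewrite !mxE.
      have := floor_itv (m.+1%:R * U w 0 i); set fl := (Num.floor _)%:~R.
      rewrite intrD => /andP[h1 h2].
      rewrite -[U w 0 i](mulKf (_ : m.+1%:R != 0)) ?pnatr_eq0//.
      rewrite mulrC -mulrBl normrM [X in _ * X]gtr0_norm ?invr_gt0 ?ltr0n//.
      rewrite ler_piMl ?invr_ge0// ger0_norm ?subr_ge0// lerBlDl ltW//.
    by rewrite sumr_const card_ord mulr_natl.
near=> m.
apply: le_trans (gc _ _) _.
apply: le_trans (_ : `|c| * (n%:R / m.+1%:R) <= _).
  apply: le_trans (ler_wpM2l (normr_ge0 c) (dvU m)).
  by rewrite ler_wpM2r ?enorm_ge0// ler_norm.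
rewrite mulrA ler_pdivrMr// -ler_pdivrMl//.
have mr : e^-1 * (`|c| * n%:R) <= m%:R by near: m; exact: nbhs_infty_ger.
by apply: le_trans mr _; rewrite ler_nat.
Unshelve. all: by end_near. Qed.

End measurability.

Section sub_sigma_algebra.
Context (R : realType) (d0 : measure_display) (Omega : measurableType d0).
Variables (G : set_system Omega).
Hypothesis sG : sigma_algebra setT G.

(** Seeing a sub-sigma-algebra as a measurable structure of its own makes the
stability lemmas for measurable functions available for [measurable_wrt]. *)
Lemma measurable_wrtP (X : Omega -> R) :
  measurable_wrt G X <-> measurable_fun (setT : set (g_sigma_algebraType G)) X.
Proof.
split=> [mX _ B mB|mX B mB].
  by rewrite setTI; apply: sub_sigma_algebra; exact: mX.
have := mX measurableT B mB; rewrite setTI /measurable /=.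
by rewrite (sigma_algebra_id sG).
Qed.

Lemma measurable_wrt_sub (X : Omega -> R) : G `<=` measurable ->
  measurable_wrt G X -> measurable_fun setT X.
Proof. by move=> Gm mX _ B mB; rewrite setTI; exact/Gm/mX. Qed.

End sub_sigma_algebra.

Section expectation.
Context (R : realType) (d0 : measure_display) (Omega : measurableType d0).
Variable P : probability Omega R.
Implicit Types X Y : Omega -> R.

Definition L1 X := P.-integrable setT (EFin \o X).
Definition E X := (\int[P]_w X w)%R.
Definition L2 X := measurable_fun setT X /\ L1 (fun w => X w ^+ 2).

Lemma L1_measurable X : L1 X -> measurable_fun setT X.
Proof. by move=> /integrableP[/measurable_EFinP]. Qed.

Lemma L1_cst c : L1 (fun=> c).
Proof. by apply: finite_measure_integrable_cst. Qed.

Lemma L1D X Y : L1 X -> L1 Y -> L1 (fun w => X w + Y w).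
Proof. by move=> iX iY; have := integrableD measurableT iX iY. Qed.

Lemma L1B X Y : L1 X -> L1 Y -> L1 (fun w => X w - Y w).
Proof. by move=> iX iY; have := integrableB measurableT iX iY. Qed.

Lemma L1Z c X : L1 X -> L1 (fun w => c * X w).
Proof. by move=> iX; have := integrableZl measurableT c iX. Qed.

Lemma L1_sum (I : Type) (r : seq I) (Q : pred I) (X : I -> Omega -> R) :
  (forall i, Q i -> L1 (X i)) -> L1 (fun w => \sum_(i <- r | Q i) X i w).
Proof.
move=> iX; have := integrable_sum measurableT r iX.
by apply: eq_integrable => // w _ /=; rewrite sumEFin.
Qed.

Lemma L1_norm X : L1 X -> L1 (fun w => `|X w|).
Proof. by move=> iX; have := integrable_norm iX. Qed.

Lemma L1_dom X Y : measurable_fun setT X -> (forall w, `|X w| <= Y w) ->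
  L1 Y -> L1 X.
Proof.
move=> mX XY iY; apply: le_integrable iY => //; first exact/measurable_EFinP.
by move=> w _ /=; rewrite lee_fin (le_trans (XY w))// ler_norm.
Qed.

Lemma E_cst c : E (fun=> c) = c.
Proof. by rewrite /E Rintegral_cst//= probability_setT mulr1. Qed.

Lemma ED X Y : L1 X -> L1 Y -> E (fun w => X w + Y w) = E X + E Y.
Proof. by move=> iX iY; rewrite /E RintegralD. Qed.

Lemma EB X Y : L1 X -> L1 Y -> E (fun w => X w - Y w) = E X - E Y.
Proof. by move=> iX iY; rewrite /E RintegralB. Qed.

Lemma EZ c X : L1 X -> E (fun w => c * X w) = c * E X.
Proof. by move=> iX; rewrite /E RintegralZl. Qed.

Lemma E_sum (I : Type) (r : seq I) (X : I -> Omega -> R) :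
  (forall i, L1 (X i)) ->
  E (fun w => \sum_(i <- r) X i w) = \sum_(i <- r) E (X i).
Proof.
move=> iX; elim: r => [|i r IH].
  by under [in LHS]eq_fun do rewrite big_nil; rewrite big_nil E_cst.
under [in LHS]eq_fun do rewrite big_cons.
by rewrite ED// ?big_cons ?IH//; apply: L1_sum => ? _.
Qed.

Lemma E_le X Y : L1 X -> L1 Y -> (forall w, X w <= Y w) -> E X <= E Y.
Proof. by move=> iX iY XY; apply: le_Rintegral. Qed.

Lemma E_ge0 X : (forall w, 0 <= X w) -> 0 <= E X.
Proof. by move=> X0; apply: Rintegral_ge0. Qed.

Lemma E_norm_le X : L1 X -> `|E X| <= E (fun w => `|X w|).
Proof. by move=> iX; apply: le_normr_Rintegral. Qed.

Lemma EFin_E X : L1 X -> (E X)%:E = (\int[P]_w (X w)%:E)%E.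
Proof. by move=> iX; rewrite /E /Rintegral fineK// integrable_fin_num. Qed.

Lemma L1_ge0 X : measurable_fun setT X -> (forall w, 0 <= X w) ->
  (\int[P]_w (X w)%:E < +oo)%E -> L1 X.
Proof.
move=> mX X0 Xoo; apply/integrableP; split; first exact/measurable_EFinP.
by under eq_integral do rewrite /= ger0_norm//.
Qed.

Lemma E_dominated (f_ : nat -> Omega -> R) X Y :
  (forall n, measurable_fun setT (f_ n)) -> (forall w, f_ ^~ w @ \oo --> X w) ->
  (forall n w, `|f_ n w| <= Y w) -> L1 Y -> L1 X /\ E (f_ n) @[n --> \oo] --> E X.
Proof.
move=> mf fX fY iY.
have mX : measurable_fun setT X by exact: measurable_fun_cvg (fun w _ => fX w).
have if_ n : L1 (f_ n) by exact: L1_dom (fY n) iY.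
have fXE w : (f_ n w)%:E @[n --> \oo] --> (X w)%:E.
  by apply: cvg_EFin; [exact: nearW|exact: fX].
have [|||//||iX _ cX] := @dominated_convergence _ _ _ P setT
    measurableT (fun n => EFin \o f_ n) (EFin \o X) (EFin \o Y).
- by move=> n; exact/measurable_EFinP.
- exact/measurable_EFinP.
- by apply: aeW => w _; exact: fXE.
- by apply: aeW => w n _ /=; rewrite lee_fin.
by split=> //; apply: fine_cvg; rewrite EFin_E.
Qed.

End expectation.

Section square_integrable.
Context (R : realType) (d0 : measure_display) (Omega : measurableType d0).
Variable P : probability Omega R.
Implicit Types X Y : Omega -> R.

Lemma L2_L1 X : L2 P X -> L1 P X.
Proof.
move=> [mX iX]; apply: L1_dom (L1D (L1_cst P 1) iX) => // w.
by rewrite -(real_normK (num_real (X w))); nra.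
Qed.

Lemma L2M_L1 X Y : L2 P X -> L2 P Y -> L1 P (fun w => X w * Y w).
Proof.
move=> [mX iX] [mY iY]; apply: L1_dom (L1D iX iY).
  exact: measurable_funM.
move=> w; rewrite normrM -(real_normK (num_real (X w))).
by rewrite -(real_normK (num_real (Y w))); nra.
Qed.

Lemma L2_dom X Y : measurable_fun setT X -> (forall w, `|X w| <= Y w) ->
  L2 P Y -> L2 P X.
Proof.
move=> mX XY [mY iY]; split=> //; apply: L1_dom iY; first exact: measurable_funX.
by move=> w; rewrite normrX lerXn2r ?nnegrE// (le_trans _ (XY w)).
Qed.

Lemma L2_cst c : L2 P (fun=> c).
Proof. by split; [exact: measurable_cst|exact: L1_cst]. Qed.

Lemma L2D X Y : L2 P X -> L2 P Y -> L2 P (fun w => X w + Y w).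
Proof.
move=> [mX iX] [mY iY]; split; first exact: measurable_funD.
apply: L1_dom (L1Z 2 (L1D iX iY)) => [|w].
  by apply: measurable_funX; exact: measurable_funD.
by rewrite ger0_norm ?sqr_ge0//; have := sqr_ge0 (X w - Y w); nra.
Qed.

Lemma L2Z c X : L2 P X -> L2 P (fun w => c * X w).
Proof.
move=> [mX iX]; split; first exact: measurable_funM.
by under eq_fun do rewrite exprMn; exact: L1Z.
Qed.

Lemma L2B X Y : L2 P X -> L2 P Y -> L2 P (fun w => X w - Y w).
Proof.
move=> iX iY; have := L2D iX (L2Z (-1) iY).
by under eq_fun do rewrite mulN1r.
Qed.

Lemma L2_sum (I : Type) (r : seq I) (Q : pred I) (X : I -> Omega -> R) :
  (forall i, Q i -> L2 P (X i)) -> L2 P (fun w => \sum_(i <- r | Q i) X i w).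
Proof.
move=> iX; elim: r => [|i r IH].
  by under eq_fun do rewrite big_nil; exact: L2_cst.
under eq_fun do rewrite big_cons.
have [Qi|//] := boolP (Q i).
by apply: L2D => //; exact: iX.
Qed.

Lemma L2_norm X : L2 P X -> L2 P (fun w => `|X w|).
Proof.
move=> [mX iX]; split; first exact: measurableT_comp.
by under eq_fun do rewrite real_normK ?num_real//.
Qed.

Lemma L2_bounded_mul c (A X : Omega -> R) : measurable_fun setT A -> (forall w, `|A w| <= c) ->
  L2 P X -> L2 P (fun w => A w * X w).
Proof.
move=> mA Ac iX; apply: L2_dom (L2Z c (L2_norm iX)).
  by apply: measurable_funM => //; case: iX.
by move=> w; rewrite normrM ler_wpM2r.
Qed.

End square_integrable.

Lemma le_inv_nat_all (R : realType) (a c : R) :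
  (forall n, a <= c / n.+1%:R) -> a <= 0.
Proof.
move=> H; rewrite leNgt; apply/negP => a0.
have c0 : 0 <= c by have := H 0; rewrite divr1; lra.
have := archi_boundP (divr_ge0 c0 (ltW a0)); set n := Num.bound _.
rewrite ltr_pdivrMr// => cn; have := H n.
by rewrite ler_pdivlMr// -natr1; lra.
Qed.

Section lower_integral.
Local Open Scope ereal_scope.
Context (R : realType) (d0 : measure_display) (Omega : measurableType d0).
Variable P : probability Omega R.
Implicit Types f g : Omega -> \bar R.

(** The integral of a nonnegative function is a supremum over simple functions
below it, hence monotone whether or not the functions are measurable.  This is
what allows integrals of the solution and of the variation, which are limits and
suprema of possibly nonmeasurable functions, to be handled. *)
Lemma le_lower_integral f g : (forall w, 0 <= f w) -> (forall w, f w <= g w) ->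
  \int[P]_w f w <= \int[P]_w g w.
Proof.
move=> f0 fg; have g0 w : 0 <= g w by apply: le_trans (fg w).
rewrite !ge0_integralTE//; apply: le_ereal_sup => _ [h /= hf <-].
by exists h => // w; exact: le_trans (hf w) (fg w).
Qed.

(** The exceptional null set is absorbed by giving [g] the value [+oo] on it, which
keeps [g] measurable and its integral unchanged. *)
Lemma le_lower_integral_ae f g : (forall w, 0 <= f w) -> (forall w, 0 <= g w) ->
  measurable_fun setT g -> {ae P, forall w, f w <= g w} ->
  \int[P]_w f w <= \int[P]_w g w.
Proof.
move=> f0 g0 mg [N [mN N0 fgN]].
pose h w := if w \in N then +oo else g w.
have mh : measurable_fun setT h.
  apply: measurable_fun_ifT => //.
  by apply: (measurable_fun_bool true); rewrite setTI preimage_mem_true.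
have h0 w : 0 <= h w by rewrite /h; case: ifP.
apply: (@le_trans _ _ (\int[P]_w h w)).
  apply: le_lower_integral => // w; rewrite /h; case: ifPn => [_|]; first exact: leey.
  by rewrite notin_setE => wN; apply: contrapT => fw; exact/wN/fgN.
rewrite le_eqVlt; apply/orP; left; apply/eqP.
apply: ge0_ae_eq_integral => //; exists N; split=> // w /=.
rewrite /h => H; apply: contrapT => wN; apply: H => _.
by rewrite memNset.
Qed.

(** The limit is compared almost everywhere with the measurable function [limn_einf]
of the sequence, to which the usual lemma applies. *)
Lemma fatou_le_ae (f_ : nat -> Omega -> R) (X : Omega -> R) (c : R) :
  (forall w, 0 <= X w)%R ->
  (forall n, measurable_fun setT (f_ n)) -> (forall n w, 0 <= f_ n w)%R ->
  (forall n, \int[P]_w (f_ n w)%:E <= c%:E) ->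
  {ae P, forall w, f_ n w @[n --> \oo] --> X w} ->
  \int[P]_w (X w)%:E <= c%:E.
Proof.
move=> X0 mf f0 fc fX.
pose g w := limn_einf (fun n => (f_ n w)%:E).
have mfE n : measurable_fun setT (fun w => (f_ n w)%:E) by exact/measurable_EFinP.
apply: (@le_trans _ _ (\int[P]_w g w)).
  apply: le_lower_integral_ae => //.
  - move=> w; rewrite /g limn_einf_lim; apply: lime_ge; first exact: is_cvg_einfs.
    by apply: nearW => n; apply: le_ereal_inf_tmp => _ [m _ <-]; rewrite lee_fin.
  - apply: (@measurableT_comp _ _ _ _ _ _ (@oppe R)) => //.
    by apply: measurable_fun_limn_esup => n; exact: measurableT_comp.
  - apply: filterS fX => w fXw.
    have fXE : (f_ n w)%:E @[n --> \oo] --> (X w)%:E.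
      by apply: cvg_EFin; [exact: nearW|exact: fXw].
    by rewrite /g (cvg_limn_einf_sup fXE).1.
apply: le_trans (fatou P measurableT mfE _) _.
  by move=> n w _; rewrite lee_fin.
rewrite limn_einf_lim; apply: lime_le; first exact: is_cvg_einfs.
apply: nearW => n; apply: le_trans (fc n).
by apply: ereal_inf_lbound; exists n => //=.
Qed.

End lower_integral.

(** * Orthogonality of conditional expectations *)

Section conditional_expectation.
Context (R : realType) (d0 : measure_display) (Omega : measurableType d0).
Variables (P : probability Omega R) (G : set_system Omega).
Hypothesis sG : sigma_algebra setT G.
Hypothesis Gm : G `<=` measurable.

(** Approximating [xi] from below by a simple [G]-measurable function with error
[1 / n.+1] reduces to indicators, where the hypothesis applies. *)
Lemma orth_bounded (D xi : Omega -> R) (B : R) :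
  L1 P D -> (forall A, G A -> \int[P]_(w in A) D w = 0) ->
  measurable_wrt G xi -> (forall w, `|xi w| <= B) ->
  E P (fun w => xi w * D w) = 0.
Proof.
move=> iD D0 mxi xiB.
have mxi' := measurable_wrt_sub Gm mxi.
have iP : L1 P (fun w => xi w * D w).
  apply: L1_dom (L1Z B (L1_norm iD)).
    by apply: measurable_funM => //; exact: L1_measurable iD.
  by move=> w; rewrite normrM ler_wpM2r.
apply/eqP; rewrite -normr_le0; apply: (@le_inv_nat_all _ _ (E P (fun w => `|D w|))).
move=> n.
(* [r w] is the index of the cell of width [1 / n.+1] that contains [xi w], counted
   from the lower bound [- B], and [c j] is the left end of cell [j] *)
pose r w := Num.truncn (n.+1%:R * (xi w + B)).
pose m := (Num.truncn (n.+1%:R * (B + B))).+1.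
pose c (j : nat) : R := j%:R / n.+1%:R - B.
have n0 : 0 < n.+1%:R :> R by rewrite ltr0n.
have xi0 w : 0 <= n.+1%:R * (xi w + B).
  by rewrite mulr_ge0// -lerBlDr sub0r; have := xiB w; rewrite ler_norml => /andP[].
have rm w : (r w < m)%N.
  rewrite ltnS; apply: le_truncn; rewrite ler_pM2l// lerD2r.
  by have := xiB w; rewrite ler_norml => /andP[].
have rc w : 0 <= xi w - c (r w) <= n.+1%:R^-1.
  have /andP[] := truncn_itv (xi0 w); rewrite /c -/(r w); set rw := r w => h1 h2.
  have -> : xi w - (rw%:R / n.+1%:R - B) = (n.+1%:R * (xi w + B) - rw%:R) / n.+1%:R.
    by field; rewrite nat1r pnatr_eq0.
  rewrite divr_ge0 ?subr_ge0 ?(ltW n0)// -[leRHS]mul1r ler_wpM2r ?invr_ge0 ?(ltW n0)//.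
  by rewrite -natr1 in h2; lra.
have mA j : G [set w | r w = j].
  have -> : [set w | r w = j] =
      xi @^-1` `[j%:R / n.+1%:R - B, j.+1%:R / n.+1%:R - B[.
    apply/seteqP; split=> w /=; rewrite in_itv /= !ltrBrDr !lerBlDr.
      move=> <-; have := truncn_itv (xi0 w); rewrite -/(r w).
      by rewrite ler_pdivrMr// ltr_pdivlMr// ![_ * n.+1%:R]mulrC.
    rewrite ler_pdivrMr// ltr_pdivlMr// ![_ * n.+1%:R]mulrC => H.
    exact: truncn_def.
  exact: mxi.
have Dj j : L1 P (fun w => \1_[set w | r w = j] w * D w) /\
    E P (fun w => \1_[set w | r w = j] w * D w) = 0.
  split.
    apply: L1_dom (L1_norm iD).
      apply: measurable_funM; last exact: L1_measurable iD.
      exact/measurable_indic/Gm.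
    move=> w; rewrite normrM ler_piMl// indicE.
    by case: (_ \in _); rewrite ?normr0 ?normr1.
  rewrite -[RHS](D0 _ (mA j)) Rintegral_mkcond; congr (E P _).
  apply/funext => w; rewrite patchE indicE.
  by case: ifPn; rewrite ?mul1r ?mul0r.
have cE w : c (r w) * D w = \sum_(j < m) c j * (\1_[set w | r w = j] w * D w).
  rewrite (bigD1 (Ordinal (rm w)))//= indicE mem_set// mul1r big1 ?addr0// => j jr.
  rewrite indicE memNset ?mul0r ?mulr0// => rj.
  by move/eqP : jr; apply; apply: val_inj.
have icD : L1 P (fun w => c (r w) * D w).
  by under eq_fun do rewrite cE; apply: L1_sum => j _; apply: L1Z; case: (Dj j).
have EcD : E P (fun w => c (r w) * D w) = 0.
  under eq_fun do rewrite cE.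
  rewrite E_sum => [|j]; last by apply: L1Z; case: (Dj j).
  by rewrite big1// => j _; case: (Dj j) => iDj EDj; rewrite EZ// EDj mulr0.
rewrite -[E P (fun w => xi w * D w)]subr0 -EcD -EB//.
apply: le_trans (E_norm_le (L1B iP icD)) _.
rewrite mulrC -EZ ?L1_norm//; apply: E_le.
- exact/L1_norm/L1B.
- exact/L1Z/L1_norm.
move=> w; rewrite -mulrBl normrM ler_wpM2r//.
by have /andP[h1 h2] := rc w; rewrite ger0_norm.
Qed.

Definition clip (R : realType) (n x : R) : R := Num.max (- n) (Num.min n x).

Lemma clip_le (n x : R) : 0 <= n -> `|clip n x| <= n.
Proof.
move=> n0; rewrite ler_norml /clip le_max lexx /= ge_max ge_min lexx /= andbT.
lra.
Qed.

Lemma clip_id (n x : R) : `|x| <= n -> clip n x = x.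
Proof. by rewrite ler_norml /clip => /andP[h1 h2]; rewrite min_r// max_r. Qed.

Lemma clip_norm (n x : R) : 0 <= n -> `|clip n x| <= `|x|.
Proof.
move=> n0; have [xn|/ltW nx] := leP `|x| n; first by rewrite clip_id.
exact: le_trans (clip_le _ n0) nx.
Qed.

Lemma clip_sq (n x : R) : 0 <= n -> clip n x ^+ 2 <= clip n x * x.
Proof.
move=> n0; have [xn|nx] := leP `|x| n; first by rewrite clip_id// expr2.
have [x0|x0] := leP 0 x.
  rewrite ger0_norm// in nx; rewrite /clip min_l ?(ltW nx)// max_r; nra.
rewrite ltr0_norm// in nx; rewrite /clip min_r; last lra.
by rewrite max_l; nra.
Qed.

Lemma measurable_clip n : measurable_fun setT (@clip R n).
Proof.
by apply: measurable_maxr => //; apply: measurable_minr => //.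
Qed.

Lemma clip_cvg (x : R) : clip n.+1%:R x @[n --> \oo] --> x.
Proof.
apply: cvg_near_cst; near=> n; apply: clip_id.
have nx : `|x| <= n%:R by near: n; exact: nbhs_infty_ger.
by apply: le_trans nx _; rewrite ler_nat.
Unshelve. all: by end_near. Qed.

Lemma measurable_wrt_clip n xi : measurable_wrt G xi ->
  measurable_wrt G (fun w => @clip R n (xi w)).
Proof.
move=> mxi B mB; have := mxi (clip n @^-1` B); apply.
by rewrite -[X in measurable X]setTI; exact: measurable_clip.
Qed.

(** Dominated convergence along the truncations of [xi], which are bounded. *)
Lemma orth_L2 (D xi : Omega -> R) :
  L2 P D -> (forall A, G A -> \int[P]_(w in A) D w = 0) ->
  measurable_wrt G xi -> L2 P xi ->
  E P (fun w => xi w * D w) = 0.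
Proof.
move=> iD D0 mxi ixi.
have mxi' := measurable_wrt_sub Gm mxi.
have [] := @E_dominated _ _ _ P (fun n w => clip n.+1%:R (xi w) * D w)
   (fun w => xi w * D w) (fun w => `|xi w| * `|D w|).
- move=> n; apply: measurable_funM; last by case: iD.
  exact: measurableT_comp (measurable_clip _) mxi'.
- by move=> w; apply: cvgM; [exact: clip_cvg|exact: cvg_cst].
- by move=> n w; rewrite normrM ler_wpM2r// clip_norm.
- by apply: L2M_L1; exact: L2_norm.
move=> _; have E0 n : E P (fun w => clip n.+1%:R (xi w) * D w) = 0.
  apply: (@orth_bounded _ _ n.+1%:R) => //; first exact: L2_L1.
    exact: measurable_wrt_clip.
  by move=> w; exact: clip_le.
under eq_cvg do rewrite E0.
by move=> /cvg_lim <- //; rewrite lim_cst.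
Qed.

Context (X W : Omega -> R).
Hypothesis XW : is_cond_exp P G X W.

Let D w := X w - W w.

Let iD : L1 P D.
Proof. by case: XW => iX iW _ _; exact: L1B. Qed.

Let D0 A : G A -> \int[P]_(w in A) D w = 0.
Proof.
move=> GA; case: XW => iX iW _ /(_ A GA) XWA.
by rewrite RintegralB ?XWA ?subrr//; [exact: Gm|apply: integrableS iX|apply: integrableS iW];
  rewrite //; exact: Gm.
Qed.

(** Testing with the truncation [V] of [W] gives
[E V^2 <= E (V W) = E (V X) <= (E V^2 + E X^2) / 2], hence [E V^2 <= E X^2];
Fatou removes the truncation.  Square integrability of [W] is part of the
conclusion, so the test function has to be bounded. *)
Lemma cond_exp_sq : L2 P X -> L2 P W /\ E P (fun w => W w ^+ 2) <= E P (fun w => X w ^+ 2).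
Proof.
move=> iX; have [iX1 iW mW _] := XW.
have mW' := measurable_wrt_sub Gm mW.
have mWn n : measurable_fun setT (fun w => clip n.+1%:R (W w)).
  exact: measurableT_comp (measurable_clip _) mW'.
have iWn n : L2 P (fun w => clip n.+1%:R (W w)).
  by apply: L2_dom (L2_cst P n.+1%:R) => // w; exact: clip_le.
have bound n : E P (fun w => clip n.+1%:R (W w) ^+ 2) <= E P (fun w => X w ^+ 2).
  set V := fun w => clip n.+1%:R (W w).
  have iVX : L1 P (fun w => V w * X w) by apply: L2M_L1 => //; exact: iWn.
  have iVW : L1 P (fun w => V w * W w).
    apply: L1_dom (L1Z n.+1%:R (L1_norm iW)); first exact: measurable_funM (mWn n) mW'.
    by move=> w; rewrite normrM ler_wpM2r// clip_le.
  have EVW : E P (fun w => V w * W w) = E P (fun w => V w * X w).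
    have := @orth_bounded D V n.+1%:R iD D0 (measurable_wrt_clip _ mW)
      (fun w => clip_le _ (ler0n _ _)).
    under eq_fun do rewrite /D mulrBr.
    by rewrite EB// => /eqP; rewrite subr_eq0 => /eqP.
  have h1 : E P (fun w => V w ^+ 2) <= E P (fun w => V w * W w).
    by apply: E_le => //; [case: (iWn n)|move=> w; exact: clip_sq].
  have h2 : E P (fun w => V w * X w) <=
      E P (fun w => 2^-1 * V w ^+ 2 + 2^-1 * X w ^+ 2).
    apply: E_le => //; first by apply: L1D; apply: L1Z; [case: (iWn n)|case: iX].
    by move=> w; have := sqr_ge0 (V w - X w); rewrite sqrrB; lra.
  have [_ iV2] := iWn n; have [_ iX2] := iX.
  rewrite ED ?EZ// in h2; [|exact: L1Z|exact: L1Z].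
  by rewrite -EVW in h2; move: h1 h2; rewrite -/V; lra.
have W2 : (\int[P]_w (W w ^+ 2)%:E <= (E P (fun w => X w ^+ 2))%:E)%E.
  apply: (@fatou_le_ae _ _ _ _ (fun n w => clip n.+1%:R (W w) ^+ 2)).
  - by move=> w; exact: sqr_ge0.
  - by move=> n; exact: measurable_funX.
  - by move=> n w; exact: sqr_ge0.
  - by move=> n; rewrite -EFin_E ?lee_fin//; case: (iWn n).
  - apply: aeW => w.
    by under eq_fun do rewrite expr2; rewrite expr2; apply: cvgM; exact: clip_cvg.
have iW2 : L2 P W.
  split=> //; apply: L1_ge0; first exact: measurable_funX.
    by move=> w; exact: sqr_ge0.
  by apply: le_lt_trans W2 _; rewrite ltry.
by split=> //; rewrite -lee_fin EFin_E//; case: iW2.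
Qed.

(** Pythagoras: [X - W] is orthogonal to [W]. *)
Lemma cond_exp_increment_sq : L2 P X ->
  E P (fun w => (X w - W w) ^+ 2) = E P (fun w => X w ^+ 2) - E P (fun w => W w ^+ 2).
Proof.
move=> iX; have [iW _] := cond_exp_sq iX; have [_ _ mW _] := XW.
have EWD : E P (fun w => W w * D w) = 0 by apply: orth_L2 => //; exact: L2B.
have -> : (fun w => (X w - W w) ^+ 2) =
    (fun w => (X w ^+ 2 - W w ^+ 2) - 2 * (W w * D w)).
  by apply/funext => w; rewrite /D; ring.
have iWD : L1 P (fun w => W w * D w) by apply: L2M_L1 => //; exact: L2B.
by rewrite EB ?EZ// ?EWD ?mulr0 ?subr0 ?EB//; [case: iX|case: iW|
  apply: L1B; [case: iX|case: iW]|exact: L1Z].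
Qed.

End conditional_expectation.

(** * Smoothness of weighted power norms *)

Section smooth_norm.
Context (R : realType).

Lemma bernoulli_le (q : nat) (x : R) : -1 <= x -> 1 + x *+ q <= (1 + x) ^+ q.
Proof.
move=> x1; elim: q => [|q IH]; first by rewrite mulr0n addr0 expr0.
have x10 : 0 <= 1 + x by lra.
apply: le_trans (_ : (1 + x) * (1 + x *+ q) <= _); last by rewrite exprS ler_wpM2l.
rewrite mulrS; have : 0 <= x * (x *+ q) by rewrite mulrnAr mulrn_wge0// -expr2 sqr_ge0.
by lra.
Qed.

(** A [q]-th root is bounded by its tangent at 1. *)
Lemma le_root_bernoulli (q : nat) (v D : R) : (0 < q)%N -> 0 <= v ->
  v ^+ q <= 1 + D -> v <= 1 + D / q%:R.
Proof.
move=> q0 v0 vD.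
have qp : 0 < q%:R :> R by rewrite ltr0n.
have D1 : -1 <= D by have := exprn_ge0 q v0; lra.
have q1 : 1 <= q%:R :> R by rewrite ler1n.
have Dq : -1 <= D / q%:R by rewrite ler_pdivlMr//; lra.
have w0 : 0 <= 1 + D / q%:R by lra.
rewrite -(@ler_pXn2r _ q)// ?nnegrE//.
apply: le_trans vD (le_trans _ (bernoulli_le q Dq)).
by rewrite -[_ / _ *+ _]mulr_natr divfK// gt_eqF.
Qed.

Lemma exprD_even_le (n : nat) (x y : R) : ~~ odd n ->
  (x + y) ^+ n <= 2 ^+ n * (x ^+ n + y ^+ n).
Proof.
move=> en; wlog xy : x y / `|x| <= `|y|.
  have [/ltW yx|xy] := ltP `|y| `|x|; last by apply.
  by move=> /(_ y x yx); rewrite addrC [_ ^+ n + _]addrC.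
have -> : (x + y) ^+ n = `|x + y| ^+ n by rewrite -normrX ger0_norm ?exprn_even_ge0.
apply: le_trans (_ : (2 * `|y|) ^+ n <= _).
  rewrite lerXn2r ?nnegrE ?mulr_ge0//; apply: le_trans (ler_normD _ _) _; lra.
rewrite exprMn ler_wpM2l ?exprn_ge0// -normrX ger0_norm ?exprn_even_ge0//.
by rewrite lerDr exprn_even_ge0.
Qed.

Lemma mul_norm_pow_le (n i : nat) (x y : R) : ~~ odd n -> (i <= n)%N ->
  `|x| ^+ (n - i) * `|y| ^+ i <= x ^+ n + y ^+ n.
Proof.
move=> en ni; have ex : x ^+ n = `|x| ^+ n by rewrite -normrX ger0_norm ?exprn_even_ge0.
have ey : y ^+ n = `|y| ^+ n by rewrite -normrX ger0_norm ?exprn_even_ge0.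
rewrite ex ey; have [xy|/ltW yx] := leP `|x| `|y|.
  apply: (@le_trans _ _ (`|y| ^+ (n - i) * `|y| ^+ i)).
    by rewrite ler_wpM2r ?exprn_ge0// lerXn2r ?nnegrE.
  by rewrite -exprD subnK// lerDr exprn_ge0.
apply: (@le_trans _ _ (`|x| ^+ (n - i) * `|x| ^+ i)).
  by rewrite ler_wpM2l ?exprn_ge0// lerXn2r ?nnegrE.
by rewrite -exprD subnK// lerDl exprn_ge0.
Qed.

(** The terms of degree at least 2 of the binomial expansion are bounded by
[r ^+ 2] times the larger of the two even powers. *)
Lemma taylor_pow_le (n : nat) (x y r : R) : ~~ odd n -> (0 < n)%N -> 0 <= r <= 1 ->
  (x + r * y) ^+ n <=
  x ^+ n + n%:R * r * (x ^+ n.-1 * y) + 2 ^+ n * r ^+ 2 * (x ^+ n + y ^+ n).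
Proof.
move=> en n0 /andP[r0 r1].
case: n en n0 => [//|[//|m]] en _; set n := m.+2 in en *.
rewrite exprDn 2!big_ord_recl /= subn0 expr0 mulr1 bin0 mulr1n -addrA lerD2l.
rewrite /bump /= subn1 bin1 expr1 /=.
apply: lerD; first by rewrite le_eqVlt -[_ *+ _]mulr_natl; apply/orP; left; apply/eqP; ring.
apply: (@le_trans _ _ (\sum_(i < m.+1) 'C(n, i.+2)%:R * (r ^+ 2 * (x ^+ n + y ^+ n)))).
  apply: ler_sum => i _; rewrite !add1n -[_ *+ _]mulr_natl ler_wpM2l//.
  apply: le_trans (ler_norm _) _; rewrite normrM !normrX normrM [`|r|]ger0_norm// exprMn.
  have ri : r ^+ i.+2 <= r ^+ 2.
    by rewrite (_ : i.+2 = (2 + i)%N)// exprD ler_piMr ?sqr_ge0// exprn_ile1.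
  rewrite mulrCA; have := mul_norm_pow_le x y en (ltn_ord i : (i.+2 <= n)%N).
  by apply: ler_pM ri => //; exact: exprn_ge0.
rewrite -mulr_suml -[leRHS]mulrA ler_wpM2r//.
  by rewrite mulr_ge0 ?sqr_ge0// addr_ge0// exprn_even_ge0.
have -> : (2 : R) ^+ n = \sum_(i < n.+1) 'C(n, i)%:R.
  rewrite -[2%:R]/(1 + 1) exprDn; apply: eq_bigr => i _.
  by rewrite !expr1n mulr1.
rewrite /n [leRHS]big_ord_recl /= [X in _ <= _ + X]big_ord_recl /=.
by rewrite addrA lerDr addr_ge0.
Qed.

Section weighted_norm.
Context (I : finType) (lam : I -> R) (q : nat).
Hypothesis lam0 : forall a, 0 < lam a.
Hypothesis q0 : (0 < q)%N.
Implicit Types x y : I -> R.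

Definition wsum x := \sum_a lam a * x a ^+ q.*2.

(** The square of the [l^(2q)] norm with weights [lam]. *)
Definition wnorm2 x := wsum x `^ (q%:R^-1).

(** The gradient of [wnorm2] at [x]. *)
Definition wgrad x a := 2 * lam a * x a ^+ q.*2.-1 / wnorm2 x ^+ q.-1.

Let ev : ~~ odd q.*2. Proof. by rewrite odd_double. Qed.

Let q2 : (0 < q.*2)%N. Proof. by rewrite double_gt0. Qed.

Let q21 : (0 < q.*2.-1)%N. Proof. by case: q q0. Qed.

Lemma wsum_ge0 x : 0 <= wsum x.
Proof.
by apply: sumr_ge0 => a _; rewrite mulr_ge0 ?(ltW (lam0 a))// exprn_even_ge0.
Qed.

Lemma wnorm2_ge0 x : 0 <= wnorm2 x. Proof. exact: powR_ge0. Qed.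

Lemma wnorm2X x : wnorm2 x ^+ q = wsum x.
Proof.
rewrite -powR_mulrn ?wnorm2_ge0// /wnorm2 -powRrM mulVf ?powRr1 ?wsum_ge0//.
by rewrite pnatr_eq0 -lt0n.
Qed.

Lemma wnorm2_le x c : 0 <= c -> wsum x <= c ^+ q -> wnorm2 x <= c.
Proof. by move=> c0; rewrite -wnorm2X ler_pXn2r// nnegrE// wnorm2_ge0. Qed.

Lemma wterm_le x a : lam a * x a ^+ q.*2 <= wsum x.
Proof.
rewrite /wsum (bigD1 a)//= lerDl; apply: sumr_ge0 => b _.
by rewrite mulr_ge0 ?(ltW (lam0 b))// exprn_even_ge0.
Qed.

Lemma wsum_eq0 x : wsum x <= 0 -> x = fun=> 0.
Proof.
move=> x0; apply/funext => a; have := le_trans (wterm_le x a) x0.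
rewrite pmulr_rle0// => h; apply/eqP.
have : x a ^+ q.*2 == 0 by rewrite eq_le h exprn_even_ge0.
by rewrite expf_eq0 => /andP[].
Qed.

Lemma wnorm2_eq0 x : wnorm2 x = 0 -> x = fun=> 0.
Proof. by move=> A0; apply: wsum_eq0; rewrite -wnorm2X A0 expr0n gtn_eqF. Qed.

(** The constant is poor, since it involves the weights; the bound only serves to
make the terms of the martingale square integrable. *)
Lemma wgrad_sq_le x a :
  wgrad x a ^+ 2 <= (4 * lam a ^+ 2 * (1 + (lam a)^-1) ^+ q.*2.-1) * wnorm2 x.
Proof.
have lamV : 0 < (lam a)^-1 by rewrite invr_gt0.
have := wnorm2_ge0 x; rewrite le_eqVlt => /predU1P[A0|A0].
  rewrite /wgrad (wnorm2_eq0 (esym A0)) expr0n.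
  rewrite gtn_eqF// mulr0 mul0r expr0n /= mulr_ge0 ?wnorm2_ge0// mulr_ge0//.
    by rewrite mulr_ge0// sqr_ge0.
  by rewrite exprn_ge0// addr_ge0// ltW.
set A := wnorm2 x in A0 *; set mu := 1 + (lam a)^-1.
have mu1 : 1 <= mu by rewrite lerDl ltW.
have x2 : x a ^+ 2 <= mu * A.
  rewrite -(@ler_pXn2r _ q)// ?nnegrE ?sqr_ge0 ?mulr_ge0 ?(ltW A0) ?(le_trans ler01 mu1)//.
  rewrite -exprM mul2n exprMn wnorm2X.
  apply: (@le_trans _ _ ((lam a)^-1 * wsum x)).
    by rewrite -ler_pdivrMl ?invr_gt0// invrK; exact: wterm_le.
  rewrite ler_wpM2r ?wsum_ge0//; apply: le_trans (ler_eXnr q0 mu1).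
  by rewrite /mu lerDr.
rewrite /wgrad -/A exprMn exprVn ler_pdivrMr ?exprn_gt0//.
rewrite !exprMn -!exprM.
have -> : 4 * lam a ^+ 2 * mu ^+ q.*2.-1 * A * A ^+ (q.-1 * 2) =
    2 ^+ 2 * lam a ^+ 2 * (mu * A) ^+ q.*2.-1.
  rewrite exprMn !mulrA -[LHS]mulrA -exprS; congr (_ * _ * _ * A ^+ _); first by ring.
  by case: q q0 => // p _; rewrite doubleS /= muln2.
rewrite ler_wpM2l ?mulr_ge0 ?sqr_ge0 ?(ltW (lam0 a))//.
rewrite mulnC exprM.
by rewrite lerXn2r ?nnegrE ?sqr_ge0 ?mulr_ge0 ?(ltW A0) ?(le_trans ler01 mu1).
Qed.

Lemma wsumZ c x : wsum (fun a => c * x a) = c ^+ q.*2 * wsum x.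
Proof. by rewrite mulr_sumr; apply: eq_bigr => a _; rewrite exprMn mulrCA. Qed.

Lemma wdot_le x y : wsum x <= 1 -> wsum y <= 1 ->
  `|\sum_a lam a * (x a ^+ q.*2.-1 * y a)| <= 2.
Proof.
move=> x1 y1; apply: le_trans (ler_norm_sum _ _ _) _.
apply: (@le_trans _ _ (wsum x + wsum y)); last lra.
rewrite -big_split; apply: ler_sum => a _; rewrite normrM gtr0_norm//= -mulrDr.
rewrite ler_wpM2l ?(ltW (lam0 a))// normrM normrX.
have := @mul_norm_pow_le q.*2 1 (x a) (y a) ev q2.
by rewrite subn1 expr1.
Qed.

(** The 2-smoothness of [l^(2q)] spaces, for [q >= 1].  Write [a0] for the norm of
[x].  If [b < a0], scale [x] and [y] to unit size, expand the power
[2 q] to second order in [r = b / a0], and take the [q]-th root by Bernoulli.  If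
[b >= a0], the triangle inequality up to constants gives a bound of order
[b ^+ 2], which also dominates the first order term.  The remainder depends on
[y] only through [b] and does not see the number of coordinates. *)
Lemma wnorm2_smooth x y b : 0 <= b -> wsum y <= b ^+ q.*2 ->
  wnorm2 (fun a => x a + y a) <=
  wnorm2 x + \sum_a wgrad x a * y a + (2 * 4 ^+ q + 12) * b ^+ 2.
Proof.
move=> b0 yb.
have K0 : 0 <= 2 * 4 ^+ q :> R by rewrite mulr_ge0// exprn_ge0.
have xy0 := wnorm2_ge0 (fun a => x a + y a).
move: b0; rewrite le_eqVlt => /predU1P[b0|b0].
  have y0 : y = fun=> 0.
    by apply: wsum_eq0; rewrite (le_trans yb)// -b0 expr0n gtn_eqF.
  rewrite y0 -b0 expr0n mulr0 addr0 big1 ?addr0 => [|a _]; last by rewrite mulr0.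
  by rewrite (_ : (fun _ => _) = x)//; apply/funext => a; rewrite addr0.
(* [eta] is [y] scaled to unit size *)
pose eta a := b^-1 * y a.
have etaE a : y a = b * eta a by rewrite /eta mulVKf// gt_eqF.
have eta1 : wsum eta <= 1.
  by rewrite wsumZ exprVn ler_pdivrMl ?exprn_gt0// mulr1.
set A := wnorm2 x; set a0 := Num.sqrt A.
have A0 : 0 <= A by exact: wnorm2_ge0.
(* [wgrad] vanishes at the origin, where the norm of [y] alone remains *)
have [Apos|Aneg] := ltP 0 A; last first.
  have Az : A = 0 by apply/eqP; rewrite eq_le Aneg.
  have x0 := wnorm2_eq0 Az.
  rewrite x0 big1 ?addr0 => [|a _]; last first.
    by rewrite /wgrad expr0n gtn_eqF// mulr0 !mul0r.
  rewrite Az add0r; apply: wnorm2_le; first by rewrite mulr_ge0 ?sqr_ge0//; lra.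
  under eq_fun do rewrite add0r.
  apply: le_trans yb _; rewrite -mul2n exprM lerXn2r ?nnegrE ?sqr_ge0//.
    by rewrite mulr_ge0 ?sqr_ge0//; lra.
  by rewrite ler_peMl ?sqr_ge0//; lra.
have a0pos : 0 < a0 by rewrite sqrtr_gt0.
have a02 : a0 ^+ 2 = A by rewrite sqr_sqrtr.
pose xi a := a0^-1 * x a.
have xiE a : x a = a0 * xi a by rewrite /xi mulVKf// gt_eqF.
have xi1 : wsum xi = 1.
  rewrite wsumZ -wnorm2X -/A -a02 -exprM mul2n -exprMn mulVf ?expr1n// gt_eqF//.
set Dt := \sum_a lam a * (xi a ^+ q.*2.-1 * eta a).
have Dt2 : `|Dt| <= 2 by apply: wdot_le; rewrite ?xi1.
have gradE : \sum_a wgrad x a * y a = 2 * (a0 * b) * Dt.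
  rewrite /Dt mulr_sumr; apply: eq_bigr => a _.
  rewrite /wgrad xiE etaE -/A -a02 -exprM exprMn.
  have -> : q.*2.-1 = ((2 * q.-1).+1)%N by case: q q0 => // p _; rewrite doubleS mul2n.
  rewrite !exprS.
  by field; rewrite expf_neq0 ?gt_eqF.
rewrite gradE; have [ba|/ltW ab] := leP b a0.
  set r := b / a0.
  have r01 : 0 <= r <= 1 by rewrite divr_ge0 ?(ltW b0) ?(ltW a0pos)//= ler_pdivrMr ?mul1r.
  have rb : a0 * r = b by rewrite /r mulrCA divff ?mulr1// gt_eqF.
  have sumle : wsum (fun a => xi a + r * eta a) <=
      1 + (q.*2%:R * r * Dt + 2 ^+ q.*2 * r ^+ 2 * 2).
    apply: (@le_trans _ _ (\sum_a (lam a * xi a ^+ q.*2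
       + q.*2%:R * r * (lam a * (xi a ^+ q.*2.-1 * eta a))
       + 2 ^+ q.*2 * r ^+ 2 * (lam a * xi a ^+ q.*2 + lam a * eta a ^+ q.*2)))).
      apply: ler_sum => a _.
      have := ler_wpM2l (ltW (lam0 a)) (taylor_pow_le (xi a) (eta a) ev q2 r01).
      by move/le_trans; apply; rewrite le_eqVlt; apply/orP; left; apply/eqP; ring.
    rewrite !big_split /= -!mulr_sumr big_split /= -/(wsum xi) -/(wsum eta) -/Dt xi1.
    rewrite addrA lerD2l ler_wpM2l//; last lra.
    by rewrite mulr_ge0 ?sqr_ge0// exprn_ge0.
  have vq : (wnorm2 (fun a => x a + y a) / A) ^+ q = wsum (fun a => xi a + r * eta a).
    rewrite exprMn exprVn wnorm2X.
    have -> : (fun a => x a + y a) = (fun a => a0 * (xi a + r * eta a)).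
      by apply/funext => a; rewrite mulrDr [a0 * (r * _)]mulrA rb -xiE -etaE.
    by rewrite wsumZ -a02 -exprM mul2n mulrC mulKf// expf_neq0// gt_eqF.
  have v0 : 0 <= wnorm2 (fun a => x a + y a) / A by rewrite divr_ge0.
  rewrite -vq in sumle; have := le_root_bernoulli q0 v0 sumle.
  rewrite ler_pdivrMr// => /le_trans; apply.
  have qR : q%:R != 0 :> R by rewrite pnatr_eq0 -lt0n.
  have q1 : 1 <= q%:R :> R by rewrite ler1n.
  have -> : (1 + (q.*2%:R * r * Dt + 2 ^+ q.*2 * r ^+ 2 * 2) / q%:R) * A =
      A + 2 * (a0 * b) * Dt + 2 * 4 ^+ q / q%:R * b ^+ 2.
    rewrite -a02 -rb -mul2n natrM exprM (_ : 2 ^+ 2 = 4 :> R); last by ring.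
    by field.
  rewrite lerD2l ler_wpM2r ?sqr_ge0//.
  apply: (@le_trans _ _ (2 * 4 ^+ q)); last lra.
  by rewrite ler_pdivrMr ?(lt_le_trans _ q1)// ler_peMr.
have w8 : wnorm2 (fun a => x a + y a) <= 8 * b ^+ 2.
  apply: wnorm2_le; first by rewrite mulr_ge0// sqr_ge0.
  apply: (@le_trans _ _ (2 ^+ q.*2 * (wsum x + wsum y))).
    rewrite -big_split mulr_sumr; apply: ler_sum => a _.
    by rewrite /= -mulrDr mulrCA ler_wpM2l ?(ltW (lam0 a))// exprD_even_le.
  apply: (@le_trans _ _ (2 ^+ q.*2 * (b ^+ q.*2 + b ^+ q.*2))).
    rewrite ler_wpM2l ?exprn_ge0// lerD//.
    rewrite -wnorm2X -/A -a02 -exprM mul2n lerXn2r ?nnegrE ?(ltW b0) ?(ltW a0pos)//.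
  rewrite -mul2n !exprM [leRHS]exprMn.
  have -> : (2 ^+ 2) ^+ q * ((b ^+ 2) ^+ q + (b ^+ 2) ^+ q) =
      (2 ^+ 2) ^+ q * 2 * (b ^+ 2) ^+ q :> R by ring.
  rewrite ler_wpM2r ?(exprn_ge0 _ (sqr_ge0 b))//.
  apply: (@le_trans _ _ ((2 ^+ 2) ^+ q * 2 ^+ q)); last first.
    rewrite -exprMn le_eqVlt; apply/orP; left; apply/eqP.
    by congr (_ ^+ _); ring.
  by rewrite ler_wpM2l ?exprn_ge0// ler_eXnr// ler1n.
have gb : - (4 * b ^+ 2) <= 2 * (a0 * b) * Dt.
  have : `|2 * (a0 * b) * Dt| <= 4 * b ^+ 2.
    rewrite !normrM [`|2|]ger0_norm// [`|a0|]gtr0_norm// [`|b|]gtr0_norm//.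
    apply: (@le_trans _ _ (2 * (b * b) * 2)); last by rewrite expr2; lra.
    apply: ler_pM => //; first by rewrite !mulr_ge0 ?(ltW b0) ?(ltW a0pos).
    by rewrite ler_wpM2l// ler_wpM2r// ltW.
  by rewrite ler_norml => /andP[].
have K0' : 0 <= 2 * 4 ^+ q * b ^+ 2 by rewrite mulr_ge0 ?sqr_ge0.
rewrite mulrDl; lra.
Qed.

End weighted_norm.

End smooth_norm.

Section measurable_weighted_norm.
Context (R : realType) (d0 : measure_display) (Omega : measurableType d0).
Context (I : finType) (lam : I -> R) (q : nat).
Hypothesis lam0 : forall a, 0 < lam a.
Hypothesis q0 : (0 < q)%N.
Variable M : Omega -> I -> R.
Hypothesis mM : forall a, measurable_fun setT (fun w => M w a).

Lemma measurable_sum_fin (J : Type) (s : seq J) (h : J -> Omega -> R) :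
  (forall j, measurable_fun setT (h j)) ->
  measurable_fun setT (fun w => \sum_(j <- s) h j w).
Proof.
move=> mh; elim: s => [|j s IH].
  by under eq_fun do rewrite big_nil; exact: measurable_cst.
by under eq_fun do rewrite big_cons; exact: measurable_funD.
Qed.

Lemma measurable_wnorm2 : measurable_fun setT (fun w => wnorm2 lam q (M w)).
Proof.
apply: (@measurableT_comp _ _ _ _ _ _ (fun x : R => x `^ (q%:R^-1))) => //.
apply: measurable_sum_fin => a; apply: measurable_funM => //.
exact: measurable_funX.
Qed.

Lemma measurable_wgrad a : measurable_fun setT (fun w => wgrad lam q (M w) a).
Proof.
under eq_fun do rewrite /wgrad -powR_inv1 ?exprn_ge0 ?wnorm2_ge0//.
apply: measurable_funM; first by apply: measurable_funM => //; exact: measurable_funX.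
apply: (@measurableT_comp _ _ _ _ _ _ (fun x : R => x `^ (-1))) => //.
by apply: measurable_funX; exact: measurable_wnorm2.
Qed.

End measurable_weighted_norm.

(** * Vector valued martingale transforms *)

Section martingale_transforms.
Context (R : realType) (d0 : measure_display) (Omega : measurableType d0).
Variables (P : probability Omega R) (k : nat) (G : nat -> set_system Omega).
Hypothesis sG : forall i, sigma_algebra setT (G i) /\ G i `<=` measurable.
Hypothesis GS : forall i, G i `<=` G i.+1.
Variable zeta : nat -> 'I_k -> Omega -> R.
Hypothesis zL2 : forall i l, L2 P (zeta i l).
Hypothesis zG : forall i l, measurable_wrt (G i.+1) (zeta i l).
Hypothesis z0 : forall i l A, G i A -> \int[P]_(w in A) zeta i l w = 0.

Context (I : finType) (lam kap : I -> R) (q : nat) (W : R).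
Hypothesis lam0 : forall a, 0 < lam a.
Hypothesis kap0 : forall a, 0 <= kap a.
Hypothesis q0 : (0 < q)%N.
Hypothesis W0 : 0 <= W.
Hypothesis lkW : \sum_a lam a * kap a ^+ q.*2 <= W ^+ q.*2.
Variable c : nat -> I -> 'I_k -> Omega -> R.
Hypothesis cG : forall i a l, measurable_wrt (G i) (c i a l).
Hypothesis ck : forall i a l w, `|c i a l w| <= kap a.

Definition transform_inc i (w : Omega) a := \sum_l c i a l w * zeta i l w.

Definition transform j (w : Omega) a := \sum_(i < j) transform_inc i w a.

Lemma measurable_wrt_transform j a : measurable_wrt (G j) (fun w => transform j w a).
Proof.
elim: j => [|j IH].
  apply/(measurable_wrtP (sG 0).1); under eq_fun do rewrite /transform big_ord0.
  exact: measurable_cst.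
have up X : measurable_wrt (G j) X -> measurable_wrt (G j.+1) X.
  by move=> mX B mB; exact/GS/mX.
have {}IH := (measurable_wrtP (sG j.+1).1 _).1 (up _ _ IH).
apply/(measurable_wrtP (sG j.+1).1).
under eq_fun do rewrite /transform big_ord_recr.
apply: measurable_funD => //; apply: measurable_sum_fin => l.
by apply: measurable_funM; apply/(measurable_wrtP (sG j.+1).1); [exact: up|exact: zG].
Qed.

Let Psi j w := wnorm2 lam q (transform j w).

(** Each step of the martingale adds a first order term, which is orthogonal to
the past and has expectation 0, and a remainder of order [W ^+ 2] times the
square of the noise.  The bound therefore behaves like that of a Hilbert norm. *)
Lemma E_wnorm2_transform j :
  L1 P (Psi j) /\
  E P (Psi j) <= (2 * 4 ^+ q + 12) * W ^+ 2 *
    \sum_(i < j) E P (fun w => (\sum_l `|zeta i l w|) ^+ 2).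
Proof.
elim: j => [|j [iPsi EPsi]].
  have P0 w : Psi 0 w = 0.
    apply/eqP; rewrite eq_le wnorm2_ge0 andbT; apply: (wnorm2_le lam0 q0) => //.
    rewrite expr0n gtn_eqF//= /wsum big1// => a _.
    by rewrite /transform big_ord0 expr0n gtn_eqF ?double_gt0// mulr0.
  have -> : Psi 0 = fun=> 0 by apply/funext.
  by rewrite E_cst big_ord0 mulr0; split=> //; exact: L1_cst.
set K : R := 2 * 4 ^+ q + 12.
have K0 : 0 <= K by rewrite addr_ge0// mulr_ge0// exprn_ge0.
pose B w := \sum_l `|zeta j l w|.
have iB : L2 P B by apply: L2_sum => l _; exact: L2_norm.
have mM a : measurable_fun (setT : set (g_sigma_algebraType (G j)))
    (fun w => transform j w a).
  exact/(measurable_wrtP (sG j).1)/measurable_wrt_transform.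
have mM' a : measurable_fun setT (fun w => transform j w a).
  exact: measurable_wrt_sub (sG j).2 (@measurable_wrt_transform j a).
have xiG a l : measurable_wrt (G j)
    (fun w => wgrad lam q (transform j w) a * c j a l w).
  apply/(measurable_wrtP (sG j).1); apply: measurable_funM.
    exact: measurable_wgrad.
  exact/(measurable_wrtP (sG j).1).
have xi2 a l : L2 P (fun w => wgrad lam q (transform j w) a * c j a l w).
  under eq_fun do rewrite mulrC.
  apply: (@L2_bounded_mul _ _ _ _ (kap a)) => //.
    exact: measurable_wrt_sub (sG j).2 (cG _ _ _).
  split; first exact: measurable_wgrad.
  apply: L1_dom (L1Z (4 * lam a ^+ 2 * (1 + (lam a)^-1) ^+ q.*2.-1) iPsi).
    by apply: measurable_funX; exact: measurable_wgrad.
  by move=> w; rewrite ger0_norm ?sqr_ge0//; exact: wgrad_sq_le.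
have ortho a l : E P (fun w => wgrad lam q (transform j w) a * c j a l w * zeta j l w) = 0.
  by apply: (orth_L2 (sG j).2) => //; exact: z0.
have iterm a l : L1 P (fun w => wgrad lam q (transform j w) a * c j a l w * zeta j l w).
  exact: L2M_L1.
have step w : Psi j.+1 w <= Psi j w +
    \sum_a \sum_l wgrad lam q (transform j w) a * c j a l w * zeta j l w
    + K * W ^+ 2 * B w ^+ 2.
  have -> : Psi j.+1 w = wnorm2 lam q (fun a => transform j w a + transform_inc j w a).
    by congr (wnorm2 _ _ _); apply/funext => a; rewrite /transform big_ord_recr.
  have -> : \sum_a \sum_l wgrad lam q (transform j w) a * c j a l w * zeta j l w =
      \sum_a wgrad lam q (transform j w) a * transform_inc j w a.
    by apply: eq_bigr => a _; rewrite mulr_sumr; apply: eq_bigr => l _; rewrite mulrA.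
  rewrite -mulrA -exprMn; apply: wnorm2_smooth => //.
    by rewrite mulr_ge0// sumr_ge0.
  rewrite exprMn; apply: le_trans (ler_wpM2r _ lkW); last first.
    by rewrite exprn_ge0// sumr_ge0.
  rewrite mulr_suml; apply: ler_sum => a _; rewrite -mulrA -exprMn.
  rewrite ler_wpM2l ?(ltW (lam0 a))//.
  rewrite -[leLHS]ger0_norm ?exprn_even_ge0 ?odd_double// normrX.
  rewrite lerXn2r ?nnegrE ?mulr_ge0 ?sumr_ge0//.
  apply: le_trans (ler_norm_sum _ _ _) _; rewrite mulr_sumr; apply: ler_sum => l _.
  by rewrite normrM ler_wpM2r.
have iR : L1 P (fun w => Psi j w +
    \sum_a \sum_l wgrad lam q (transform j w) a * c j a l w * zeta j l w
    + K * W ^+ 2 * B w ^+ 2).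
  apply: L1D; last by apply: L1Z; case: iB.
  by apply: L1D => //; apply: L1_sum => a _; apply: L1_sum.
have iS : L1 P (Psi j.+1).
  apply: L1_dom iR.
    apply: measurable_wnorm2 => a.
    exact: measurable_wrt_sub (sG j.+1).2 (@measurable_wrt_transform j.+1 a).
  by move=> w; rewrite ger0_norm ?wnorm2_ge0//; exact: step.
split=> //; apply: le_trans (E_le iS iR step) _.
rewrite ED; [|by apply: L1D => //; apply: L1_sum => a _; apply: L1_sum|
  by apply: L1Z; case: iB].
rewrite ED//; last by apply: L1_sum => a _; apply: L1_sum.
rewrite E_sum; last by move=> a; apply: L1_sum.
rewrite big1 ?addr0; last by move=> a _; rewrite E_sum// big1.
rewrite EZ; last by case: iB.
by rewrite big_ord_recr mulrDr lerD2r.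
Qed.

End martingale_transforms.

(** * Chaining over a dyadic grid *)

Section sums.
Context (R : realType).

Lemma sum_inv_sq_le n : \sum_(j < n) (1 + j%:R : R) ^- 2 <= 2.
Proof.
case: n => [|n]; first by rewrite big_ord0.
apply: (@le_trans _ _ (2 - n.+1%:R^-1)); last by rewrite lerBlDr lerDl.
elim: n => [|n IH]; first by rewrite big_ord1 addr0 expr1n invr1; lra.
rewrite big_ord_recr /=; apply: le_trans (lerD IH (lexx _)) _.
rewrite nat1r -lerBrDl.
have p1 : 0 < n.+1%:R :> R by rewrite ltr0n.
have p2 : n.+2%:R = n.+1%:R + 1 :> R by rewrite -natr1.
rewrite p2; move: (n.+1%:R) p1 => p p1.
have -> : 2 - (p + 1)^-1 - (2 - p^-1) = (p * (p + 1))^-1 by field; lra.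
by rewrite lef_pV2 ?posrE; nra.
Qed.

Lemma sum_geo_le (rho c : R) n : 0 <= rho -> c * (1 - rho) = 1 ->
  0 <= c -> \sum_(i < n) rho ^+ i <= c.
Proof.
move=> r0 cr c0.
have -> : \sum_(i < n) rho ^+ i = c * (1 - rho ^+ n).
  elim: n => [|n IH]; first by rewrite big_ord0 expr0 subrr mulr0.
  rewrite big_ord_recr /= IH exprS; apply/eqP; rewrite -subr_eq0.
  have -> : c * (1 - rho ^+ n) + rho ^+ n - c * (1 - rho * rho ^+ n) =
    (1 - c * (1 - rho)) * rho ^+ n by ring.
  by rewrite cr subrr mul0r.
by rewrite ler_piMr// lerBlDr lerDl exprn_ge0.
Qed.

End sums.

Section dyadic_grid.
Context (R : realType) (d n : nat).

Definition grid := {ffun 'I_d -> bool * 'I_n}.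

(** The sign is stored apart from the absolute value, so that halving the latter
moves a point towards the origin in each coordinate. *)
Definition grid_point (k : nat) (z : grid) : 'rV[R]_d :=
  \row_c ((-1) ^+ (z c).1 * (z c).2%:R / 2 ^+ k).

Lemma half_lt (j : 'I_n) : (j./2 < n)%N.
Proof. by apply: leq_ltn_trans (ltn_ord j); rewrite -divn2 leq_div. Qed.

Definition grid_parent (z : grid) : grid :=
  [ffun c => ((z c).1, Ordinal (half_lt (z c).2))].

Lemma grid_pointE k z c : `|grid_point k z 0 c| = (z c).2%:R / 2 ^+ k.
Proof. by rewrite mxE -mulrA normrM normrX normrN1 expr1n mul1r ger0_norm// divr_ge0// exprn_ge0. Qed.

Lemma half_dyadic_le k (j : nat) :
  0 <= (j%:R / 2 ^+ k.+1 - (j./2)%:R / 2 ^+ k : R) <= (2 ^+ k.+1)^-1.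
Proof.
have -> : j%:R / 2 ^+ k.+1 - (j./2)%:R / 2 ^+ k = (odd j)%:R / 2 ^+ k.+1 :> R.
  rewrite -{1}(odd_double_half j) natrD -mul2n natrM exprS.
  by field; rewrite expf_neq0.
have p0 : 0 < (2 : R) ^+ k.+1 by rewrite exprn_gt0.
by case: (odd j); rewrite ?mul1r ?mul0r ?lexx invr_ge0 (ltW p0).
Qed.

Lemma grid_parent_dist k z :
  enorm (grid_point k.+1 z - grid_point k (grid_parent z)) <= d%:R / 2 ^+ k.+1.
Proof.
apply: le_trans (enorm_le_sum _) _.
apply: (@le_trans _ _ (\sum_(c < d) (2 ^+ k.+1)^-1)).
  apply: ler_sum => c _; rewrite !mxE ffunE /= -!mulrA -mulrBr normrM normrX normrN1 expr1n mul1r.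
  by have /andP[h1 h2] := half_dyadic_le k (z c).2; rewrite ger0_norm.
by rewrite sumr_const card_ord -[leLHS]mulr_natl.
Qed.

(** A chain of parents stays in the ball of its first point, so one bound on the
norm serves all levels of the chain. *)
Lemma grid_parent_norm k z :
  enorm (grid_point k (grid_parent z)) <= enorm (grid_point k.+1 z).
Proof.
rewrite /enorm ler_wsqrtr//; apply: ler_sum => c _.
rewrite -(real_normK (num_real _)) -[leRHS](real_normK (num_real _)).
rewrite lerXn2r ?nnegrE// !grid_pointE ffunE /= -subr_ge0.
by have /andP[] := half_dyadic_le k (z c).2.
Qed.

Lemma sum_grid_le : \sum_(z : grid) \prod_c (1 + (z c).2%:R : R) ^- 2 <= 4 ^+ d.
Proof.
pose F (p : bool * 'I_n) : R := (1 + p.2%:R) ^- 2.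
have -> : \sum_(z : grid) \prod_c (1 + (z c).2%:R : R) ^- 2 =
    \prod_(c < d) \sum_p F p by rewrite bigA_distr_bigA.
rewrite prodr_const card_ord; apply: lerXn2r; rewrite ?nnegrE//.
  by apply: sumr_ge0 => p _; rewrite invr_ge0 sqr_ge0.
have -> : \sum_p F p = \sum_(b : bool) \sum_(j < n) F (b, j).
  by rewrite pair_big; apply: eq_bigr => -[b j].
by rewrite big_bool /=; have := sum_inv_sq_le R n; rewrite /F /=; lra.
Qed.

End dyadic_grid.

Definition chain_const (R : realType) (d : nat) (C : R) : R :=
  (2 * 4 ^+ (2 * d.+1) + 12) *
  (C * d.+1%:R * (1 + 2 * d%:R * 4 ^+ d)) ^+ 2.

Section chaining.
Context (R : realType) (d0 : measure_display) (Omega : measurableType d0).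
Variables (P : probability Omega R) (d k : nat) (G : nat -> set_system Omega).
Hypothesis sG : forall i, sigma_algebra setT (G i) /\ G i `<=` measurable.
Hypothesis GS : forall i, G i `<=` G i.+1.
Variable zeta : nat -> 'I_k -> Omega -> R.
Hypothesis zL2 : forall i l, L2 P (zeta i l).
Hypothesis zG : forall i l, measurable_wrt (G i.+1) (zeta i l).
Hypothesis z0 : forall i l A, G i A -> \int[P]_(w in A) zeta i l w = 0.
Variables (C : R) (coef : nat -> 'rV[R]_d -> 'I_d -> 'I_k -> Omega -> R).
Hypothesis C0 : 0 <= C.
Hypothesis coefG : forall i x e l, measurable_wrt (G i) (coef i x e l).
Hypothesis coef_le : forall i x e l w, `|coef i x e l w| <= C.
Hypothesis coef_holder : forall i x x' e l w,
  `|coef i x e l w - coef i x' e l w| <= C * Num.sqrt (enorm (x - x')).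

(** The martingale transform as a random field: its coefficients depend on a point
[x], which is later allowed to be random. *)
Definition mart_field (j : nat) (x : 'rV[R]_d) (e : 'I_d) (w : Omega) :=
  \sum_(i < j) \sum_l coef i x e l w * zeta i l w.

Variables (K n : nat).

(** Coefficients of level [k] have size [2^(-k/2)], hence [2^(-k q)] in the power
[2 q].  With [q = 2 d + 2] this pays for the growth [2^(2 d k)] of the grid and
for a factor [2^k] in the weights [lam], which makes the chain increments decay,
and leaves [2^(-k)] for the sum over the levels.  The factors [(1 + j)^(-2)] of
[lam] make the sum over the points of one level finite. *)
Let q := (2 * d.+1)%N.
Let I := ('I_K.+1 * grid d n * 'I_d)%type.
Let C' := C * d.+1%:R.
Let W := C' * (1 + 2 * d%:R * 4 ^+ d).

Let lam (a : I) : R :=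
  2 ^+ (a.1.1 * (2 * d).+1) * \prod_c (1 + (a.1.2 c).2%:R) ^- 2.

Let kap (a : I) : R := C' * Num.sqrt (2 ^- a.1.1).

(** The coefficients of the chain increments: value at a point minus value at its
parent, and the value itself at level 0. *)
Let cc i (a : I) l w :=
  coef i (grid_point R a.1.1 a.1.2) a.2 l w -
  (if a.1.1 == 0%N :> nat then 0
   else coef i (grid_point R a.1.1.-1 (grid_parent a.1.2)) a.2 l w).

Let C'0 : 0 <= C'. Proof. by rewrite mulr_ge0. Qed.

Let W0 : 0 <= W.
Proof. by rewrite mulr_ge0// addr_ge0// mulr_ge0// exprn_ge0. Qed.

Let q0 : (0 < q)%N. Proof. by rewrite muln_gt0. Qed.

Let lam0 a : 0 < lam a.
Proof.
rewrite mulr_gt0 ?exprn_gt0//; apply: prodr_gt0 => c _.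
by rewrite invr_gt0 exprn_gt0// ltr_wpDr.
Qed.

Let ccG i a l : measurable_wrt (G i) (cc i a l).
Proof.
apply/(measurable_wrtP (sG i).1); rewrite /cc.
case: (a.1.1 == 0%N :> nat); apply: measurable_funB => //;
  exact/(measurable_wrtP (sG i).1).
Qed.

Let cc_le i a l w : `|cc i a l w| <= kap a.
Proof.
rewrite /cc /kap; case: a => -[[m mK] z] e /=; case: m mK => [|m] mK /=.
  rewrite subr0 expr0 invr1 sqrtr1 mulr1; apply: le_trans (coef_le _ _ _ _ _) _.
  by rewrite ler_peMr// ler1n.
apply: le_trans (coef_holder _ _ _ _ _ _) _.
rewrite -mulrA ler_wpM2l//.
have -> : d.+1%:R = Num.sqrt (d.+1%:R ^+ 2) :> R by rewrite sqrtr_sqr ger0_norm.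
rewrite -sqrtrM ?sqr_ge0// ler_wsqrtr//.
apply: le_trans (grid_parent_dist _ _ _) _.
rewrite ler_wpM2r ?invr_ge0 ?exprn_ge0// -natrX ler_nat.
by rewrite (leq_trans (leqnSn d))// expnS leq_pmulr// expn1.
Qed.

(** The factor [2^(-k)] left over by the choice of exponents makes the sum over
all levels [k] finite. *)
Let lam_kap a : lam a * kap a ^+ q.*2 =
  C' ^+ q.*2 * (2^-1 ^+ a.1.1 * \prod_c (1 + (a.1.2 c).2%:R) ^- 2).
Proof.
have kq : Num.sqrt (2 ^- a.1.1) ^+ q.*2 = 2 ^- (a.1.1 * q) :> R.
  by rewrite -mul2n exprM sqr_sqrtr ?invr_ge0 ?exprn_ge0// exprVn exprM.
rewrite /lam /kap exprMn kq mulrCA; congr (_ * _).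
rewrite mulrAC; congr (_ * _).
have -> : q = ((2 * d).+1 + 1)%N by rewrite /q; lia.
by rewrite mulnDr muln1 exprD exprVn; field; rewrite !expf_neq0.
Qed.

Let sum_lam_kap : \sum_a lam a * kap a ^+ q.*2 <= W ^+ q.*2.
Proof.
under eq_bigr do rewrite lam_kap.
rewrite -mulr_sumr /W [leRHS]exprMn ler_wpM2l ?exprn_ge0//.
set S := \sum_z \prod_c (1 + ((z : grid d n) c).2%:R : R) ^- 2.
have S0 : 0 <= S.
  by apply: sumr_ge0 => z _; apply: prodr_ge0 => c _; rewrite invr_ge0 sqr_ge0.
have -> : \sum_(a : I) 2^-1 ^+ a.1.1 * \prod_c (1 + (a.1.2 c).2%:R) ^- 2 =
    (\sum_(m < K.+1) 2^-1 ^+ m) * S *+ d.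
  rewrite mulr_suml -sumrMnl.
  transitivity (\sum_(p : 'I_K.+1 * grid d n) \sum_(e : 'I_d)
      2^-1 ^+ p.1 * \prod_c (1 + (p.2 c).2%:R : R) ^- 2).
    by rewrite pair_big; apply: eq_bigr => -[[]].
  under eq_bigr do rewrite sumr_const card_ord.
  under [RHS]eq_bigr do rewrite mulr_sumr -sumrMnl.
  by rewrite pair_big; apply: eq_bigr => -[].
have two : \sum_(m < K.+1) (2^-1 : R) ^+ m <= 2 by apply: sum_geo_le; lra.
have Sd : S <= 4 ^+ d := sum_grid_le R d n.
have d4 : 0 <= 2 * d%:R * 4 ^+ d :> R by rewrite mulr_ge0// exprn_ge0.
apply: (@le_trans _ _ (1 + 2 * d%:R * 4 ^+ d)); last first.
  by apply: ler_eXnr; rewrite ?double_gt0//; lra.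
apply: (@le_trans _ _ (2 * 4 ^+ d *+ d)).
  rewrite lerMn2r; apply/orP; right; apply: ler_pM => //.
  by apply: sumr_ge0 => m _; rewrite exprn_ge0// invr_ge0.
by rewrite -[leLHS]mulr_natr; lra.
Qed.

Let Psi j w := wnorm2 lam q (transform zeta cc j w).

(** A decay rate per level: by Bernoulli, [rho ^+ q.*2 >= 1 / 2], so the factor
[2^(-k)] gained in the power [2 q] is at most [rho ^+ k] for the increment
itself, and the geometric series of ratio [rho] sums to [4 q]. *)
Let rho : R := 1 - (4 * q)%:R^-1.

Let rho01 : 0 <= rho <= 1.
Proof.
have q1 : 1 <= (4 * q)%:R :> R by rewrite ler1n muln_gt0.
by rewrite /rho subr_ge0 invf_le1 ?(lt_le_trans _ q1)// q1 lerBlDr lerDl invr_ge0 (le_trans _ q1).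
Qed.

Let rho_half : 2^-1 <= rho ^+ q.*2.
Proof.
have q1 : 0 < q%:R :> R by rewrite ltr0n.
have E : (4 * q)%:R^-1 *+ q.*2 = 2^-1 :> R.
  by rewrite -[_ *+ _]mulr_natr -mul2n !natrM; field; rewrite gt_eqF.
have := @bernoulli_le R q.*2 (- (4 * q)%:R^-1); rewrite mulNrn E.
move=> H; apply: le_trans (H _); first lra.
by have /andP[] := rho01; rewrite /rho; lra.
Qed.

(** A single coordinate is bounded by the full norm [Psi] divided by its weight.
In the inverse weight, [prod (1 + j_c)^2] is at most [2^(2 d k) (1 + |x|)^(2 d)],
because [j_c] is [2^k] times the coordinate of [x]; a factor [2^(-k)] remains. *)
Let transform_le j w (a : I) :
  `|transform zeta cc j w a| <=
    rho ^+ a.1.1 * (Psi j w + 1 + enorm (grid_point R a.1.1 a.1.2)).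
Proof.
set x := grid_point _ _ _; set D := transform _ _ _ _ _.
have Psi0 : 0 <= Psi j w by exact: wnorm2_ge0.
have x0 : 0 <= enorm x by exact: enorm_ge0.
have rho0 : 0 <= rho by case/andP: rho01.
have D1 : lam a * D ^+ q.*2 <= Psi j w ^+ q.
  rewrite (wnorm2X lam0 q0); exact: (wterm_le q lam0 (transform zeta cc j w) a).
have prod1 : \prod_c (1 + (a.1.2 c).2%:R : R) ^+ 2 <=
    2 ^+ (a.1.1 * (2 * d)) * (1 + enorm x) ^+ q.
  apply: (@le_trans _ _ (\prod_(c < d) ((2 ^+ a.1.1 * (1 + enorm x)) ^+ 2))).
    apply: ler_prod => c _; rewrite sqr_ge0 /=.
    rewrite lerXn2r ?nnegrE ?mulr_ge0 ?exprn_ge0 ?addr_ge0//.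
    have := le_coord_enorm x c; rewrite /x grid_pointE.
    rewrite ler_pdivrMr ?exprn_gt0// mulrDr mulr1 mulrC => h.
    by rewrite lerD// exprn_ege1// ler1n.
  rewrite prodr_const card_ord -exprM exprMn -exprM.
  rewrite ler_wpM2l ?exprn_ge0//; apply: ler_weXn2l; first lra.
  by rewrite /q mulnS leq_addl.
have D2 : D ^+ q.*2 <= Psi j w ^+ q * (2^-1 ^+ a.1.1 * (1 + enorm x) ^+ q).
  move: D1; rewrite /lam; set pr := \prod_c _.
  set pr' := \prod_c _ in prod1.
  have pp : pr * pr' = 1.
    rewrite -big_split big1// => c _ /=.
    by rewrite mulVf// expf_neq0// gt_eqF// ltr_wpDr.
  have pr'0 : 0 <= pr' by apply: prodr_ge0 => c _; exact: sqr_ge0.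
  have p2 : 0 < (2 : R) ^+ (a.1.1 * (2 * d).+1) by rewrite exprn_gt0.
  move=> D1; have -> : D ^+ q.*2 = (2 ^+ (a.1.1 * (2 * d).+1))^-1 *
      (2 ^+ (a.1.1 * (2 * d).+1) * pr * D ^+ q.*2) * pr'.
    have -> : forall u : R, (2 ^+ (a.1.1 * (2 * d).+1))^-1 *
        (2 ^+ (a.1.1 * (2 * d).+1) * pr * u) * pr' = pr * pr' * u.
      by move=> u; field; rewrite expf_neq0.
    by rewrite pp mul1r.
  apply: (@le_trans _ _ ((2 ^+ (a.1.1 * (2 * d).+1))^-1 * Psi j w ^+ q *
     (2 ^+ (a.1.1 * (2 * d)) * (1 + enorm x) ^+ q))).
    apply: ler_pM => //.
      rewrite mulr_ge0 ?invr_ge0 ?(ltW p2)// mulr_ge0//.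
        by have := ltW (lam0 a).
      by rewrite exprn_even_ge0// odd_double.
    by rewrite ler_wpM2l// invr_ge0 ltW.
  rewrite le_eqVlt; apply/orP; left; apply/eqP.
  rewrite mulnS exprD exprVn.
  by field; rewrite !expf_neq0.
have D3 : D ^+ 2 <= rho ^+ a.1.1 ^+ 2 * (Psi j w * (1 + enorm x)).
  rewrite -(@ler_pXn2r _ q)// ?nnegrE ?sqr_ge0//; last first.
    by rewrite mulr_ge0 ?sqr_ge0// mulr_ge0// addr_ge0.
  rewrite -[leLHS]exprM mul2n; apply: le_trans D2 _.
  rewrite [leRHS]exprMn [(Psi j w * _) ^+ q]exprMn [leRHS]mulrCA ler_wpM2l ?exprn_ge0//.
  rewrite ler_wpM2r ?exprn_ge0 ?addr_ge0//.
  have -> : rho ^+ a.1.1 ^+ 2 ^+ q = (rho ^+ q.*2) ^+ a.1.1.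
    by rewrite -!exprM; congr (_ ^+ _); rewrite -mul2n [(2 * q * _)%N]mulnC mulnA.
  by rewrite lerXn2r ?nnegrE ?exprn_ge0 ?invr_ge0.
have r0 : 0 <= rho ^+ a.1.1 by rewrite exprn_ge0.
rewrite -ler_sqr ?nnegrE ?mulr_ge0 ?addr_ge0//.
rewrite real_normK ?num_real// exprMn; apply: le_trans D3 _.
rewrite ler_wpM2l ?sqr_ge0//; nra.
Qed.

(** Telescoping along the chain of parents down to level 0. *)
Lemma mart_field_grid_le j (z : grid d n) e w :
  `|mart_field j (grid_point R K z) e w| <=
    (4 * q)%:R * (Psi j w + 1 + enorm (grid_point R K z)).
Proof.
(* induction on the level, with a common bound [X] for the norms along the chain *)
suff H (m : 'I_K.+1) (X : R) (z' : grid d n) : enorm (grid_point R m z') <= X ->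
    `|mart_field j (grid_point R m z') e w| <=
    \sum_(i < m.+1) rho ^+ i * (Psi j w + 1 + X).
  apply: le_trans (H ord_max _ z (lexx _)) _; rewrite -mulr_suml ler_wpM2r//.
    by rewrite !addr_ge0// ?enorm_ge0// wnorm2_ge0.
  apply: sum_geo_le; rewrite ?ler0n//; first by case/andP: rho01.
  by rewrite /rho opprB addrCA subrr addr0 divff// pnatr_eq0.
case: m => m mK /=; elim: m mK z' => [|m IH] mK z' zX.
  rewrite big_ord1; have := transform_le j w (Ordinal mK, z', e) => /=.
  rewrite /transform /transform_inc /cc /=.
  under eq_bigr do under eq_bigr do rewrite subr0.
  move=> /le_trans; apply; rewrite expr0 !mul1r.
  by rewrite lerD2l.
rewrite big_ord_recr /=.
have -> : mart_field j (grid_point R m.+1 z') e w =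
    mart_field j (grid_point R m (grid_parent z')) e w +
    transform zeta cc j w (Ordinal mK, z', e).
  rewrite /mart_field /transform /transform_inc -big_split /=; apply: eq_bigr => i _.
  rewrite -big_split /=; apply: eq_bigr => l _.
  by rewrite /cc /= -mulrDl addrC subrK.
apply: le_trans (ler_normD _ _) (lerD _ _).
  by apply: (IH (ltnW mK)); exact: le_trans (grid_parent_norm _ _ _) zX.
apply: le_trans (transform_le _ _ _) _; rewrite /= ler_wpM2l ?lerD2l//.
by rewrite exprn_ge0//; case/andP: rho01.
Qed.

(** [Q] is the squared norm of the vector of all chain increments.  Its
expectation involves neither the depth [K] nor the size [n] of the grid. *)
Lemma mart_field_chaining j : exists Q : Omega -> R,
  [/\ forall w, 0 <= Q w, L1 P Q,
      E P Q <= chain_const d C *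
        \sum_(i < j) E P (fun w => (\sum_l `|zeta i l w|) ^+ 2) &
      forall (z : grid d n) e w, `|mart_field j (grid_point R K z) e w| <=
        (8 * d.+1)%:R * (Q w + 1 + enorm (grid_point R K z))].
Proof.
exists (Psi j).
have [iQ EQ] := @E_wnorm2_transform _ _ _ P k G sG GS zeta zL2 zG z0 I lam kap q W
   lam0 (fun a => mulr_ge0 C'0 (sqrtr_ge0 _)) q0 W0 sum_lam_kap cc ccG cc_le j.
split=> // [w|z e w]; first exact: wnorm2_ge0.
by apply: le_trans (mart_field_grid_le j z e w) _; rewrite /q mulnA.
Qed.

End chaining.

(** * Quantitative regularity of the vector field *)

Section field_estimates.
Context (R : realType) (d k : nat).
Variables (T C : R) (f : R -> 'rV[R]_d -> 'rV[R]_k -> 'rV[R]_d).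
Variable A : 'I_k -> R -> 'rV[R]_d -> 'rV[R]_k -> 'rV[R]_d.

(** The only properties of the field that enter the error analysis.  [A l] plays
the part of the partial derivative in direction [l]; the Taylor inequality
determines it, and its bound and its regularity follow from the record. *)
Record field_estimates : Prop := FieldEstimates {
  fe_C : 0 <= C;
  fe_x : forall t x x' y, t \in `[0, T] ->
    enorm (f t x y - f t x' y) <= C * enorm (x - x');
  fe_y : forall t x y y', t \in `[0, T] ->
    enorm (f t x y - f t x y') <= C * enorm (y - y');
  fe_t : forall s t x y, 0 <= s -> s <= t -> t <= T ->
    enorm (f t x y - f s x y) <= C * (1 + enorm x + enorm y) * (t - s);
  fe_taylor : forall t x y z, t \in `[0, T] ->
    enorm (f t x (y + z) - f t x y - \sum_l z 0 l *: A l t x y)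
      <= C * enorm z ^+ 2 }.

Hypothesis T0 : 0 <= T.
Hypothesis fe : field_estimates.

Let C0 : 0 <= C := fe_C fe.

Definition growth_const := enorm (f 0 0 0) + C * T + C.

Lemma growth_const_ge0 : 0 <= growth_const.
Proof. by rewrite !addr_ge0 ?enorm_ge0// mulr_ge0. Qed.

Lemma field_growth t x y : t \in `[0, T] ->
  enorm (f t x y) <= growth_const * (1 + enorm x + enorm y).
Proof.
move=> tT; have := tT; rewrite in_itv /= => /andP[t0 t1].
have -> : f t x y = f 0 0 0 + (f t 0 0 - f 0 0 0) + (f t x 0 - f t 0 0)
    + (f t x y - f t x 0) by rewrite !subrKC ?addrA ?subrK// addrAC subrKC addrC subrK.
have h1 := fe_t fe 0 0 (lexx _) t0 t1.
have h2 := fe_x fe x 0 0 tT; have h3 := fe_y fe x y 0 tT.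
rewrite !enorm0 !subr0 !addr0 mulr1 in h1 h2 h3.
have h0 := enorm_ge0 (f 0 0 0); have hx := enorm_ge0 x; have hy := enorm_ge0 y.
apply: le_trans (enormD _ _) _; apply: le_trans (lerD (enormD _ _) h3) _.
apply: le_trans (lerD (lerD (enormD _ _) h2) (lexx _)) _.
have h4 : C * t <= C * T by rewrite ler_wpM2l.
have CT : 0 <= C * T by rewrite mulr_ge0.
have p : 0 <= (enorm (f 0 0 0) + C * T) * (enorm x + enorm y).
  by rewrite mulr_ge0// addr_ge0.
by rewrite /growth_const; have := C0; lra.
Qed.

(** Divide the Taylor inequality in direction [l] by the length of the increment. *)
Lemma partial_le l t x y : t \in `[0, T] -> enorm (A l t x y) <= C.
Proof.
move=> tT; rewrite -subr_le0; apply: (@le_inv_nat_all _ _ C) => n.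
pose dl : R := n.+1%:R^-1.
have dl0 : 0 < dl by rewrite invr_gt0.
have := fe_taylor fe x y (dl *: delta_mx 0 l) tT.
rewrite (bigD1 l)//= big1 ?addr0 => [|j jl]; last first.
  by rewrite !mxE (negbTE jl) andbF mulr0 scale0r.
rewrite !mxE !eqxx mulr1 enormZ enorm_delta mulr1 gtr0_norm//.
set D := f t x _; move=> h1.
have h2 := fe_y fe x (y + dl *: delta_mx 0 l) y tT.
rewrite [_ + _ - y]addrC addKr enormZ enorm_delta mulr1 gtr0_norm// -/D in h2.
have h3 : dl * enorm (A l t x y) <= C * dl + C * dl ^+ 2.
  rewrite -[dl in leLHS]gtr0_norm// -enormZ.
  have -> : dl *: A l t x y = (D - f t x y) - (D - f t x y - dl *: A l t x y).
    by rewrite subKr.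
  by apply: le_trans (enormD _ _) _; rewrite enormN lerD.
have : dl * enorm (A l t x y) <= dl * (C + C * dl) by lra.
by rewrite ler_pM2l// -/dl; lra.
Qed.

(** A derivative is a difference quotient of step [s] up to [C * s], and difference
quotients of step [s] at [x] and [x'] differ by at most [2 C |x - x'| / s]; the
choice [s = sqrt |x - x'|] balances the two. *)
Lemma partial_holder l t x x' y : t \in `[0, T] ->
  enorm (A l t x y - A l t x' y) <= 4 * C * Num.sqrt (enorm (x - x')).
Proof.
move=> tT; set s := Num.sqrt _.
have s0 : 0 <= s by exact: sqrtr_ge0.
have s2 : s ^+ 2 = enorm (x - x') by rewrite sqr_sqrtr// enorm_ge0.
move: s0; rewrite le_eqVlt => /predU1P[s0|s0].
  have /eqP : enorm (x - x') = 0 by rewrite -s2 -s0 expr0n.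
  move=> /eqP xx0; have xx : x = x'.
    apply/rowP => i; apply/eqP; rewrite -subr_eq0 -normr_le0 -xx0.
    by have := le_coord_enorm (x - x') i; rewrite !mxE.
  by rewrite xx subrr enorm0 -s0 mulr0.
have tay x1 : enorm (f t x1 (y + s *: delta_mx 0 l) - f t x1 y - s *: A l t x1 y)
    <= C * s ^+ 2.
  have := fe_taylor fe x1 y (s *: delta_mx 0 l) tT.
  rewrite (bigD1 l)//= big1 ?addr0 => [|j jl]; last first.
    by rewrite !mxE (negbTE jl) andbF mulr0 scale0r.
  by rewrite !mxE !eqxx mulr1 enormZ enorm_delta mulr1 gtr0_norm.
have h1 := tay x; have h2 := tay x'.
have h3 := fe_x fe x x' (y + s *: delta_mx 0 l) tT.
have h4 := fe_x fe x x' y tT.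
rewrite -s2 in h3 h4.
set D1 := f t x _ in h1 h3; set D2 := f t x' _ in h2 h3.
have h5 : s * enorm (A l t x y - A l t x' y) <= s * (4 * C * s).
  rewrite -[s in leLHS]gtr0_norm// -enormZ.
  have -> : s *: (A l t x y - A l t x' y) =
    (D1 - D2) - (f t x y - f t x' y) - (D1 - f t x y - s *: A l t x y)
      + (D2 - f t x' y - s *: A l t x' y).
    by apply/rowP => i; rewrite !mxE; ring.
  apply: le_trans (enormD _ _) _; apply: le_trans (lerD (enormD _ _) h2) _.
  rewrite enormN; apply: le_trans (lerD (lerD (enormD _ _) h1) (lexx _)) _.
  by rewrite enormN; lra.
by rewrite ler_pM2l in h5.
Qed.

Section measurability.
Context (d0 : measure_display) (Omega : measurableType d0).
Variables (X : Omega -> 'rV[R]_d) (Y : Omega -> 'rV[R]_k).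
Hypothesis mX : random_vector X.
Hypothesis mY : random_vector Y.

Lemma measurable_field t i : t \in `[0, T] ->
  measurable_fun setT (fun w => f t (X w) (Y w) 0 i).
Proof.
move=> tT; pose g (u : 'rV[R]_(d + k)) := f t (lsubmx u) (rsubmx u) 0 i.
have -> : (fun w => f t (X w) (Y w) 0 i) = g \o (fun w => row_mx (X w) (Y w)).
  by apply/funext => w; rewrite /g /= row_mxKl row_mxKr.
apply: (@measurable_lipschitz_comp _ _ _ _ _ _ (2 * C)).
  move=> j; case: (split_ordP j) => j' ->.
    by under eq_fun do rewrite row_mxEl; exact: mX.
  by under eq_fun do rewrite row_mxEr; exact: mY.
move=> u v.
have nl : enorm (lsubmx u - lsubmx v) <= enorm (u - v).
  rewrite /enorm ler_wsqrtr// big_split_ord /=.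
  apply: (@le_trans _ _ (\sum_(i < d) (u - v) 0 (lshift k i) ^+ 2)).
    by apply: ler_sum => j _; rewrite !mxE.
  by rewrite lerDl sumr_ge0// => j _; exact: sqr_ge0.
have nr : enorm (rsubmx u - rsubmx v) <= enorm (u - v).
  rewrite /enorm ler_wsqrtr// big_split_ord /=.
  apply: (@le_trans _ _ (\sum_(i < k) (u - v) 0 (rshift d i) ^+ 2)).
    by apply: ler_sum => j _; rewrite !mxE.
  by rewrite lerDr sumr_ge0// => j _; exact: sqr_ge0.
apply: (@le_trans _ _ (enorm (f t (lsubmx u) (rsubmx u) - f t (lsubmx v) (rsubmx v)))).
  by have := le_coord_enorm (f t (lsubmx u) (rsubmx u) - f t (lsubmx v) (rsubmx v)) i;
    rewrite !mxE.
apply: le_trans (enorm_dist_triangle _ (f t (lsubmx v) (rsubmx u)) _) _.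
apply: le_trans (lerD (fe_x fe _ _ _ tT) (fe_y fe _ _ _ tT)) _.
have := ler_wpM2l C0 nl; have := ler_wpM2l C0 nr; lra.
Qed.

End measurability.

(** [A l] is the limit of difference quotients of the measurable field. *)
Lemma measurable_partial (d0 : measure_display) (Omega : measurableType d0)
    (X : Omega -> 'rV[R]_d) (Y : Omega -> 'rV[R]_k) l t i :
  random_vector X -> random_vector Y -> t \in `[0, T] ->
  measurable_fun setT (fun w => A l t (X w) (Y w) 0 i).
Proof.
move=> mX mY tT.
apply: (@measurable_fun_cvg _ _ _ _ (fun n w => n.+1%:R *
  (f t (X w) (Y w + n.+1%:R^-1 *: delta_mx 0 l) 0 i - f t (X w) (Y w) 0 i))).
  move=> n; apply: measurable_funM => //; apply: measurable_funB.
    apply: measurable_field => // j; under eq_fun do rewrite !mxE.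
    by apply: measurable_funD.
  exact: measurable_field.
move=> w _; apply/cvgrPdist_le => e e0; near=> n.
pose dl : R := n.+1%:R^-1.
have dl0 : 0 < dl by rewrite invr_gt0.
have := fe_taylor fe (X w) (Y w) (dl *: delta_mx 0 l) tT.
rewrite (bigD1 l)//= big1 ?addr0 => [|j jl]; last first.
  by rewrite !mxE (negbTE jl) andbF mulr0 scale0r.
rewrite !mxE !eqxx mulr1 enormZ enorm_delta mulr1 gtr0_norm//.
move=> /(le_trans (le_coord_enorm _ i)); rewrite !mxE -/dl.
set D := f t (X w) _ 0 i - _; set a := A l t _ _ 0 i => h.
have -> : a - n.+1%:R * D = - (n.+1%:R * (D - dl * a)).
  by rewrite /dl; field; rewrite nat1r pnatr_eq0.
rewrite normrN normrM ger0_norm//.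
apply: le_trans (ler_wpM2l _ h) _ => //.
rewrite /dl -[leLHS](_ : C / n.+1%:R = _); last by field; rewrite nat1r pnatr_eq0.
rewrite ler_pdivrMr// -ler_pdivrMl//.
have Cn : e^-1 * C <= n%:R by near: n; exact: nbhs_infty_ger.
by apply: le_trans Cn _; rewrite ler_nat.
Unshelve. all: by end_near. Qed.

End field_estimates.

(** * Pathwise comparison of two Euler schemes *)

Section gronwall.
Context (R : realType).

Lemma sum_ord_widen (g : nat -> R) (j n : nat) : (forall i, 0 <= g i) ->
  (j <= n)%N -> \sum_(i < j) g i <= \sum_(i < n) g i.
Proof.
move=> g0 jn; rewrite -!(big_mkord xpredT g).
by rewrite [leRHS](big_cat_nat (leq0n j) jn)//= lerDl sumr_ge0.
Qed.

Lemma one_plus_pow_le_exp (b : R) n : 0 <= b -> (1 + b) ^+ n <= expR (b * n%:R).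
Proof.
move=> b0; rewrite expRM_natr lerXn2r ?nnegrE ?expR_ge0 ?addr_ge0//.
exact: expR_ge1Dx.
Qed.

Lemma discrete_gronwall (n : nat) (u : nat -> R) (a b : R) : 0 <= a -> 0 <= b ->
  (forall j, (j <= n)%N -> u j <= a + b * \sum_(i < j) u i) ->
  forall j, (j <= n)%N -> u j <= a * expR (b * j%:R).
Proof.
move=> a0 b0 H j jn; apply: le_trans (ler_wpM2l a0 (one_plus_pow_le_exp j b0)).
elim/ltn_ind: j jn => j IH jn; apply: le_trans (H j jn) _.
apply: (@le_trans _ _ (a + b * \sum_(i < j) a * (1 + b) ^+ i)).
  rewrite lerD2l ler_wpM2l//; apply: ler_sum => i _; apply: IH => //.
  exact: leq_trans (ltnW (ltn_ord i)) jn.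
rewrite le_eqVlt; apply/orP; left; apply/eqP.
elim: j {IH jn} => [|j IH]; first by rewrite big_ord0 expr0 mulr0 addr0 mulr1.
by rewrite big_ord_recr /= mulrDr addrA IH exprS; ring.
Qed.

End gronwall.

Section euler_scheme.
Context (R : realType) (d k : nat).
Variables (T C : R) (f : R -> 'rV[R]_d -> 'rV[R]_k -> 'rV[R]_d).
Variable A : 'I_k -> R -> 'rV[R]_d -> 'rV[R]_k -> 'rV[R]_d.
Hypothesis T0 : 0 < T.
Hypothesis fe : field_estimates T C f A.

Let C0 : 0 <= C := fe_C fe.

Lemma step_gt0 N : (0 < N)%N -> 0 < step T N.
Proof. by move=> N0; rewrite divr_gt0// ltr0n. Qed.

Lemma step_total N : (0 < N)%N -> step T N * N%:R = T.
Proof. by move=> N0; rewrite /step divfK// pnatr_eq0 -lt0n. Qed.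

Lemma mesh_in N j : (0 < N)%N -> (j <= N)%N -> mesh T N j \in `[0, T].
Proof.
move=> N0 jN; rewrite in_itv /= /mesh mulr_ge0 ?(ltW (step_gt0 N0))//=.
by rewrite -[leRHS](step_total N0) mulrC ler_wpM2l ?ler_nat// ltW// step_gt0.
Qed.

Lemma mesh_refine N m i : (0 < m)%N -> mesh T (N * m) (i * m) = mesh T N i.
Proof.
move=> m0; rewrite /mesh /step !natrM.
have m1 : m%:R != 0 :> R by rewrite pnatr_eq0 -lt0n.
by rewrite invfM mulrA [_ * m%:R]mulrC; rewrite -!mulrA mulrCA;
  congr (_ * _); rewrite mulrCA; congr (_ * _); rewrite mulrCA divff ?mulr1.
Qed.

Lemma eulerE N x y j : euler T f N x y j =
  x + \sum_(i < j) step T N *: f (mesh T N i) (euler T f N x y i) (y (mesh T N i)).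
Proof.
elim: j => [|j IH]; first by rewrite big_ord0 addr0.
by rewrite big_ord_recr /= addrA -IH.
Qed.

Lemma euler_lipschitz N x x' y j : (0 < N)%N -> (j <= N)%N ->
  enorm (euler T f N x y j - euler T f N x' y j) <= expR (C * T) * enorm (x - x').
Proof.
move=> N0 jN; have h0 := ltW (step_gt0 N0).
have := @discrete_gronwall _ N
  (fun j => enorm (euler T f N x y j - euler T f N x' y j))
  (enorm (x - x')) (step T N * C) (enorm_ge0 _) (mulr_ge0 h0 C0) _ j jN.
move=> H; apply: le_trans (H _) _ => [i iN|].
  rewrite !eulerE opprD addrACA -sumrB.
  apply: le_trans (enormD _ _) _; rewrite lerD2l.
  apply: le_trans (enorm_sum _ _ _) _; rewrite mulr_sumr; apply: ler_sum => l _.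
  rewrite -scalerBr enormZ ger0_norm// -mulrA ler_wpM2l//.
  by apply: (fe_x fe); apply: mesh_in => //; exact: ltnW (leq_trans (ltn_ord l) iN).
rewrite mulrC ler_wpM2r ?enorm_ge0// ler_expR -mulrA mulrCA ler_wpM2l//.
by rewrite -[leRHS](step_total N0) ler_wpM2l// ler_nat.
Qed.

Lemma sum_blocks (V : zmodType) (m j : nat) (g : nat -> V) :
  \sum_(n < j * m) g n = \sum_(i < j) \sum_(r < m) g (i * m + r)%N.
Proof.
elim: j => [|j IH]; first by rewrite mul0n !big_ord0.
by rewrite mulSnr big_split_ord /= IH big_ord_recr.
Qed.

Section refinement.
Variables (N m : nat) (x : 'rV[R]_d) (y z : R -> 'rV[R]_k).
Hypotheses (N0 : (0 < N)%N) (m0 : (0 < m)%N).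

Let h := step T N.
Let h' := step T (N * m).
Let t i := mesh T N i.
Let s i r := mesh T (N * m) (i * m + r).
Let U n := euler T f (N * m) x y n.
Let X i := euler T f N x y i.
Let dz i r := z (s i r) - z (t i).
Let df i r := y (s i r) - y (t i) - dz i r.

(** A bound for the distance travelled by the fine scheme inside block [i]. *)
Definition fine_drift i :=
  \sum_(r < m) h' * (growth_const T C f * (1 + enorm (U (i * m + r)) + enorm (y (s i r)))).

(** All of the local error except the feedback of the current error and the linear
term in [dz].  Here [z] is the martingale part of the noise path [y], and
[df] is the increment of the remaining part. *)
Definition local_remainder i r :=
  C * fine_drift i + C * (1 + enorm (X i) + enorm (y (s i r))) * h
  + C * enorm (df i r) + C * enorm (dz i r) ^+ 2.

Let h'0 : 0 < h'. Proof. by rewrite step_gt0// muln_gt0 N0. Qed.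

Let h0 : 0 < h. Proof. exact: step_gt0. Qed.

Lemma stepM : h' * m%:R = h.
Proof.
rewrite /h' /h /step natrM invfM mulrA -mulrA mulVf ?mulr1//.
by rewrite pnatr_eq0 -lt0n.
Qed.

Let nodeN i r : (i < N)%N -> (r < m)%N -> (i * m + r <= N * m)%N.
Proof. by move=> iN rm; nia. Qed.

Let s_in i r : (i < N)%N -> (r < m)%N -> s i r \in `[0, T].
Proof. by move=> iN rm; rewrite mesh_in ?muln_gt0 ?N0// nodeN. Qed.

Let t_in i : (i < N)%N -> t i \in `[0, T].
Proof. by move=> iN; rewrite mesh_in// ltnW. Qed.

Let s_minus_t i r : (r < m)%N -> 0 <= s i r - t i <= h.
Proof.
move=> rm; have -> : s i r - t i = h' * r%:R.
  by rewrite /t -(mesh_refine N i m0) /s /mesh natrD mulrDl addrC addKr mulrC.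
rewrite mulr_ge0 ?(ltW h'0)//= -stepM ler_wpM2l ?(ltW h'0)// ler_nat.
exact: ltnW.
Qed.

Lemma fine_increment i r : (i < N)%N -> (r < m)%N ->
  enorm (U (i * m + r) - U (i * m)) <= fine_drift i.
Proof.
move=> iN rm.
have -> : U (i * m + r) - U (i * m) =
    \sum_(r' < r) h' *: f (s i r') (U (i * m + r')) (y (s i r')).
  elim: r {rm} => [|r IH]; first by rewrite addn0 subrr big_ord0.
  by rewrite big_ord_recr /= -IH addnS /U /= addrAC.
apply: le_trans (enorm_sum _ _ _) _.
rewrite /fine_drift -(big_mkord xpredT (fun r =>
   h' * (growth_const T C f * (1 + enorm (U (i * m + r)) + enorm (y (s i r)))))).
rewrite -(big_mkord xpredT (fun r => enorm (h' *: f (s i r) (U (i * m + r)) (y (s i r))))).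
rewrite [leRHS](big_cat_nat (leq0n r) (ltnW rm))//= ler_wpDr//.
  have g0 := growth_const_ge0 (ltW T0) fe.
  apply: sumr_ge0 => j _; rewrite (mulr_ge0 (ltW h'0))// (mulr_ge0 g0)//.
  by rewrite !addr_ge0 ?enorm_ge0.
rewrite big_nat_cond [leRHS]big_nat_cond; apply: ler_sum => j /andP[/andP[_ jr] _].
rewrite enormZ gtr0_norm// ler_wpM2l ?(ltW h'0)//.
by apply: (field_growth (ltW T0) fe); apply: s_in => //; exact: ltn_trans rm.
Qed.

(** The arguments of [f] are changed one at a time: first the state, then the time,
then the part of the noise other than [z], and last [z] itself, by Taylor. *)
Lemma local_error i r : (i < N)%N -> (r < m)%N ->
  enorm (f (s i r) (U (i * m + r)) (y (s i r)) - f (t i) (X i) (y (t i))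
         - \sum_l dz i r 0 l *: A l (t i) (X i) (y (t i)))
  <= C * enorm (U (i * m) - X i) + local_remainder i r.
Proof.
move=> iN rm; have si := s_in iN rm; have ti := t_in iN.
have [/andP[st0 sth]] := (s_minus_t i rm).
set M := \sum_l _.
(* the intermediate values at which one argument has been changed *)
pose f1 := f (s i r) (X i) (y (s i r)).
pose f2 := f (t i) (X i) (y (s i r)).
pose f3 := f (t i) (X i) (y (t i) + dz i r).
have -> : f (s i r) (U (i * m + r)) (y (s i r)) - f (t i) (X i) (y (t i)) - M =
   (f (s i r) (U (i * m + r)) (y (s i r)) - f1) + (f1 - f2) + (f2 - f3)
   + (f3 - f (t i) (X i) (y (t i)) - M).
  by apply/rowP => e; rewrite !mxE; ring.
have b1 : enorm (f (s i r) (U (i * m + r)) (y (s i r)) - f1) <=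
    C * enorm (U (i * m) - X i) + C * fine_drift i.
  apply: le_trans (fe_x fe _ _ _ si) _; rewrite -mulrDr ler_wpM2l//.
  apply: le_trans (enorm_dist_triangle _ (U (i * m)) _) _.
  by rewrite addrC lerD2l; exact: fine_increment.
have b2 : enorm (f1 - f2) <= C * (1 + enorm (X i) + enorm (y (s i r))) * h.
  move: si ti; rewrite !in_itv /= => /andP[_ sT] /andP[t00 _].
  apply: le_trans (fe_t fe _ _ t00 _ sT) _; first by rewrite -subr_ge0.
  by rewrite ler_wpM2l// mulr_ge0// !addr_ge0// enorm_ge0.
have b3 : enorm (f2 - f3) <= C * enorm (df i r).
  by apply: le_trans (fe_y fe _ _ _ ti) _; rewrite opprD addrA.
have b4 := fe_taylor fe (X i) (y (t i)) (dz i r) ti.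
rewrite -/f3 -/M in b4.
apply: le_trans (enormD _ _) _; apply: le_trans (lerD (enormD _ _) b4) _.
apply: le_trans (lerD (lerD (enormD _ _) b3) (lexx _)) _.
by rewrite /local_remainder; lra.
Qed.

(** The linear terms are evaluated at the coarse scheme, whose state at the
beginning of a block is determined by [x] and by the noise up to then. *)
Definition martingale_part j : 'rV[R]_d :=
  \sum_(i < j) \sum_(r < m) h' *: \sum_l dz i r 0 l *: A l (t i) (X i) (y (t i)).

(** One coarse step is compared with the [m] fine steps of its block; the linear
terms are kept as a vector, since only their sum is small. *)
Lemma refinement_error j : (j <= N)%N ->
  enorm (U (j * m) - X j) <=
    (\sum_(i < N) \sum_(r < m) h' * local_remainder i r) + enorm (martingale_part j)
    + h * C * \sum_(i < j) enorm (U (i * m) - X i).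
Proof.
move=> jN.
have lr0 i r : 0 <= local_remainder i r.
  have g0 := growth_const_ge0 (ltW T0) fe.
  have fd0 : 0 <= fine_drift i.
    apply: sumr_ge0 => l _; rewrite (mulr_ge0 (ltW h'0))// (mulr_ge0 g0)//.
    by rewrite !addr_ge0 ?enorm_ge0.
  have := enorm_ge0 (X i); have := enorm_ge0 (y (s i r)) => y0 x0.
  by rewrite /local_remainder !addr_ge0// mulr_ge0 ?enorm_ge0 ?exprn_ge0 ?enorm_ge0
    ?(ltW h0)// mulr_ge0// !addr_ge0.
have -> : U (j * m) - X j = \sum_(i < j) \sum_(r < m) h' *:
    (f (s i r) (U (i * m + r)) (y (s i r)) - f (t i) (X i) (y (t i))).
  rewrite /U /X !eulerE opprD addrACA subrr add0r.
  rewrite (sum_blocks m j (fun n => step T (N * m) *: f (mesh T (N * m) n)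
    (euler T f (N * m) x y n) (y (mesh T (N * m) n)))) -sumrB.
  apply: eq_bigr => i _; under [RHS]eq_bigr do rewrite scalerBr.
  rewrite sumrB; congr (_ - _); rewrite sumr_const card_ord -scaler_nat scalerA.
  by rewrite mulrC stepM.
rewrite -[X in enorm X](subrK (martingale_part j)).
apply: le_trans (enormD _ _) _; rewrite -addrA [leRHS]addrCA [leRHS]addrC lerD2r.
rewrite /martingale_part -sumrB; apply: le_trans (enorm_sum _ _ _) _.
apply: (@le_trans _ _ (\sum_(i < j) (\sum_(r < m) h' * local_remainder i r
   + h * C * enorm (U (i * m) - X i)))).
  apply: ler_sum => i _; have iN := leq_trans (ltn_ord i) jN.
  rewrite -sumrB; apply: le_trans (enorm_sum _ _ _) _.
  apply: (@le_trans _ _ (\sum_(r < m) h' * (C * enorm (U (i * m) - X i) + local_remainder i r))).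
    apply: ler_sum => r _; rewrite -scalerBr enormZ gtr0_norm// ler_wpM2l ?(ltW h'0)//.
    exact: local_error.
  under eq_bigr do rewrite mulrDr.
  rewrite big_split /= addrC lerD2l sumr_const card_ord -mulr_natl -stepM.
  by rewrite le_eqVlt; apply/orP; left; apply/eqP; ring.
rewrite big_split /= -mulr_sumr lerD2r.
apply: (sum_ord_widen (g := fun i => \sum_(r < m) h' * local_remainder i r)) => // i.
by apply: sumr_ge0 => r _; rewrite mulr_ge0 ?(ltW h'0).
Qed.

End refinement.

End euler_scheme.

(** * The martingale noise over the blocks of a refinement *)

Section random_vectors.
Context (R : realType) (d0 : measure_display) (Omega : measurableType d0).

Lemma measurable_enorm n (V : Omega -> 'rV[R]_n) :
  random_vector V -> measurable_fun setT (fun w => enorm (V w)).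
Proof.
move=> mV; apply: (@measurable_lipschitz_comp _ _ _ _ V (@enorm R n) 1) => // u v.
rewrite mul1r ler_norml.
have h1 := enormD (u - v) v; have h2 := enormD (v - u) u.
rewrite subrK in h1; rewrite subrK enormB in h2.
by apply/andP; split; lra.
Qed.

Lemma random_vectorB n (V W : Omega -> 'rV[R]_n) :
  random_vector V -> random_vector W -> random_vector (fun w => V w - W w).
Proof.
move=> mV mW i; under eq_fun do rewrite !mxE.
exact: measurable_funB.
Qed.

Context (d k : nat) (T C : R) (f : R -> 'rV[R]_d -> 'rV[R]_k -> 'rV[R]_d).
Variable A : 'I_k -> R -> 'rV[R]_d -> 'rV[R]_k -> 'rV[R]_d.
Hypothesis T0 : 0 < T.
Hypothesis fe : field_estimates T C f A.

Lemma random_vector_euler N (x : Omega -> 'rV[R]_d) (Y : R -> Omega -> 'rV[R]_k) j :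
  (0 < N)%N -> (j <= N)%N -> random_vector x ->
  (forall i, (i < j)%N -> random_vector (Y (mesh T N i))) ->
  random_vector (fun w => euler T f N (x w) (Y ^~ w) j).
Proof.
move=> N0 + mx; elim: j => [|j IH] jN mY e //=.
under eq_fun do rewrite !mxE.
have mE : random_vector (fun w => euler T f N (x w) (Y ^~ w) j).
  by apply: IH => [|i ij]; [exact: ltnW|apply: mY; exact: ltnW].
apply: measurable_funD; first exact: mE.
apply: measurable_funM => //.
apply: (measurable_field fe) => //; first by apply: mY.
by apply: mesh_in => //; exact: ltnW.
Qed.

End random_vectors.

Section zero_mean_sum.
Context (R : realType) (d0 : measure_display) (Omega : measurableType d0).
Variable P : probability Omega R.

Lemma Rintegral_sum_eq0 (S : set Omega) n (D : 'I_n -> Omega -> R) :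
  measurable S -> (forall r, L1 P (D r)) ->
  (forall r, \int[P]_(w in S) D r w = 0) ->
  \int[P]_(w in S) (\sum_r D r w) = 0.
Proof.
move=> mS iD D0.
suff H (s : seq 'I_n) : P.-integrable S (EFin \o (fun w => \sum_(r <- s) D r w)) /\
    \int[P]_(w in S) (\sum_(r <- s) D r w) = 0 by case: (H (index_enum 'I_n)).
have iS r : P.-integrable S (EFin \o D r) by apply: integrableS (iD r).
elim: s => [|r s [iIH IH]].
  split; last by under eq_Rintegral do rewrite big_nil; rewrite Rintegral_cst// mul0r.
  by apply: eq_integrable (integrable0 _ _) => // w _ /=; rewrite big_nil.
split; last first.
  by under eq_Rintegral do rewrite big_cons; rewrite RintegralD// D0 add0r.
have := integrableD mS (iS r) iIH.
by apply: eq_integrable => // w _ /=; rewrite big_cons EFinD.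
Qed.

End zero_mean_sum.

Section noise.
Context (R : realType) (d0 : measure_display) (Omega : measurableType d0).
Variables (P : probability Omega R) (T : R) (k : nat).
Variable Filt : R -> set_system Omega.
Variables (Z : R -> Omega -> 'rV[R]_k).
Hypothesis T0 : 0 < T.
Hypothesis Fs : forall t, 0 <= t -> sigma_algebra setT (Filt t) /\ Filt t `<=` measurable.
Hypothesis Fm : forall s t, 0 <= s -> s <= t -> Filt s `<=` Filt t.
Hypothesis Zmart : forall s t, 0 <= s -> s <= t -> t <= T -> forall l,
  is_cond_exp P (Filt s) (fun w => Z t w 0 l) (fun w => Z s w 0 l).
Hypothesis ZT2 : forall l, L2 P (fun w => Z T w 0 l).

Definition energy t l := E P (fun w => Z t w 0 l ^+ 2).

Lemma mart_L2 t l : 0 <= t -> t <= T -> L2 P (fun w => Z t w 0 l).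
Proof.
by move=> t0 tT; have [] := cond_exp_sq (Fs t0).2 (Zmart t0 tT (lexx _) l) (ZT2 l).
Qed.

Lemma energy_le s t l : 0 <= s -> s <= t -> t <= T -> energy s l <= energy t l.
Proof.
move=> s0 st tT; have t0 := le_trans s0 st.
by have [] := cond_exp_sq (Fs s0).2 (Zmart s0 st tT l) (mart_L2 l t0 tT).
Qed.

Lemma energy_ge0 t l : 0 <= energy t l.
Proof. by apply: E_ge0 => w; exact: sqr_ge0. Qed.

(** Orthogonality of martingale increments, which makes energies additive over a
partition. *)
Lemma energy_increment s t l : 0 <= s -> s <= t -> t <= T ->
  E P (fun w => (Z t w 0 l - Z s w 0 l) ^+ 2) = energy t l - energy s l.
Proof.
move=> s0 st tT; have t0 := le_trans s0 st.
exact: (cond_exp_increment_sq (Fs s0).2 (Zmart s0 st tT l) (mart_L2 l t0 tT)).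
Qed.

Lemma mart_increment_orth s t l S : 0 <= s -> s <= t -> t <= T -> Filt s S ->
  \int[P]_(w in S) (Z t w 0 l - Z s w 0 l) = 0.
Proof.
move=> s0 st tT FS; have [iZt iZs _ /(_ S FS) ZS] := Zmart s0 st tT l.
have mS := (Fs s0).2 _ FS.
by rewrite RintegralB ?ZS ?subrr//; [apply: integrableS iZt|apply: integrableS iZs].
Qed.

Variables (N m : nat).
Hypotheses (N0 : (0 < N)%N) (m0 : (0 < m)%N).

Let h := step T N.
Let h' := step T (N * m).
Let t i := mesh T N i.
Let s i r := mesh T (N * m) (i * m + r).

Lemma mesh_order i r : (i < N)%N -> (r < m)%N ->
  [/\ 0 <= t i, t i <= s i r, s i r <= t i.+1 & t i.+1 <= T].
Proof.
move=> iN rm; have h'0 : 0 < h' by rewrite step_gt0// muln_gt0 N0.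
have := mesh_in T0 N0 (ltnW iN); have := mesh_in T0 N0 iN.
rewrite !in_itv /= => /andP[_ tT] /andP[t00 _].
split=> //.
  by rewrite /t -(mesh_refine T N i m0) /s /mesh ler_wpM2r ?(ltW h'0)// ler_nat leq_addr.
rewrite /t -(mesh_refine T N i.+1 m0) /s /mesh ler_wpM2r ?(ltW h'0)// ler_nat.
by rewrite mulSnr leq_add2l ltnW.
Qed.

Definition incr i (r : 'I_m) l w := Z (s i r) w 0 l - Z (t i) w 0 l.

Lemma incr_L2 i r l : (i < N)%N -> L2 P (incr i r l).
Proof.
move=> iN; have [t0 ts st tT] := mesh_order iN (ltn_ord r).
apply: L2B; apply: mart_L2 => //.
- exact: le_trans ts.
- exact: le_trans tT.
- exact: le_trans (le_trans ts st) tT.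
Qed.

(** The increments from [t i] to [s i r], for a fixed [r], run over disjoint
intervals. *)
Lemma sum_incr_sq r l :
  \sum_(i < N) E P (fun w => incr i r l w ^+ 2) <= energy T l.
Proof.
apply: (@le_trans _ _ (\sum_(i < N) (energy (t i.+1) l - energy (t i) l))).
  apply: ler_sum => i _; have [t0 ts st tT] := mesh_order (ltn_ord i) (ltn_ord r).
  rewrite energy_increment ?(le_trans st tT)// lerD2r energy_le//.
  exact: le_trans ts.
rewrite -(big_mkord xpredT (fun i => energy (t i.+1) l - energy (t i) l)).
rewrite telescope_sumr//; have -> : t N = T by rewrite /t /mesh mulrC step_total.
by rewrite lerBlDr lerDl energy_ge0.
Qed.

(** The linear term of a block has the coarse coefficient in common, so the [m]
increments enter through their mean, a martingale difference for the coarse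
filtration.  After the last block it is extended by 0. *)
Definition block_noise i l w :=
  if (i < N)%N then m%:R^-1 * \sum_r incr i r l w else 0.

(** Times beyond [T] are cut off, so that the family is a filtration for all
indices. *)
Definition block_filt i := Filt (Num.min (t i) T).

Let t_ge0 i : 0 <= t i.
Proof. by rewrite /t /mesh mulr_ge0// ltW// step_gt0. Qed.

Let tT_ge0 i : 0 <= Num.min (t i) T.
Proof. by rewrite le_min t_ge0 ltW. Qed.

Lemma block_filt_sigma i : sigma_algebra setT (block_filt i) /\ block_filt i `<=` measurable.
Proof. exact: Fs. Qed.

Lemma block_filtS i : block_filt i `<=` block_filt i.+1.
Proof.
apply: Fm => //; rewrite le_min !ge_min lexx orbT andbT.
by rewrite /t /mesh ler_wpM2r ?ler_nat// ltW// step_gt0.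
Qed.

Lemma block_filtE i : (i <= N)%N -> block_filt i = Filt (t i).
Proof.
move=> iN; rewrite /block_filt min_l//.
by have := mesh_in T0 N0 iN; rewrite in_itv => /andP[].
Qed.

Lemma block_noise_L2 i l : L2 P (block_noise i l).
Proof.
rewrite /block_noise; case: ltnP => iN; last exact: L2_cst.
by apply: L2Z; apply: L2_sum => r _; exact: incr_L2.
Qed.

Lemma block_noise_measurable i l : measurable_wrt (block_filt i.+1) (block_noise i l).
Proof.
apply/(measurable_wrtP (block_filt_sigma i.+1).1); rewrite /block_noise.
case: ltnP => iN; last exact: measurable_cst.
apply: measurable_funM => //; apply: measurable_sum_fin => r.
have [t0 ts st tT] := mesh_order iN (ltn_ord r).
have up u : 0 <= u -> u <= t i.+1 -> measurable_fun
    (setT : set (g_sigma_algebraType (block_filt i.+1))) (fun w => Z u w 0 l).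
  move=> u0 ut; apply/(measurable_wrtP (block_filt_sigma i.+1).1).
  have [_ _ mZ _] := Zmart u0 (le_trans ut tT) (lexx _) l.
  by rewrite block_filtE// => B mB; apply: Fm u0 ut _ _; exact: mZ.
apply: measurable_funB; apply: up => //.
- exact: le_trans ts.
- exact: le_trans ts st.
Qed.

Lemma block_noise_orth i l S : block_filt i S -> \int[P]_(w in S) block_noise i l w = 0.
Proof.
move=> FS; have mS := (block_filt_sigma i).2 _ FS.
rewrite /block_noise; case: ltnP => iN; last by rewrite Rintegral_cst// mul0r.
have iI r : L1 P (incr i r l) by apply: L2_L1; exact: incr_L2.
rewrite RintegralZl//; last first.
  by apply: integrableS (L1_sum (index_enum _) (fun r _ => iI r)).
rewrite Rintegral_sum_eq0 ?mulr0// => r.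
have [t0 ts st tT] := mesh_order iN (ltn_ord r).
apply: mart_increment_orth => //; first exact: le_trans tT.
by rewrite block_filtE// in FS; exact: ltnW.
Qed.

(** By Cauchy-Schwarz the square of a mean is at most the mean of the squares, and
each of the [m] families of increments has its energy bounded by that of [Z T]. *)
Lemma block_noise_energy j : (j <= N)%N ->
  \sum_(i < j) E P (fun w => (\sum_l `|block_noise i l w|) ^+ 2)
    <= k%:R * \sum_l energy T l.
Proof.
move=> jN.
apply: (@le_trans _ _ (\sum_(i < j) k%:R * \sum_l m%:R^-1 * \sum_(r < m)
    E P (fun w => incr i r l w ^+ 2))).
  apply: ler_sum => i _; have iN := leq_trans (ltn_ord i) jN.
  have iI r l : L1 P (fun w => incr i r l w ^+ 2) by case: (incr_L2 r l iN).
  have iB : L2 P (fun w => \sum_l `|block_noise i l w|).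
    by apply: L2_sum => l _; apply: L2_norm; exact: block_noise_L2.
  have iS : L1 P (fun w => k%:R * \sum_l m%:R^-1 * \sum_(r < m) incr i r l w ^+ 2).
    by apply/L1Z/L1_sum => l _; apply/L1Z/L1_sum.
  apply: le_trans (E_le iB.2 iS _) _ => [w|].
    have := sum_mul_sq_le (fun=> 1) (fun l => `|block_noise i l w|).
    under eq_bigr do rewrite mul1r.
    move/le_trans; apply; under eq_bigr do rewrite expr1n.
    rewrite sumr_const card_ord ler_wpM2l//; apply: ler_sum => l _.
    rewrite real_normK ?num_real// /block_noise iN exprMn.
    have := sum_mul_sq_le (fun=> 1) (fun r => incr i r l w).
    under eq_bigr do rewrite mul1r.
    under [X in _ <= X * _]eq_bigr do rewrite expr1n.
    rewrite sumr_const card_ord => H.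
    have mp : 0 < m%:R :> R by rewrite ltr0n.
    rewrite expr2 -mulrA ler_pM2l ?invr_gt0// ler_pdivrMl//.
  rewrite EZ; last by apply/L1_sum => l _; apply/L1Z/L1_sum.
  rewrite ler_wpM2l// E_sum; last by move=> l; apply/L1Z/L1_sum.
  apply: ler_sum => l _; rewrite EZ; last exact: L1_sum.
  by rewrite E_sum.
rewrite -mulr_sumr ler_wpM2l// exchange_big; apply: ler_sum => l _ /=.
rewrite -mulr_sumr exchange_big /=.
have mp : 0 < m%:R :> R by rewrite ltr0n.
rewrite ler_pdivrMl// mulr_natl -[X in _ *+ X](card_ord m) -sumr_const.
apply: ler_sum => r _; apply: le_trans (sum_incr_sq r l).
apply: (sum_ord_widen (g := fun i => E P (fun w => incr i r l w ^+ 2))) => // i.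
by apply: E_ge0 => w; exact: sqr_ge0.
Qed.

End noise.

(** * Expected error of a refinement from a grid-valued start *)

Lemma measurable_fin_comp (R : realType) (d0 : measure_display)
    (Omega : measurableType d0) (I : finType) (g : Omega -> I) (phi : I -> R) :
  (forall a, measurable [set w | g w = a]) ->
  measurable_fun setT (fun w => phi (g w)).
Proof.
move=> mg _ B mB; rewrite setTI.
have -> : (fun w => phi (g w)) @^-1` B =
    \bigcup_(a in [set a | B (phi a)]) [set w | g w = a].
  by apply/seteqP; split=> w /=; [exists (g w)|move=> [a /= Ba ->]].
by apply: fin_bigcup_measurable => // a _; exact: mg.
Qed.

Section expected_error.
Context (R : realType) (d0 : measure_display) (Omega : measurableType d0).
Variables (P : probability Omega R) (d k : nat) (T C : R).
Variables (f : R -> 'rV[R]_d -> 'rV[R]_k -> 'rV[R]_d).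
Variable A : 'I_k -> R -> 'rV[R]_d -> 'rV[R]_k -> 'rV[R]_d.
Hypothesis T0 : 0 < T.
Hypothesis fe : field_estimates T C f A.
Variable Y : R -> Omega -> 'rV[R]_k.
Hypothesis mY : forall t, t \in `[0, T] -> random_vector (Y t).
Variable BY : R.
Hypothesis BY0 : 0 <= BY.
Hypothesis YL1 : forall t, t \in `[0, T] ->
  L1 P (fun w => enorm (Y t w)) /\ E P (fun w => enorm (Y t w)) <= BY.

Let C0 : 0 <= C := fe_C fe.
Let Cg := growth_const T C f.
Let Cg0 : 0 <= Cg := growth_const_ge0 (ltW T0) fe.

Lemma L1_nonneg_dom (X V : Omega -> R) : measurable_fun setT X ->
  (forall w, 0 <= X w) -> (forall w, X w <= V w) -> L1 P V -> L1 P X.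
Proof. by move=> mX X0 XV; apply: L1_dom => // w; rewrite ger0_norm. Qed.

Definition moment_const (B0 : R) := (B0 + T * Cg * (1 + BY)) * expR (Cg * T).

(** Linear growth of the field and Gronwall, applied to expectations. *)
Lemma euler_moment N (x : Omega -> 'rV[R]_d) B0 : (0 < N)%N -> 0 <= B0 ->
  random_vector x -> L1 P (fun w => enorm (x w)) ->
  E P (fun w => enorm (x w)) <= B0 ->
  forall j, (j <= N)%N -> L1 P (fun w => enorm (euler T f N (x w) (Y ^~ w) j)) /\
    E P (fun w => enorm (euler T f N (x w) (Y ^~ w) j)) <= moment_const B0.
Proof.
move=> N0 B00 mx ix xB.
have h0 := ltW (step_gt0 T0 N0); set h := step T N in h0.
pose X j w := euler T f N (x w) (Y ^~ w) j.
pose ti i := mesh T N i.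
have tin i : (i < N)%N -> ti i \in `[0, T] by move=> iN; apply: mesh_in => //; exact: ltnW.
have mX j : (j <= N)%N -> measurable_fun setT (fun w => enorm (X j w)).
  move=> jN; apply: measurable_enorm.
  apply: (random_vector_euler T0 fe) => // i ij.
  by apply/mY/tin; exact: leq_trans jN.
pose D i w := h * (Cg * (1 + enorm (X i w) + enorm (Y (ti i) w))).
have pw j w : (j <= N)%N -> enorm (X j w) <= enorm (x w) + \sum_(i < j) D i w.
  move=> jN; rewrite /X eulerE; apply: le_trans (enormD _ _) _; rewrite lerD2l.
  apply: le_trans (enorm_sum _ _ _) _; apply: ler_sum => i _.
  rewrite enormZ ger0_norm// ler_wpM2l//.
  by apply: (field_growth (ltW T0) fe); apply: tin; exact: leq_trans jN.
have iY i : (i < N)%N -> L1 P (fun w => enorm (Y (ti i) w)).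
  by move=> iN; case: (YL1 (tin i iN)).
have iX j : (j <= N)%N -> L1 P (fun w => enorm (X j w)).
  elim/ltn_ind: j => j IH jN.
  apply: (@L1_nonneg_dom _ (fun w => enorm (x w) + \sum_(i < j) D i w)).
  - exact: mX.
  - by move=> w; exact: enorm_ge0.
  - by move=> w; exact: pw.
  - apply: L1D => //; apply: L1_sum => i _.
    have iN : (i < N)%N := leq_trans (ltn_ord i) jN.
    apply/L1Z/L1Z; apply: L1D; last exact: iY.
    by apply: L1D; [exact: L1_cst|apply: IH => //; exact: ltnW].
have iD i : (i < N)%N -> L1 P (D i).
  move=> iN; apply/L1Z/L1Z; apply: L1D; last exact: iY.
  by apply: L1D; [exact: L1_cst|apply: iX; exact: ltnW].
move=> j jN; split; first exact: iX.
have TC0 : 0 <= T * Cg * (1 + BY)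
  by apply: mulr_ge0; [apply: mulr_ge0; [exact: ltW|exact: Cg0]|exact: addr_ge0].
have := @discrete_gronwall _ N (fun j => E P (fun w => enorm (X j w)))
  (B0 + T * Cg * (1 + BY)) (h * Cg) (addr_ge0 B00 TC0) (mulr_ge0 h0 Cg0) _ j jN.
move=> H; apply: le_trans (H _) _ => [i iN|]; last first.
  rewrite ler_wpM2l ?addr_ge0// ler_expR mulrC mulrA mulrC ler_wpM2l//.
  by rewrite -[leRHS](step_total T N0) mulrC ler_wpM2l ?ler_nat.
have iDi (l : 'I_i) : L1 P (D l) by apply: iD; exact: leq_trans iN.
apply: le_trans (E_le (iX i iN) (L1D ix (L1_sum (index_enum _) (fun l _ => iDi l))) (fun w => pw i w iN)) _.
rewrite ED ?E_sum//; last by apply: L1_sum.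
rewrite -addrA lerD//.
have -> : T * Cg * (1 + BY) = \sum_(l < N) h * (Cg * (1 + BY)).
  by rewrite sumr_const card_ord -mulr_natl -(step_total T N0) -/h; ring.
apply: (@le_trans _ _ (\sum_(l < i) h * (Cg * (1 + BY)) +
  h * Cg * \sum_(l < i) E P (fun w => enorm (X l w)))).
  rewrite mulr_sumr -big_split /=; apply: ler_sum => l _.
  have lN : (l < N)%N by exact: leq_trans iN.
  have iXl := iX l (ltnW lN); have iYl := iY l lN.
  have iS : L1 P (fun w => 1 + enorm (X l w) + enorm (Y (ti l) w)).
    by apply: L1D => //; apply: L1D => //; exact: L1_cst.
  rewrite EZ; last exact: L1Z.
  rewrite EZ// ED//; last by apply: L1D => //; exact: L1_cst.
  rewrite ED ?E_cst//; last exact: L1_cst.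
  set u := E P (fun w => enorm (X l w)).
  have -> : h * (Cg * (1 + BY)) + h * Cg * u = h * (Cg * (1 + u + BY)) by ring.
  by rewrite ler_wpM2l// ler_wpM2l// lerD2l; exact: (YL1 (tin l lN)).2.
rewrite lerD2r; apply: (sum_ord_widen (g := fun=> h * (Cg * (1 + BY)))) => // _.
by apply: mulr_ge0 => //; apply: mulr_ge0; [exact: Cg0|exact: addr_ge0].
Qed.

Variable Filt : R -> set_system Omega.
Variable Z : R -> Omega -> 'rV[R]_k.
Hypothesis Fs : forall t, 0 <= t -> sigma_algebra setT (Filt t) /\ Filt t `<=` measurable.
Hypothesis Fm : forall s t, 0 <= s -> s <= t -> Filt s `<=` Filt t.
Hypothesis YF : forall t, t \in `[0, T] -> forall i, measurable_wrt (Filt t) (fun w => Y t w 0 i).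
Hypothesis Zmart : forall s t, 0 <= s -> s <= t -> t <= T -> forall l,
  is_cond_exp P (Filt s) (fun w => Z t w 0 l) (fun w => Z s w 0 l).
Hypothesis ZT2 : forall l, L2 P (fun w => Z T w 0 l).

(** The increments of [F], written through [Y] and [Z]: in this form they are
random vectors, and they agree with those of [F] almost surely. *)
Definition fv_incr N m i r w :=
  Y (mesh T (N * m) (i * m + r)) w - Y (mesh T N i) w -
  (Z (mesh T (N * m) (i * m + r)) w - Z (mesh T N i) w).

Variable V1 : R.
Hypothesis FV : forall N m r, (0 < N)%N -> (r < m)%N ->
  E P (fun w => \sum_(i < N) enorm (fv_incr N m i r w)) <= V1.

Definition total_energy := \sum_l energy P Z T l.

Let Cc := 4 * C * expR (C * T).

Definition remainder_const (B0 : R) :=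
  T * C * Cg * (1 + moment_const B0 + BY) + T * C * (1 + moment_const B0 + BY)
  + C * V1 + C * total_energy.

Definition refinement_const (B0 : R) :=
  (remainder_const B0 +
   d%:R * ((8 * d.+1)%:R * (chain_const d Cc * (k%:R * total_energy) + 1 + B0)))
  * expR (C * T).

Variables (N m : nat).
Hypotheses (N0 : (0 < N)%N) (m0 : (0 < m)%N).

Let h := step T N.
Let h' := step T (N * m).
Let t i := mesh T N i.
Let s i r := mesh T (N * m) (i * m + r).

Let Nm0 : (0 < N * m)%N. Proof. by rewrite muln_gt0 N0. Qed.
Let h'0 : 0 <= h'. Proof. exact/ltW/step_gt0. Qed.
Let h0 : 0 <= h. Proof. exact/ltW/step_gt0. Qed.

Let t_in i : (i < N)%N -> t i \in `[0, T].
Proof. by move=> iN; rewrite mesh_in// ltnW. Qed.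

Let node i r : (i < N)%N -> (r < m)%N -> (i * m + r < N * m)%N.
Proof. by move=> iN rm; nia. Qed.

Let s_in i r : (i < N)%N -> (r < m)%N -> s i r \in `[0, T].
Proof. by move=> iN rm; rewrite mesh_in// ltnW// node. Qed.

Let mZ u : u \in `[0, T] -> random_vector (Z u).
Proof.
rewrite in_itv /= => /andP[u0 uT] l.
by have [_ iZ _ _] := Zmart u0 uT (lexx _) l; exact: L1_measurable iZ.
Qed.

Let dz i r w := Z (s i r) w - Z (t i) w.

Let dz_sqE (i r : nat) (rm : (r < m)%N) w :
  enorm (dz i r w) ^+ 2 = \sum_l incr T Z N i (Ordinal rm) l w ^+ 2.
Proof. by rewrite enorm_sq; apply: eq_bigr => l _; rewrite !mxE. Qed.

Let dz_sq_L1 i r : (i < N)%N -> (r < m)%N -> L1 P (fun w => enorm (dz i r w) ^+ 2).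
Proof.
move=> iN rm; under eq_fun do rewrite (dz_sqE i rm).
by apply: L1_sum => l _; case: (incr_L2 T0 Fs Zmart ZT2 N0 m0 (Ordinal rm) l iN).
Qed.

Lemma fv_incr_L1 i r : (i < N)%N -> (r < m)%N -> L1 P (fun w => enorm (fv_incr N m i r w)).
Proof.
move=> iN rm; have si := s_in iN rm; have ti := t_in iN.
apply: (@L1_nonneg_dom _ (fun w => enorm (Y (s i r) w) + enorm (Y (t i) w) +
   (1 + enorm (dz i r w) ^+ 2))).
- apply: measurable_enorm; apply: random_vectorB; apply: random_vectorB.
  + exact: mY.
  + exact: mY.
  + exact: mZ.
  + exact: mZ.
- by move=> w; exact: enorm_ge0.
- move=> w; apply: le_trans (enormD _ _) _; rewrite enormN -/(dz i r w).
  apply: lerD; first by apply: le_trans (enormD _ _) _; rewrite enormN.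
  by have := enorm_ge0 (dz i r w); nra.
- by apply: L1D; [apply: L1D; [case: (YL1 si)|case: (YL1 ti)]|
    apply: L1D; [exact: L1_cst|exact: dz_sq_L1]].
Qed.

(** Each of the four contributions to the local remainder has expectation [O(h)]
once summed over the blocks: drift and time by the moment bound, [fv_incr] by the
variation, and the squares by the energy. *)
Lemma remainder_moment (x : Omega -> 'rV[R]_d) B0 : 0 <= B0 ->
  random_vector x -> L1 P (fun w => enorm (x w)) ->
  E P (fun w => enorm (x w)) <= B0 ->
  let Rem w := \sum_(i < N) \sum_(r < m)
     h' * local_remainder T C f N m (x w) (Y ^~ w) (Z ^~ w) i r in
  L1 P Rem /\ E P Rem <= h * remainder_const B0.
Proof.
move=> B00 mx ix xB Rem.
pose B := 1 + moment_const B0 + BY.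
have momU n : (n <= N * m)%N -> _ := euler_moment Nm0 B00 mx ix xB (j := n).
have momX i : (i <= N)%N -> _ := euler_moment N0 B00 mx ix xB (j := i).
pose fd i w := fine_drift T C f N m (x w) (Y ^~ w) i.
pose g1 M n u w := 1 + enorm (euler T f M (x w) (Y ^~ w) n) + enorm (Y u w).
have g1P M n u : (0 < M)%N -> (n <= M)%N -> u \in `[0, T] ->
    L1 P (g1 M n u) /\ E P (g1 M n u) <= B.
  move=> M0 nM uT; have [iU EU] := euler_moment M0 B00 mx ix xB nM.
  have [iY EY] := YL1 uT.
  have i1U : L1 P (fun w => 1 + enorm (euler T f M (x w) (Y ^~ w) n)).
    by apply: L1D => //; exact: L1_cst.
  split; first exact: L1D.
  rewrite /g1 ED// ED ?E_cst//; last exact: L1_cst.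
  by rewrite /B; lra.
have fdP i : (i < N)%N -> L1 P (fd i) /\ E P (fd i) <= h * Cg * B.
  move=> iN.
  have iT (r : 'I_m) : L1 P (fun w => h' * (Cg * g1 (N * m)%N (i * m + r)%N (s i r) w)).
    by apply/L1Z/L1Z; case: (g1P (N * m)%N (i * m + r)%N (s i r) Nm0
      (ltnW (node iN (ltn_ord r))) (s_in iN (ltn_ord r))).
  split; first by apply: L1_sum => r _; exact: iT.
  rewrite /fd /fine_drift E_sum; last by move=> r; exact: iT.
  rewrite /h -(stepM T N m0) -/h'.
  have -> : h' * m%:R * Cg * B = \sum_(r < m) h' * (Cg * B).
    by rewrite sumr_const card_ord -[RHS]mulr_natl; ring.
  apply: ler_sum => r _.
  have [ig Eg] := g1P (N * m)%N (i * m + r)%N (s i r) Nm0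
      (ltnW (node iN (ltn_ord r))) (s_in iN (ltn_ord r)).
  rewrite -/Cg EZ; last exact: L1Z.
  by rewrite EZ// ler_wpM2l// ler_wpM2l.
have lrP i r : (i < N)%N -> (r < m)%N ->
    let lr w := local_remainder T C f N m (x w) (Y ^~ w) (Z ^~ w) i r in
    L1 P lr /\ E P lr <= C * (h * Cg * B) + C * B * h
       + C * E P (fun w => enorm (fv_incr N m i r w))
       + C * E P (fun w => enorm (dz i r w) ^+ 2).
  move=> iN rm lr.
  have [ifd Efd] := fdP i iN.
  have [ig Eg] := g1P N i (s i r) N0 (ltnW iN) (s_in iN rm).
  have idf := fv_incr_L1 iN rm; have idz := dz_sq_L1 iN rm.
  have -> : lr = fun w => C * fd i w + C * h * g1 N i (s i r) w
     + C * enorm (fv_incr N m i r w) + C * enorm (dz i r w) ^+ 2.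
    by apply/funext => w; rewrite /lr /local_remainder /g1 -/(fd i w) -/h; ring.
  have j1 := L1Z C ifd; have j2 := L1Z (C * h) ig; have j3 := L1Z C idf.
  have j4 := L1Z C idz; have j12 := L1D j1 j2; have j123 := L1D j12 j3.
  split; first exact: L1D.
  rewrite ED// ED// ED// !EZ//.
  rewrite !lerD2r; apply: lerD; first by rewrite ler_wpM2l.
  by rewrite [C * B * h]mulrAC ler_wpM2l// mulr_ge0.
have iRem : L1 P Rem.
  by apply: L1_sum => i _; apply: L1_sum => r _; apply: L1Z;
    case: (lrP i r (ltn_ord i) (ltn_ord r)).
split=> //.
rewrite /Rem E_sum; last first.
  by move=> i; apply: L1_sum => r _; apply: L1Z; case: (lrP i r (ltn_ord i) (ltn_ord r)).
have [b bE] : exists b, b = C * (h * Cg * B) + C * B * h by eexists.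
set b3 := fun i r => C * E P (fun w => enorm (fv_incr N m i r w)).
set b4 := fun i r => C * E P (fun w => enorm (dz i r w) ^+ 2).
apply: (@le_trans _ _ (\sum_(i < N) \sum_(r < m) h' * (b + b3 i r + b4 i r))).
  apply: ler_sum => i _; rewrite E_sum; last first.
    by move=> r; apply: L1Z; case: (lrP i r (ltn_ord i) (ltn_ord r)).
  apply: ler_sum => r _; have [il El] := lrP i r (ltn_ord i) (ltn_ord r).
  by rewrite EZ// ler_wpM2l// bE.
under eq_bigr do under eq_bigr do rewrite !mulrDr.
under eq_bigr do rewrite !big_split /=.
rewrite !big_split /=.
have -> : h * remainder_const B0 = T * b + h * (C * V1) + h * (C * total_energy).
  by rewrite /remainder_const bE -/B; ring.
apply: lerD; first apply: lerD.
- under eq_bigr do rewrite sumr_const card_ord.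
  have TE : h' * m%:R * N%:R = T by rewrite /h' (stepM T N m0) step_total.
  rewrite sumr_const card_ord -mulrnA -[leLHS]mulr_natl natrM.
  by rewrite -[in leRHS]TE le_eqVlt; apply/orP; left; apply/eqP; ring.
- rewrite exchange_big /= /h -(stepM T N m0) -/h'.
  apply: (@le_trans _ _ (\sum_(r < m) h' * (C * V1))); last first.
    by rewrite sumr_const card_ord -[leLHS]mulr_natl le_eqVlt; apply/orP; left; apply/eqP; ring.
  apply: ler_sum => r _; rewrite -mulr_sumr ler_wpM2l// -mulr_sumr ler_wpM2l//.
  rewrite -E_sum; first exact: FV.
  by move=> i; exact: fv_incr_L1.
- rewrite exchange_big /= /h -(stepM T N m0) -/h'.
  apply: (@le_trans _ _ (\sum_(r < m) h' * (C * total_energy))); last first.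
    by rewrite sumr_const card_ord -[leLHS]mulr_natl le_eqVlt; apply/orP; left; apply/eqP; ring.
  apply: ler_sum => r _; rewrite -mulr_sumr ler_wpM2l// -mulr_sumr ler_wpM2l//.
  apply: (@le_trans _ _ (\sum_l \sum_(i < N) E P (fun w => incr T Z N i r l w ^+ 2))).
    rewrite exchange_big; apply: ler_sum => i _.
    have iI l := (incr_L2 T0 Fs Zmart ZT2 N0 m0 r l (ltn_ord i)).2.
    rewrite -E_sum//; apply: E_le.
    + exact: dz_sq_L1.
    + exact: L1_sum.
    + by move=> w; rewrite enorm_sq; apply: ler_sum => l _; rewrite !mxE.
  by apply: ler_sum => l _; exact: (sum_incr_sq T0 Fs Zmart ZT2 N0 m0).
Qed.

(** The dependence on the deterministic starting point [x] is kept as a parameter: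
for fixed [x] the coefficient is known at time [t i]. *)
Definition coarse_coef i (x : 'rV[R]_d) (e : 'I_d) (l : 'I_k) w :=
  if (i < N)%N then A l (t i) (euler T f N x (Y ^~ w) i) (Y (t i) w) 0 e else 0.

Lemma coarse_coef_measurable i x e l :
  measurable_wrt (block_filt T Filt N i) (coarse_coef i x e l).
Proof.
have sGi := block_filt_sigma T0 Fs N0 i.
apply/(measurable_wrtP sGi.1); rewrite /coarse_coef.
case: ltnP => iN; last exact: measurable_cst.
have Yup j : (j <= i)%N -> random_vector
    (Y (mesh T N j) : g_sigma_algebraType (block_filt T Filt N i) -> 'rV[R]_k).
  move=> ji q; apply/(measurable_wrtP sGi.1) => B mB.
  have jN := leq_ltn_trans ji iN; have tj := t_in jN.
  have := YF tj q mB; rewrite -/(t j).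
  rewrite block_filtE ?(ltnW iN)//; apply: Fm; first by move: tj; rewrite in_itv => /andP[].
  by rewrite /t /mesh ler_wpM2r// ler_nat.
apply: (measurable_partial fe) => //; last exact: t_in.
- apply: (random_vector_euler T0 fe) => //; first exact: ltnW.
  by move=> j ji; apply: Yup; exact: ltnW.
- exact: Yup.
Qed.

Let Cc0 : 0 <= Cc.
Proof. by rewrite mulr_ge0 ?expR_ge0// mulr_ge0. Qed.

Let exp1 : 1 <= expR (C * T).
Proof. by rewrite -expR0 ler_expR mulr_ge0// ltW. Qed.

Lemma coarse_coef_le i x e l w : `|coarse_coef i x e l w| <= Cc.
Proof.
rewrite /coarse_coef; case: ltnP => iN; last by rewrite normr0.
apply: le_trans (le_coord_enorm _ _) _; apply: le_trans (partial_le fe _ _ _ (t_in iN)) _.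
rewrite /Cc; have C4 : C <= 4 * C by have := C0; lra.
by apply: le_trans C4 _; rewrite ler_peMr// mulr_ge0.
Qed.

(** Composition of [partial_holder] with the Lipschitz dependence of the scheme on
its starting point; the square root of [expR (C * T)] is bounded by [expR (C * T)]. *)
Lemma coarse_coef_holder i x x' e l w :
  `|coarse_coef i x e l w - coarse_coef i x' e l w| <= Cc * Num.sqrt (enorm (x - x')).
Proof.
rewrite /coarse_coef; case: ltnP => iN; last first.
  by rewrite subrr normr0 mulr_ge0 ?sqrtr_ge0.
set u := A _ _ _ _; set v := A _ _ _ _.
apply: (@le_trans _ _ (enorm (u - v))).
  by have := le_coord_enorm (u - v) e; rewrite !mxE.
apply: le_trans (partial_holder fe _ _ _ _ (t_in iN)) _.
rewrite /Cc -[leRHS]mulrA ler_wpM2l ?mulr_ge0//.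
have lip := euler_lipschitz T0 fe x x' (Y ^~ w) N0 (ltnW iN).
apply: le_trans (ler_wsqrtr lip) _; rewrite sqrtrM ?expR_ge0//.
rewrite ler_wpM2r ?sqrtr_ge0//.
rewrite -[leRHS](ger0_norm (expR_ge0 _)) -sqrtr_sqr ler_wsqrtr//.
by rewrite expr2 ler_peMr ?expR_ge0.
Qed.

Lemma martingale_partE x j w e : (j <= N)%N ->
  martingale_part T f A N m x (Y ^~ w) (Z ^~ w) j 0 e =
  h * mart_field (block_noise T Z N m) coarse_coef j x e w.
Proof.
move=> jN; rewrite /martingale_part summxE mulr_sumr; apply: eq_bigr => i _.
have iN : (i < N)%N := leq_trans (ltn_ord i) jN.
rewrite summxE.
under eq_bigr do rewrite !mxE summxE mulr_sumr.
rewrite exchange_big mulr_sumr; apply: eq_bigr => l _ /=.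
rewrite /coarse_coef /block_noise iN.
have -> : forall a S : R, h * (a * (m%:R^-1 * S)) = h' * (a * S).
  move=> a S; rewrite /h -(stepM T N m0) -/h'; field.
  by rewrite pnatr_eq0 -lt0n.
rewrite !mulr_sumr; apply: eq_bigr => r _.
by rewrite !mxE [_ * A _ _ _ _ _ _]mulrC.
Qed.

(** A starting point with values in a grid may depend on the whole noise, because
the chaining bound holds on the whole grid at once and costs only [|x|].  The
constant depends on the start through [B0] alone, hence neither on the grid nor
on [N] and [m]. *)
Theorem expected_refinement K n (zz : Omega -> grid d n) B0 : 0 <= B0 ->
  (forall g, measurable [set w | zz w = g]) ->
  E P (fun w => enorm (grid_point R K (zz w))) <= B0 ->
  forall j, (j <= N)%N ->
  let err w := enorm (euler T f (N * m) (grid_point R K (zz w)) (Y ^~ w) (j * m)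
                      - euler T f N (grid_point R K (zz w)) (Y ^~ w) j) in
  L1 P err /\ E P err <= h * refinement_const B0.
Proof.
move=> B00 mzz xB.
pose x w := grid_point R K (zz w).
have mx : random_vector x.
  by move=> e; exact: (measurable_fin_comp (fun g => grid_point R K g 0 e)).
have ix : L1 P (fun w => enorm (x w)).
  apply: (@L1_nonneg_dom _ (fun=> \sum_(g : grid d n) enorm (grid_point R K g))).
  - exact: measurable_enorm.
  - by move=> w; exact: enorm_ge0.
  - move=> w /=; rewrite (bigD1 (zz w))//= lerDl.
    by apply: sumr_ge0 => g _; exact: enorm_ge0.
  - exact: L1_cst.
have [iRem ERem] := remainder_moment B00 mx ix xB.
set Rem := fun w => _ in iRem ERem.
pose err j w := enorm (euler T f (N * m) (x w) (Y ^~ w) (j * m)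
                      - euler T f N (x w) (Y ^~ w) j).
have ierr j : (j <= N)%N -> L1 P (err j).
  move=> jN; have jmN : (j * m <= N * m)%N by rewrite leq_mul2r jN orbT.
  have [iU _] := euler_moment Nm0 B00 mx ix xB jmN.
  have [iX _] := euler_moment N0 B00 mx ix xB jN.
  apply: (@L1_nonneg_dom _ _ _ _ _ (L1D iU iX)).
  - apply: measurable_enorm; apply: random_vectorB; apply: (random_vector_euler T0 fe) => //.
      by move=> i ij; apply/mY/mesh_in => //; exact: leq_trans (ltnW ij) jmN.
    by move=> i ij; apply/mY/mesh_in => //; exact: leq_trans (ltnW ij) jN.
  - by move=> w; exact: enorm_ge0.
  - by move=> w; apply: le_trans (enormD _ _) _; rewrite enormN.
pose S0 := chain_const d Cc * (k%:R * total_energy).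
pose bM := d%:R * ((8 * d.+1)%:R * (S0 + 1 + B0)).
have [G1 G2] : (forall i, sigma_algebra setT (block_filt T Filt N i) /\
    block_filt T Filt N i `<=` measurable) /\
    (forall i, block_filt T Filt N i `<=` block_filt T Filt N i.+1).
  by split=> i; [exact: block_filt_sigma|exact: block_filtS].
have te0 : 0 <= total_energy by apply: sumr_ge0 => l _; exact: energy_ge0.
have cc0 : 0 <= chain_const d Cc.
  by rewrite /chain_const mulr_ge0 ?sqr_ge0// addr_ge0// mulr_ge0// exprn_ge0.
(* [bM] bounds the martingale part and [remainder_const] the rest; the last sum is
   the feedback for the Gronwall inequality *)
have step_le j : (j <= N)%N ->
    E P (err j) <= h * (remainder_const B0 + bM) + h * C * \sum_(i < j) E P (err i).
  move=> jN.
  have [Q [Q0 iQ EQ Qle]] := mart_field_chaining G1 G2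
    (block_noise_L2 T0 Fs Zmart ZT2 N0 m0) (block_noise_measurable T0 Fs Fm Zmart N0 m0)
    (block_noise_orth T0 Fs Zmart ZT2 N0 m0)
    Cc0 coarse_coef_measurable coarse_coef_le coarse_coef_holder K n j.
  have {}EQ : E P Q <= S0.
    apply: le_trans EQ _; rewrite ler_wpM2l//.
    exact: (block_noise_energy T0 Fs Zmart ZT2 N0 m0).
  pose MP w := d%:R * ((8 * d.+1)%:R * (Q w + 1 + enorm (x w))).
  have i1 : L1 P (fun w => Q w + 1) by apply: L1D => //; exact: L1_cst.
  have i2 : L1 P (fun w => Q w + 1 + enorm (x w)) by exact: L1D.
  have iMP : L1 P MP by apply/L1Z/L1Z.
  have iE (i : 'I_j) : L1 P (err i) by apply: ierr; exact: leq_trans (ltnW (ltn_ord i)) jN.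
  have iSE : L1 P (fun w => \sum_(i < j) err i w) by apply: L1_sum.
  have pw w : err j w <= Rem w + h * MP w + h * C * \sum_(i < j) err i w.
    apply: le_trans (refinement_error T0 fe (x w) (Y ^~ w) (Z ^~ w) N0 m0 jN) _.
    rewrite lerD2r lerD2l; apply: le_trans (enorm_le_sum _) _.
    apply: (@le_trans _ _ (\sum_(e < d) h * ((8 * d.+1)%:R * (Q w + 1 + enorm (x w))))).
      apply: ler_sum => e _; rewrite martingale_partE// normrM ger0_norm//.
      by rewrite ler_wpM2l//; exact: Qle.
    by rewrite sumr_const card_ord -[leLHS]mulr_natl mulrCA.
  have j1 := L1Z h iMP; have j2 := L1D iRem j1; have j3 := L1Z (h * C) iSE.
  apply: le_trans (E_le (ierr j jN) (L1D j2 j3) pw) _.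
  have ES : E P (fun w => \sum_(i < j) err i w) = \sum_(i < j) E P (err i).
    by rewrite E_sum.
  rewrite ED// ED// EZ// EZ// ES.
  rewrite lerD2r mulrDr lerD// ler_wpM2l//.
  rewrite /MP EZ; last exact: L1Z.
  rewrite EZ// /bM ler_wpM2l// ler_wpM2l// ED// ED ?E_cst//; last exact: L1_cst.
  by rewrite lerD// lerD.
have rc0 : 0 <= h * (remainder_const B0 + bM).
  have := step_le 0%N (leq0n _); rewrite big_ord0 mulr0 addr0.
  by apply: le_trans; apply: E_ge0 => w; exact: enorm_ge0.
move=> j jN err'; split; first exact: ierr.
have H := discrete_gronwall rc0 (mulr_ge0 h0 C0) step_le jN.
apply: le_trans H _; rewrite /refinement_const -/S0 -/bM mulrA ler_wpM2l//.
rewrite ler_expR [h * C]mulrC -mulrA ler_wpM2l//.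
by rewrite -[leRHS](step_total T N0) ler_wpM2l// ler_nat.
Qed.

End expected_error.

(** * Rounding a random vector to a grid *)

Section rounding.
Context (R : realType) (d0 : measure_display) (Omega : measurableType d0).
Variables (P : probability Omega R) (d : nat).

Lemma measurable_truncn_pred (X : Omega -> R) (Q : pred nat) :
  measurable_fun setT X -> (forall w, 0 <= X w) ->
  measurable [set w | Q (Num.truncn (X w))].
Proof.
move=> mX X0.
have -> : [set w | Q (Num.truncn (X w))] =
    \bigcup_i (if Q i then X @^-1` `[i%:R, i.+1%:R[ else set0).
  apply/seteqP; split=> w /=.
    move=> Qw; exists (Num.truncn (X w)) => //; rewrite Qw /= in_itv /=.
    exact: truncn_itv.
  move=> [i _]; case: ifP => // Qi /=; rewrite in_itv /= => Xi.
  by rewrite (truncn_def Xi).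
apply: bigcupT_measurable => i; case: ifP => // _.
by rewrite -[X in measurable X]setTI; exact: mX.
Qed.

Variables (X : Omega -> 'rV[R]_d).
Hypothesis mX : random_vector X.

Let lev (K : nat) (x : R) := minn (Num.truncn (2 ^+ K * `|x|)) (K * 2 ^ K).

(** Each coordinate is rounded towards 0 at precision [2 ^- K] and cut off at [K],
so that finitely many grid points suffice. *)
Definition grid_round K w : grid d (K * 2 ^ K).+1 :=
  [ffun c => (X w 0 c < 0, inord (lev K (X w 0 c)))].

Let lev_lt K x : (lev K x < (K * 2 ^ K).+1)%N.
Proof. by rewrite ltnS geq_minr. Qed.

Lemma measurable_grid_round K g : measurable [set w | grid_round K w = g].
Proof.
have -> : [set w | grid_round K w = g] =
    \bigcap_(c in setT) ([set w | (X w 0 c < 0) = (g c).1] `&`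
      [set w | lev K (X w 0 c) == (g c).2]).
  apply/seteqP; split=> w /=.
    by move=> <- c _ /=; split; rewrite ffunE //= inordK.
  move=> H; apply/ffunP => c; have [/= h1 /eqP h2] := H c I.
  rewrite ffunE; case: (g c) h1 h2 => b j /= -> h2; congr (_, _).
  by apply: val_inj; rewrite /= inordK.
apply: fin_bigcap_measurable; first exact: finite_finset.
move=> c _; apply: measurableI.
  have m0 : measurable [set w | X w 0 c < 0].
    have -> : [set w | X w 0 c < 0] = (fun w => X w 0 c) @^-1` `]-oo, 0[.
      by apply/seteqP; split=> w /=; rewrite in_itv.
    by rewrite -[X in measurable X]setTI; exact: mX.
  case: (g c).1; first by [].
  have -> : [set w | (X w 0 c < 0) = false] = ~` [set w | X w 0 c < 0].
    by apply/seteqP; split=> w /= => [->//|/negP/negbTE].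
  exact: measurableC.
apply: (@measurable_truncn_pred (fun w => 2 ^+ K * `|X w 0 c|)
  (fun i => minn i (K * 2 ^ K) == (g c).2)).
  by apply: measurable_funM => //; apply: measurableT_comp => //; exact: mX.
by move=> w; rewrite mulr_ge0// exprn_ge0.
Qed.

Let rest K x : R := `|x| - (lev K x)%:R / 2 ^+ K.

Let rest_ge0 K x : 0 <= rest K x.
Proof.
have p : 0 < 2 ^+ K :> R by rewrite exprn_gt0.
rewrite subr_ge0 ler_pdivrMr// mulrC.
apply: (@le_trans _ _ (Num.truncn (2 ^+ K * `|x|))%:R).
  by rewrite ler_nat geq_minl.
by rewrite truncn_le mulr_ge0// ltW.
Qed.

Let rest_le K x : `|x| <= K%:R -> rest K x <= 2 ^- K.
Proof.
move=> xK; have p : 0 < 2 ^+ K :> R by rewrite exprn_gt0.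
have y0 : 0 <= 2 ^+ K * `|x| by rewrite mulr_ge0// ltW.
have /andP[_] := truncn_itv y0; rewrite -[X in _ < X]natr1 => h1.
rewrite /rest; have -> : lev K x = Num.truncn (2 ^+ K * `|x|).
  apply/minn_idPl; rewrite -(ler_nat R); apply: le_trans (_ : 2 ^+ K * `|x| <= _).
    by rewrite truncn_le.
  by rewrite natrM natrX mulrC ler_wpM2r// ltW.
rewrite lerBlDr; set t := (Num.truncn _)%:R in h1 *.
have -> : 2 ^- K + t / 2 ^+ K = (t + 1) / 2 ^+ K by rewrite mulrDl mul1r addrC.
by rewrite ler_pdivlMr// mulrC ltW.
Qed.

Lemma grid_round_coord K w c :
  `|X w 0 c - grid_point R K (grid_round K w) 0 c| = rest K (X w 0 c).
Proof.
have p : 0 < 2 ^+ K :> R by rewrite exprn_gt0.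
rewrite !mxE ffunE /= inordK//; set x := X w 0 c.
rewrite -[RHS]ger0_norm ?rest_ge0// /rest.
have [x0|x0] := ltP x 0; last by rewrite expr0 mul1r (ger0_norm x0).
by rewrite expr1 mulN1r mulNr opprK (ltr0_norm x0) -normrN opprD.
Qed.

Lemma grid_round_norm K w : enorm (grid_point R K (grid_round K w)) <= enorm (X w).
Proof.
rewrite /enorm ler_wsqrtr//; apply: ler_sum => c _.
rewrite -(real_normK (num_real _)) -[leRHS](real_normK (num_real _)).
rewrite lerXn2r ?nnegrE// grid_pointE ffunE /= inordK// -subr_ge0.
exact: rest_ge0.
Qed.

(** The rounding error tends to 0 pointwise and is dominated by [2 |X|]. *)
Lemma grid_round_approx (eps : R) : L1 P (fun w => enorm (X w)) -> 0 < eps ->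
  exists K, E P (fun w => enorm (X w - grid_point R K (grid_round K w))) <= eps.
Proof.
move=> iX eps0.
have mG K : random_vector (fun w => grid_point R K (grid_round K w)).
  move=> c; apply: (measurable_fin_comp (fun g => grid_point R K g 0 c)).
  exact: measurable_grid_round.
have mD K : measurable_fun setT (fun w => enorm (X w - grid_point R K (grid_round K w))).
  by apply: measurable_enorm; exact: random_vectorB.
have [|||_] := @E_dominated _ _ _ P
  (fun K w => enorm (X w - grid_point R K (grid_round K w))) (fun=> 0)
  (fun w => 2 * enorm (X w)) mD.
- move=> w; apply/cvgrPdist_le => e e0; near=> K.
  rewrite sub0r normrN ger0_norm ?enorm_ge0//.
  apply: le_trans (enorm_le_sum _) _.
  have XK : enorm (X w) <= K%:R by near: K; exact: nbhs_infty_ger.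
  apply: (@le_trans _ _ (\sum_(c < d) 2 ^- K)).
    apply: ler_sum => c _; have := grid_round_coord K w c; rewrite !mxE => ->.
    by apply: rest_le; apply: le_trans XK; exact: le_coord_enorm.
  rewrite sumr_const card_ord -[leLHS]mulr_natl ler_pdivrMr ?exprn_gt0//.
  rewrite -ler_pdivrMl//.
  have dK : e^-1 * d%:R <= K%:R by near: K; exact: nbhs_infty_ger.
  apply: le_trans dK _; rewrite -natrX ler_nat; exact/ltnW/ltn_expl.
- move=> K w; rewrite ger0_norm ?enorm_ge0//; apply: le_trans (enormD _ _) _.
  by rewrite enormN; have := grid_round_norm K w; lra.
- exact: L1Z.
rewrite E_cst => /cvgrPdist_le /(_ eps eps0)[K _ /(_ K (leqnn K)) /=].
rewrite sub0r normrN => h; exists K; exact: le_trans (ler_norm _) h.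
Unshelve. all: by end_near. Qed.

End rounding.

(** * Convergence of the Euler scheme along a path *)

Section cadlag_paths.
Context (R : realType) (k : nat).
Implicit Types g : R -> 'rV[R]_k.

Lemma enorm_le_mx_norm (v : 'rV[R]_k) : enorm v <= k%:R * `|v|.
Proof.
apply: le_trans (enorm_le_sum v) _.
apply: (@le_trans _ _ (\sum_(i < k) `|v|)); last by rewrite sumr_const card_ord mulr_natl.
apply: ler_sum => i _; rewrite [leRHS]/Num.Def.normr/= mx_normrE.
exact: (le_bigmax _ (fun ij : 'I_1 * 'I_k => `|v ij.1 ij.2|) (0, i)).
Qed.

Lemma mx_norm_enorm_lt (e : R) (v : 'rV[R]_k) : `|v| < e / k.+1%:R -> enorm v <= e.
Proof.
move=> ve; apply: le_trans (enorm_le_mx_norm v) _.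
rewrite ltr_pdivlMr// in ve; apply: le_trans (ltW ve).
by rewrite mulrC ler_wpM2l// ler_nat.
Qed.

(** The points of [B] account for the oscillations of size larger than [eps]: two
times in [0, u] that no point of [B] separates give close values. *)
Definition oscillation_free (eps u : R) g (B : seq R) (M : R) :=
  (forall s t, 0 <= s -> s <= t -> t <= u -> (forall b, b \in B -> ~~ (s < b <= t)) ->
     enorm (g s - g t) <= eps) /\
  (forall s, 0 <= s <= u -> enorm (g s) <= M).

(** The set of [u] for which such a finite [B] exists is closed under suprema by the
left limits and open to the right by right continuity, so it reaches [T]. *)
Lemma cadlag_oscillation (T eps : R) g : 0 < T -> 0 < eps -> cadlag g T ->
  exists B M, oscillation_free eps T g B M.
Proof.
move=> T0 eps0 [grc gll].
have e1 : 0 < eps / 2 / k.+1%:R by rewrite !divr_gt0.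
pose S := [set u | 0 <= u <= T /\ exists B M, oscillation_free eps u g B M].
have S0 : S 0.
  split; first by rewrite lexx ltW.
  exists [::], (enorm (g 0)); split=> [s t s0 st t0 _|s /andP[s0 s1]].
    have -> : s = 0 by lra.
    have -> : t = 0 by lra.
    by rewrite subrr enorm0 ltW.
  by have -> : s = 0 by lra.
have supS : has_sup S by split; [exists 0|exists T => u [/andP[]]].
pose c := sup S.
have c0 : 0 <= c by exact: (ub_le_sup (proj2 supS) S0).
have cT : c <= T by apply: ge_sup; [exists 0|move=> u [/andP[]]].
have Sc : exists B M, oscillation_free eps c g B M.
  move: c0; rewrite le_eqVlt => /predU1P[c0|c0]; first by rewrite -c0; case: S0.
  have /cvg_ex[l gl] : cvg (g s @[s --> c^'-]) by apply: gll; rewrite c0 cT.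
  have /cvgrPdist_lt /(_ _ e1) [dl /= dl0 gdl] := gl.
  have gl_le s : c - dl < s -> s < c -> enorm (l - g s) <= eps / 2.
    move=> s1 s2; apply: mx_norm_enorm_lt; apply: gdl => //=.
    by rewrite gtr0_norm ?subr_gt0//; lra.
  have [u [u0T [B [M [osc bnd]]]] uc] := sup_adherent dl0 supS.
  rewrite -/c in uc.
  have ule : u <= c.
    by apply: (ub_le_sup (proj2 supS)); split=> //; exists B, M.
  exists [:: c, u & B], (`|M| + (enorm l + eps / 2) + enorm (g c)).
  split=> [s t s0 st tc nB|s /andP[s0 sc]].
    have [tu|ut] := leP t u.
      by apply: osc => // b bB; apply: nB; rewrite !inE bB !orbT.
    have [tltc|] := ltP t c; last first.
      move=> ct; have tc' : t = c by lra.
      have := nB c; rewrite inE eqxx /= => /(_ isT).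
      rewrite tc' lexx andbT -leNgt => cs.
      have -> : s = c by lra.
      by rewrite subrr enorm0 ltW.
    have us : u <= s.
      have := nB u; rewrite !inE eqxx orbT => /(_ isT).
      by rewrite (ltW ut) andbT -leNgt.
    apply: le_trans (enorm_dist_triangle _ l _) _; rewrite enormB.
    have h1 : enorm (l - g s) <= eps / 2 by apply: gl_le; lra.
    have h2 : enorm (l - g t) <= eps / 2 by apply: gl_le; lra.
    lra.
  have M0 : 0 <= `|M| by [].
  have l0 := enorm_ge0 l; have gc0 := enorm_ge0 (g c).
  have [su|us] := leP s u.
    have sM : enorm (g s) <= M by apply: bnd; rewrite s0.
    have := ler_norm M; lra.
  have [sltc|cs] := ltP s c; last first.
    have -> : s = c by lra.
    lra.
  have h1 : enorm (l - g s) <= eps / 2 by apply: gl_le; lra.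
  have h2 : enorm (g s) <= enorm l + enorm (l - g s).
    have := enormD l (- (l - g s)); rewrite enormN opprB addrCA subrr addr0; exact.
  lra.
have [cltT|Tc] := ltP c T; last by have <- : c = T by lra.
exfalso.
have /cvgrPdist_lt /(_ _ e1) [dl /= dl0 gdl] : g s @[s --> c^'+] --> g c.
  by apply: grc; rewrite c0.
have gc_le s : c <= s -> s < c + dl -> enorm (g c - g s) <= eps / 2.
  rewrite le_eqVlt => /predU1P[<- _|cs sd].
    by rewrite subrr enorm0 ltW// divr_gt0.
  apply: mx_norm_enorm_lt; apply: gdl => //=.
  by rewrite ltr0_norm ?subr_lt0//; lra.
pose u := Num.min T (c + dl / 2).
have cu : c < u by rewrite lt_min cltT ltrDl divr_gt0.
have uT : u <= T by rewrite ge_min lexx.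
have udl : u < c + dl.
  have : u <= c + dl / 2 by rewrite ge_min lexx orbT.
  by move: dl0; lra.
have [B [M [osc bnd]]] := Sc.
suff Su : S u by have := ub_le_sup (proj2 supS) Su; rewrite -/c leNgt cu.
split; first by rewrite uT (le_trans c0 (ltW cu)).
exists (c :: B), (`|M| + enorm (g c) + eps / 2).
split=> [s t s0 st tu nB|s /andP[s0 su]].
  have [tc|ct] := leP t c.
    by apply: osc => // b bB; apply: nB; rewrite inE bB orbT.
  have cs : c <= s.
    have := nB c; rewrite inE eqxx => /(_ isT).
    by rewrite (ltW ct) andbT -leNgt.
  apply: le_trans (enorm_dist_triangle _ (g c) _) _; rewrite enormB.
  have h1 : enorm (g c - g s) <= eps / 2 by apply: gc_le; lra.
  have h2 : enorm (g c - g t) <= eps / 2 by apply: gc_le; lra.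
  lra.
have M0 : 0 <= `|M| by []; have gc0 := enorm_ge0 (g c).
have [sc|cs] := leP s c.
  have sM : enorm (g s) <= M by apply: bnd; rewrite s0.
  have := ler_norm M; lra.
have h1 : enorm (g c - g s) <= eps / 2 by apply: gc_le; lra.
have h2 : enorm (g s) <= enorm (g c) + enorm (g c - g s).
  have := enormD (g c) (- (g c - g s)); rewrite enormN opprB addrCA subrr addr0; exact.
lra.
Qed.

End cadlag_paths.

Section integral_equation.
Context (R : realType).
Notation mu := (@lebesgue_measure R).

(** One step of the Euler scheme freezes the integrand of the integral equation. *)
Lemma Rintegral_increment_le (phi : R -> R) (T s t c K : R) :
  mu.-integrable `[0, T] (EFin \o phi) -> 0 <= s -> s <= t -> t <= T ->
  (forall r, s < r <= t -> `|phi r - c| <= K) ->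
  `|\int[mu]_(r in `[0, t]) phi r - \int[mu]_(r in `[0, s]) phi r - (t - s) * c|
    <= K * (t - s).
Proof.
move=> iphi s0 st tT phiK.
have i0t : mu.-integrable `[0, t] (EFin \o phi).
  apply: integrableS iphi => //; apply: subset_itvl; by rewrite bnd_simp.
rewrite Rintegral_itvB//; [|by rewrite bnd_simp..].
have ist : mu.-integrable `]s, t] (EFin \o phi).
  by apply: integrableS i0t => //; apply: subset_itvr; rewrite bnd_simp.
have mst : fine (mu `]s, t]) = t - s.
  by rewrite lebesgue_measure_itv /= lte_fin; case: ltP => //= ts; lra.
have ic a : mu.-integrable `]s, t] (EFin \o (fun=> a)).
  apply/integrableP; split; first exact/measurable_EFinP.
  rewrite integral_cst//= lebesgue_measure_itv /=.
  by case: ifP => _; rewrite ?mule0// -EFinB -EFinM ltry.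
have -> : (t - s) * c = \int[mu]_(r in `]s, t]) c by rewrite Rintegral_cst// mst mulrC.
have iB : mu.-integrable `]s, t] (EFin \o (fun r => phi r - c)).
  by apply: (integrableB _ ist (ic c)); exact: measurable_itv.
rewrite -RintegralB//; apply: le_trans (le_normr_Rintegral _ iB) _ => //.
rewrite -mst -Rintegral_cst//; apply: le_Rintegral => //.
  exact: integrable_norm iB.
Qed.

Lemma Rintegral_norm_bound (phi : R -> R) (T : R) :
  mu.-integrable `[0, T] (EFin \o phi) ->
  exists K, forall t, 0 <= t <= T -> `|\int[mu]_(r in `[0, t]) phi r| <= K.
Proof.
move=> iphi; exists (\int[mu]_(r in `[0, T]) `|phi r|) => t /andP[t0 tT].
have sub : `[0, t] `<=` `[0, T] by apply: subset_itvl; rewrite bnd_simp.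
have i0t : mu.-integrable `[0, t] (EFin \o phi) by apply: integrableS iphi.
apply: le_trans (le_normr_Rintegral _ i0t) _ => //.
rewrite /Rintegral fine_le//.
- by apply: integrable_fin_num => //; have := integrable_norm i0t.
- by apply: integrable_fin_num => //; have := integrable_norm iphi.
apply: ge0_subset_integral => //.
by apply/measurable_EFinP; apply: measurableT_comp => //; have /integrableP[/measurable_EFinP] := iphi.
Qed.

End integral_equation.

Section euler_convergence.
Context (R : realType) (d k : nat).
Variables (T C : R) (f : R -> 'rV[R]_d -> 'rV[R]_k -> 'rV[R]_d).
Variable A : 'I_k -> R -> 'rV[R]_d -> 'rV[R]_k -> 'rV[R]_d.
Hypothesis T0 : 0 < T.
Hypothesis fe : field_estimates T C f A.
Let C0 : 0 <= C := fe_C fe.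

(** The cells of a partition are disjoint, so each point of [B] is counted at most
once. *)
Lemma count_cells (B : seq R) (t : nat -> R) M :
  (forall n, t n <= t n.+1) ->
  (\sum_(n < M) count (fun b => (t n < b <= t n.+1)%R) B <= size B)%N.
Proof.
move=> tS.
suff H M' : (\sum_(n < M') count (fun b => (t n < b <= t n.+1)%R) B +
    count (fun b => (b <= t 0%N)%R) B = count (fun b => (b <= t M')%R) B)%N.
  by apply: leq_trans (count_size (fun b => (b <= t M)%R) B); rewrite -H leq_addr.
elim: M' => [|n IH]; first by rewrite big_ord0 add0n.
rewrite big_ord_recr /= addnAC IH -count_predUI.
rewrite [X in (_ + X)%N](_ : _ = 0%N) ?addn0.
  apply: eq_count => b /=; apply/orP/idP => [[h|/andP[]//]|h].
    exact: le_trans h (tS n).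
  by have [h1|h1] := leP b (t n); [left|right].
rewrite -(count_pred0 B); apply: eq_count => b /=.
by apply/negbTE/negP => /and3P[h1 h2 _]; move: (le_lt_trans h1 h2); rewrite ltxx.
Qed.

Variables (x0 : 'rV[R]_d) (y : R -> 'rV[R]_k) (x : R -> 'rV[R]_d).
Hypothesis ycadlag : cadlag y T.
Hypothesis xsol : solves T f x0 y x.

(** The integrand varies by a small amount over a cell of the mesh unless a point of
[B] lies in the cell.  In the exceptional cells the variation is only bounded, but
their number is at most the size of [B] and each has length [T / M].  Gronwall
adds up these local errors. *)
Theorem euler_cvg_path (eps : R) : 0 < eps ->
  \forall M \near \oo, forall n, (n <= M)%N ->
    enorm (euler T f M x0 y n - x (mesh T M n)) <= eps.
Proof.
have [ixf xE] := xsol => eps0.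
have e0 : 0 < expR (C * T) by exact: expR_gt0.
have [My ybnd] : exists M, forall s, 0 <= s <= T -> enorm (y s) <= M.
  by have [B [M [_ H]]] := cadlag_oscillation T0 ltr01 ycadlag; exists M.
have [Mx xbnd] : exists M, forall s, 0 <= s <= T -> enorm (x s) <= M.
  have [K HK] : exists K : 'I_d -> R, forall i t, 0 <= t <= T ->
      `|\int[lebesgue_measure]_(r in `[0, t]) f r (x r) (y r) 0 i| <= K i.
    have [K HK] := @choice _ _ _ (fun i => Rintegral_norm_bound (ixf i)).
    by exists K.
  exists (\sum_i (`|x0 0 i| + K i)) => s sT.
  apply: le_trans (enorm_le_sum _) _; apply: ler_sum => i _.
  rewrite xE ?in_itv//; apply: le_trans (ler_normD _ _) _; rewrite lerD2l.
  exact: HK.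
have Mx0 : 0 <= Mx by apply: le_trans (xbnd 0 _); rewrite ?enorm_ge0 ?lexx ?ltW.
have My0 : 0 <= My by apply: le_trans (ybnd 0 _); rewrite ?enorm_ge0 ?lexx ?ltW.
pose phi s := f s (x s) (y s).
have [Kf [Kf0 phiK]] : exists Kf, 0 <= Kf /\ forall s, 0 <= s <= T -> enorm (phi s) <= Kf.
  have g0 := growth_const_ge0 (ltW T0) fe.
  exists (growth_const T C f * (1 + Mx + My)).
  split=> [|s sT]; first by apply: mulr_ge0 => //; rewrite !addr_ge0.
  apply: le_trans (field_growth (ltW T0) fe (x s) (y s) (_ : s \in `[0, T])) _.
    by rewrite in_itv.
  by rewrite ler_wpM2l//; have := xbnd s sT; have := ybnd s sT; lra.
have incr s t K c : 0 <= s -> s <= t -> t <= T ->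
    (forall r, s < r <= t -> enorm (phi r - c) <= K) ->
    enorm (x t - x s - (t - s) *: c) <= d%:R * (K * (t - s)).
  move=> s0 st tT HK; apply: le_trans (enorm_le_sum _) _.
  apply: (@le_trans _ _ (\sum_(i < d) K * (t - s))); last first.
    by rewrite sumr_const card_ord mulr_natl.
  apply: ler_sum => i _; rewrite !mxE !xE ?in_itv /= ?s0 ?tT ?(le_trans s0 st) ?(le_trans st tT)//.
  set I1 := Rintegral _ _ _; set I2 := Rintegral _ _ _.
  have -> : x0 0 i + I1 - (x0 0 i + I2) - (t - s) * c 0 i = I1 - I2 - (t - s) * c 0 i by ring.
  apply: (Rintegral_increment_le (ixf i)) => // r rst.
  by apply: le_trans (HK r rst); have := le_coord_enorm (phi r - c) i; rewrite !mxE.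
have xlip s t : 0 <= s -> s <= t -> t <= T -> enorm (x t - x s) <= d%:R * (Kf * (t - s)).
  move=> s0 st tT; have := incr s t Kf 0 s0 st tT; rewrite scaler0 subr0; apply.
  move=> r /andP[sr rt]; rewrite subr0; apply: phiK.
  by apply/andP; split; [exact: le_trans s0 (ltW sr)|exact: le_trans rt tT].
pose e1 := eps / (2 * (d%:R * T * C + 1) * expR (C * T)).
have den0 : 0 < 2 * (d%:R * T * C + 1) * expR (C * T).
  by rewrite !mulr_gt0// ltr_wpDl// !mulr_ge0// ltW.
have e10 : 0 < e1 by exact: divr_gt0.
have [B [My' [osc _]]] := cadlag_oscillation T0 e10 ycadlag.
(* [a1 / M] collects the drift and time terms and the exceptional cells, [e1] the
   small oscillations *)
pose a1 := d%:R * T * (C * (1 + Mx + My) * T + C * (d%:R * (Kf * T))) +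
           d%:R * (2 * Kf * T * (size B)%:R).
have a10 : 0 <= a1.
  have T0' := ltW T0.
  rewrite /a1; apply: addr_ge0; last by rewrite !mulr_ge0.
  apply: mulr_ge0; first by rewrite mulr_ge0.
  apply: addr_ge0; last by rewrite !mulr_ge0.
  by rewrite !mulr_ge0// !addr_ge0.
suff H M : (0 < M)%N -> forall n, (n <= M)%N ->
    enorm (euler T f M x0 y n - x (mesh T M n)) <=
    (a1 / M%:R + d%:R * T * C * e1) * expR (C * T).
  near=> M => n nM.
  have M0 : (0 < M)%N by near: M; exact: nbhs_infty_gt.
  apply: le_trans (H M M0 n nM) _.
  have h2 : d%:R * T * C * e1 * expR (C * T) <= eps / 2.
    have p0 : 0 <= d%:R * T * C by rewrite !mulr_ge0// ltW.
    have -> : d%:R * T * C * e1 * expR (C * T) =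
        eps / 2 * (d%:R * T * C / (d%:R * T * C + 1)).
      by rewrite /e1; field; rewrite !gt_eqF//= ltr_wpDl.
    rewrite ler_piMr ?divr_ge0 ?(ltW eps0)//.
    by rewrite ler_pdivrMr ?ltr_wpDl// mul1r lerDl.
  have h1 : a1 / M%:R * expR (C * T) <= eps / 2.
    have Mp : 0 < M%:R :> R by rewrite ltr0n.
    rewrite mulrAC ler_pdivrMr// -ler_pdivrMl ?divr_gt0//.
    by near: M; exact: nbhs_infty_ger.
  by rewrite mulrDl; lra.
move=> M0 n nM.
pose t i := mesh T M i; pose h := step T M.
have h0 : 0 < h by exact: step_gt0.
have tS i : t i.+1 - t i = h by rewrite /t /mesh -natr1; rewrite -/h; ring.
have tin i : (i <= M)%N -> 0 <= t i <= T by move=> iM; have := mesh_in T0 M0 iM; rewrite in_itv.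
have hT : h <= T.
  by rewrite -[leRHS](step_total T M0) ler_peMr ?(ltW h0)// ler1n.
pose beta i := count (fun b => t i < b <= t i.+1) B.
(* the variation of the integrand over a cell free of points of [B] *)
pose kap := C * (1 + Mx + My) * h + C * (d%:R * (Kf * h)) + C * e1.
have kap0 : 0 <= kap.
  have [h0' e0'] := (ltW h0, ltW e10).
  rewrite /kap; apply: addr_ge0; last exact: mulr_ge0.
  apply: addr_ge0; last by do 3 apply: mulr_ge0 => //.
  by apply: mulr_ge0 => //; apply: mulr_ge0 => //; rewrite !addr_ge0.
have loc i : (i < M)%N -> forall r, t i < r <= t i.+1 ->
    enorm (phi r - phi (t i)) <= kap + 2 * Kf * (beta i)%:R.
  move=> iM r rt; have /andP[tr rt'] := rt.
  have /andP[ti0 tiT] := tin i (ltnW iM); have /andP[_ tiT'] := tin i.+1 iM.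
  have rT : 0 <= r <= T by apply/andP; split; lra.
  have [hasb|nob] := boolP (has (fun b => t i < b <= t i.+1) B).
    have b1 : 1 <= (beta i)%:R :> R by rewrite ler1n -has_count.
    apply: le_trans (enormD _ _) _; rewrite enormN.
    have := phiK r rT; have := phiK (t i) (tin i (ltnW iM)) => p1 p2.
    have kb : 2 * Kf <= 2 * Kf * (beta i)%:R by rewrite ler_peMr// mulr_ge0.
    by lra.
  have yosc : enorm (y (t i) - y r) <= e1.
    apply: osc => // [| |b bB]; [exact: ltW|lra|].
    have := hasPn nob b bB; apply: contra => /andP[h1 h2].
    by rewrite h1 (le_trans h2).
  have rin : r \in `[0, T] by rewrite in_itv.
  have tiin : t i \in `[0, T] by rewrite in_itv /= ti0.
  have p1 : enorm (f r (x r) (y r) - f r (x (t i)) (y r)) <= C * (d%:R * (Kf * h)).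
    apply: le_trans (fe_x fe _ _ _ rin) _; rewrite ler_wpM2l//.
    apply: le_trans (xlip _ _ ti0 (ltW tr) _) _; first by case/andP: rT.
    by rewrite ler_wpM2l// ler_wpM2l//; have := tS i; lra.
  have p2 : enorm (f r (x (t i)) (y r) - f (t i) (x (t i)) (y r)) <= C * (1 + Mx + My) * h.
    apply: le_trans (fe_t fe _ _ ti0 (ltW tr) _) _; first by case/andP: rT.
    apply: ler_pM.
    - by apply: mulr_ge0 => //; rewrite !addr_ge0 ?enorm_ge0.
    - lra.
    - rewrite ler_wpM2l//; have := xbnd (t i) (tin i (ltnW iM)); have := ybnd r rT; lra.
    - by have := tS i; lra.
  have p3 : enorm (f (t i) (x (t i)) (y r) - f (t i) (x (t i)) (y (t i))) <= C * e1.
    apply: le_trans (fe_y fe _ _ _ tiin) _; rewrite ler_wpM2l//.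
    by rewrite enormB.
  have b0 : 0 <= 2 * Kf * (beta i)%:R by rewrite !mulr_ge0.
  apply: le_trans (enorm_dist_triangle _ (f (t i) (x (t i)) (y r)) _) _.
  apply: le_trans (lerD (enorm_dist_triangle _ (f r (x (t i)) (y r)) _) p3) _.
  by rewrite /kap; lra.
pose er i := enorm (euler T f M x0 y i - x (t i)).
have xt0 : x (t 0%N) = x0.
  apply/rowP => i; rewrite xE; last by rewrite in_itv; exact: tin.
  by rewrite /t /mesh mul0r set_itv1 Rintegral_set1 addr0.
have erS i : (i < M)%N -> er i.+1 <= er i + h * C * er i + d%:R * ((kap + 2 * Kf * (beta i)%:R) * h).
  move=> iM; have /andP[ti0 tiT] := tin i (ltnW iM); have /andP[_ tiT'] := tin i.+1 iM.
  have ts : t i <= t i.+1 by have := tS i; lra.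
  have := incr (t i) (t i.+1) _ (phi (t i)) ti0 ts tiT' (loc i iM); rewrite tS => hi.
  rewrite /er /= -/h -/(t i).
  set X := euler T f M x0 y i.
  have -> : X + h *: f (t i) X (y (t i)) - x (t i.+1) = (X - x (t i)) +
      h *: (f (t i) X (y (t i)) - phi (t i)) - (x (t i.+1) - x (t i) - h *: phi (t i)).
    by apply/rowP => q; rewrite !mxE; ring.
  apply: le_trans (enormD _ _) _; rewrite enormN; apply: lerD => //.
  apply: le_trans (enormD _ _) _; rewrite lerD2l enormZ gtr0_norm// -mulrA ler_wpM2l ?(ltW h0)//.
  by apply: (fe_x fe); rewrite in_itv /= ti0.
have erE i : (i <= M)%N -> er i <= \sum_(l < i) d%:R * ((kap + 2 * Kf * (beta l)%:R) * h)
     + h * C * \sum_(l < i) er l.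
  elim: i => [|i IH] iM; first by rewrite !big_ord0 mulr0 addr0 /er /= xt0 subrr enorm0.
  rewrite !big_ord_recr /= mulrDr; apply: le_trans (erS i iM) _.
  by have := IH (ltnW iM); lra.
have sumb i : (i <= M)%N -> \sum_(l < i) d%:R * ((kap + 2 * Kf * (beta l)%:R) * h) <=
    a1 / M%:R + d%:R * T * C * e1.
  move=> iM.
  have Mh : M%:R * h = T by rewrite mulrC step_total.
  have hE : h = T / M%:R by [].
  apply: (@le_trans _ _ (\sum_(l < M) d%:R * ((kap + 2 * Kf * (beta l)%:R) * h))).
    apply: (sum_ord_widen (g := fun l => d%:R * ((kap + 2 * Kf * (beta l)%:R) * h))) => // l.
    by rewrite mulr_ge0// mulr_ge0 ?(ltW h0)// addr_ge0// !mulr_ge0.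
  have -> : \sum_(l < M) d%:R * ((kap + 2 * Kf * (beta l)%:R) * h) =
      d%:R * (kap * (M%:R * h)) + d%:R * (2 * Kf * h) * (\sum_(l < M) beta l)%:R.
    rewrite natr_sum mulr_sumr.
    have -> : d%:R * (kap * (M%:R * h)) = \sum_(l < M) d%:R * (kap * h).
      by rewrite sumr_const card_ord -[RHS]mulr_natl; ring.
    by rewrite -big_split /=; apply: eq_bigr => l _; ring.
  rewrite Mh.
  have cB : (\sum_(l < M) beta l)%:R <= (size B)%:R :> R.
    rewrite ler_nat; apply: (@count_cells B t M) => l.
    by rewrite -subr_ge0 tS ltW.
  apply: (@le_trans _ _ (d%:R * (kap * T) + d%:R * (2 * Kf * h) * (size B)%:R)).
    by rewrite lerD2l ler_wpM2l// !mulr_ge0// ltW.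
  rewrite le_eqVlt; apply/orP; left; apply/eqP; rewrite /kap /a1 hE.
  by field; rewrite lt0r_neq0// ltr0n.
have c0 : 0 <= a1 / M%:R + d%:R * T * C * e1.
  apply: addr_ge0; first exact: divr_ge0.
  by have [T0' e0'] := (ltW T0, ltW e10); do 3 apply: mulr_ge0 => //.
have er_le i : (i <= M)%N ->
    er i <= a1 / M%:R + d%:R * T * C * e1 + h * C * \sum_(l < i) er l.
  by move=> iM; apply: le_trans (erE i iM) _; rewrite lerD2r; exact: sumb.
apply: le_trans (discrete_gronwall c0 (mulr_ge0 (ltW h0) C0) er_le nM) _.
apply: ler_wpM2l => //; rewrite ler_expR [h * C]mulrC -mulrA; apply: ler_wpM2l => //.
by rewrite -[leRHS](step_total T M0); apply: ler_wpM2l; [exact: ltW|rewrite ler_nat].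
Unshelve. all: by end_near. Qed.

End euler_convergence.

(** * From the hypotheses to the quantitative estimates *)

Section smooth_field.
Context (R : realType) (d k : nat) (T : R).
Variables (f : R -> 'rV[R]_d -> 'rV[R]_k -> 'rV[R]_d) (cL c1 c2 c3 c4 c7 : R).
Hypothesis hcL : 0 <= cL.
Hypothesis hc : [/\ 0 <= c1, 0 <= c2, 0 <= c3, 0 <= c4 & 0 <= c7].
Hypothesis hfx : forall t x x' y, t \in `[0, T] ->
  enorm (f t x y - f t x' y) <= cL * enorm (x - x').
Hypothesis hC1 : forall x y, C1_in T (fun t => f t x y).
Hypothesis hC2 : forall t x, t \in `[0, T] -> C2 (f t x).
Hypothesis hft : forall t x y, t \in `[0, T] ->
  enorm (derive_in T (fun s => f s x y) t) <= c1 + c2 * enorm x + c3 * enorm y.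
Hypothesis hfy : forall t x y, t \in `[0, T] -> (opnorm ('d (f t x) y) <= c4%:E)%E.
Hypothesis hfyy : forall t x y, t \in `[0, T] -> (opnorm2 (diff2 (f t x) y) <= c7%:E)%E.

Lemma smooth_field_estimates : field_estimates T (cL + c1 + c2 + c3 + c4 + c7) f
  (fun l t x y => 'd (f t x) y (delta_mx 0 l)).
Proof.
have [c10 c20 c30 c40 c70] := hc; have cL0 := hcL; split.
- by rewrite !addr_ge0.
- move=> t x x' y tT; apply: le_trans (hfx _ _ _ tT) _.
  by rewrite ler_wpM2r ?enorm_ge0//; lra.
- move=> t x y y' tT; have [fd _ _] := hC2 x tT.
  apply: le_trans (lipschitz_space fd (fun y => hfy x y tT) y y') _.
  by rewrite ler_wpM2r ?enorm_ge0//; lra.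
- move=> s t x y s0 st tT.
  apply: le_trans (lipschitz_time (hC1 x y) (fun r => @hft r x y) s0 st tT) _.
  rewrite ler_wpM2r ?subr_ge0//.
  rewrite !mulrDr mulr1; apply: lerD; first apply: lerD; rewrite ?ler_wpM2r ?enorm_ge0//; lra.
- move=> t x y z tT; have [fd Jd _] := hC2 x tT.
  have -> : \sum_l z 0 l *: 'd (f t x) y (delta_mx 0 l) = 'd (f t x) y z.
    by rewrite [in RHS](row_sum_delta z) linear_sum; apply: eq_bigr => l _; rewrite linearZ.
  apply: le_trans (taylor_space fd Jd (fun y => hfyy x y tT) y z) _.
  by rewrite ler_wpM2r ?sqr_ge0//; lra.
Qed.

End smooth_field.

Lemma block_index_leq N m i r : (i < N)%N -> (r < m)%N -> (i * m + r <= N * m)%N.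
Proof. nia. Qed.

Section variation.
Context (R : realType) (n : nat) (T : R).
Hypothesis T0 : 0 < T.
Implicit Type g : R -> 'rV[R]_n.

Lemma variation_ge0 g : (0 <= variation_on `[0%R, T] g)%E.
Proof.
apply: ereal_sup_ubound; exists 0%N, (fun=> 0); split=> //.
  by move=> j _; rewrite /= in_itv /= lexx ltW.
by rewrite big_ord0.
Qed.

(** Interleaving the coarse nodes with the fine nodes of rank [r] gives a partition,
of whose increments every other one is kept.  For [r = 0] the two nodes of a block
coincide and the sum vanishes. *)
Lemma block_variation_le g N m r : (0 < N)%N -> (r < m)%N ->
  ((\sum_(i < N) enorm (g (mesh T (N * m) (i * m + r)) - g (mesh T N i)))%:E
    <= variation_on `[0%R, T] g)%E.
Proof.
move=> N0 rm; have m0 : (0 < m)%N by exact: leq_ltn_trans rm.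
case: r rm => [_|r rm].
  rewrite big1 ?variation_ge0// => i _.
  by rewrite addn0 mesh_refine// subrr enorm0.
have h0 : 0 < step T (N * m) by rewrite step_gt0// muln_gt0 N0.
(* even indices give the coarse nodes, odd indices the fine nodes of rank [r.+1] *)
pose node j := (j./2 * m + odd j * r.+1)%N.
apply: (@le_trans _ _ (\sum_(j < N * 2) enorm (g (mesh T (N * m) (node j.+1))
    - g (mesh T (N * m) (node j))))%:E); last first.
  apply: ereal_sup_ubound; exists (N * 2)%N, (fun j => mesh T (N * m) (node j)).
  split=> // j jN.
    by apply: mesh_in; rewrite ?muln_gt0 ?N0// /node; nia.
  by rewrite /mesh ltr_pM2r// ltr_nat /node; case: (boolP (odd j)); nia.
rewrite lee_fin (sum_blocks _ _ (fun j => enorm (g (mesh T (N * m) (node j.+1))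
    - g (mesh T (N * m) (node j))))).
apply: ler_sum => i _; rewrite !big_ord_recl big_ord0 /= addr0.
rewrite -[leLHS]addr0; apply: lerD; last exact: enorm_ge0.
rewrite -(mesh_refine T N i m0) /node.
have -> : ((i * 2 + 0).+1./2 * m + odd (i * 2 + 0).+1 * r.+1 = i * m + r.+1)%N by nia.
by have -> : ((i * 2 + 0)./2 * m + odd (i * 2 + 0) * r.+1 = i * m)%N by nia.
Qed.

Lemma increment_variation_le g t : t \in `[0, T] ->
  ((enorm (g t - g 0))%:E <= variation_on `[0%R, T] g)%E.
Proof.
move=> tT; have := tT; rewrite in_itv /= => /andP[].
rewrite le_eqVlt => /predU1P[<- _|t0 t1].
  by rewrite subrr enorm0 variation_ge0.
apply: ereal_sup_ubound; exists 1%N, (fun j => if j is 0%N then 0 else t); split.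
- by move=> [|j] _ //=; rewrite in_itv /= lexx ltW.
- by move=> [|j].
- by rewrite big_ord_recl big_ord0 addr0.
Qed.

End variation.

Section second_moment.
Context (R : realType) (d0 : measure_display) (Omega : measurableType d0).
Variables (P : probability Omega R) (D : Omega -> R) (V : Omega -> \bar R).

(** Here [V] stands for the total variation, a supremum of uncountably many random
variables; it is compared with [D] through lower integrals, after [D] has been
set to 0 on a null set. *)
Lemma ae_le_square_integrable : measurable_fun setT D -> (forall w, 0 <= D w) ->
  {ae P, forall w, ((D w)%:E <= V w)%E} ->
  (\int[P]_w V w ^+ 2 < +oo)%E ->
  L1 P D /\ E P D <= 1 + fine (\int[P]_w V w ^+ 2)%E.
Proof.
move=> mD D0 DV Voo.
have D2V : (\int[P]_w (D w ^+ 2)%:E <= \int[P]_w V w ^+ 2)%E.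
  have [S [mS S0 SDV]] := DV.
  (* [g] lies below [V ^+ 2] everywhere and has the same integral as [D ^+ 2] *)
  pose g w := ((D w ^+ 2) * \1_(~` S) w)%:E.
  have -> : (\int[P]_w (D w ^+ 2)%:E = \int[P]_w g w)%E.
    apply: ae_eq_integral => //.
    - by apply/measurable_EFinP; exact: measurable_funX.
    - apply/measurable_EFinP; apply: measurable_funM; first exact: measurable_funX.
      by apply: measurable_indic; exact: measurableC.
    - exists S; split=> // w /= H; apply: contrapT => nS; apply: H => _.
      by rewrite /g indicE mem_set// mulr1.
  apply: le_lower_integral => w.
    by rewrite lee_fin mulr_ge0// sqr_ge0.
  rewrite /g indicE; have [wS|nS] := boolP (w \in ~` S).
    have DVw : ((D w)%:E <= V w)%E by apply: contrapT => H; move/set_mem: wS; apply; exact: SDV.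
    by rewrite mulr1 expr2 EFinM expe2 lee_pmul// ?lee_fin.
  rewrite mulr0 expe2.
  by have [h|/ltW h] := leP 0%E (V w); [exact: mule_ge0|exact: mule_le0].
have iD2 : L1 P (fun w => D w ^+ 2).
  apply: L1_ge0 => [|w|]; [exact: measurable_funX|exact: sqr_ge0|].
  exact: le_lt_trans D2V Voo.
have i1 := L1D (L1_cst P 1) iD2.
have le1 w : D w <= 1 + D w ^+ 2 by have := sqr_ge0 (D w - 1); nra.
have iD : L1 P D by apply: L1_dom i1 => // w; rewrite ger0_norm.
split=> //; apply: le_trans (E_le iD i1 le1) _.
rewrite (ED (L1_cst P 1) iD2) E_cst lerD2l -lee_fin EFin_E// fineK//.
rewrite ge0_fin_numE//; apply: le_trans D2V; apply: integral_ge0 => w _.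
by rewrite lee_fin sqr_ge0.
Qed.

End second_moment.

(** * Arbitrary initial values and the theorem *)

Section arbitrary_start.
Context (R : realType) (d0 : measure_display) (Omega : measurableType d0).
Variables (P : probability Omega R) (d k : nat) (T C : R).
Variables (f : R -> 'rV[R]_d -> 'rV[R]_k -> 'rV[R]_d).
Variable A : 'I_k -> R -> 'rV[R]_d -> 'rV[R]_k -> 'rV[R]_d.
Hypothesis T0 : 0 < T.
Hypothesis fe : field_estimates T C f A.
Variable Y : R -> Omega -> 'rV[R]_k.
Hypothesis mY : forall t, t \in `[0, T] -> random_vector (Y t).
Variables (K0 B0 : R).
Hypothesis grid_start : forall N m, (0 < N)%N -> (0 < m)%N ->
  forall K n (zz : Omega -> grid d n),
  (forall g, measurable [set w | zz w = g]) ->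
  E P (fun w => enorm (grid_point R K (zz w))) <= B0 ->
  forall j, (j <= N)%N ->
  let err w := enorm (euler T f (N * m) (grid_point R K (zz w)) (Y ^~ w) (j * m)
                      - euler T f N (grid_point R K (zz w)) (Y ^~ w) j) in
  L1 P err /\ E P err <= step T N * K0.

(** Both schemes are moved to the common starting point [z], a rounding of [x] at
distance at most [step T N] in mean; each move costs the Lipschitz constant
[expR (C * T)] of the scheme. *)
Lemma expected_refinement_any (x x' : Omega -> 'rV[R]_d) (c0 : R) N m j :
  (0 < N)%N -> (0 < m)%N -> (j <= N)%N ->
  random_vector x -> random_vector x' ->
  L1 P (fun w => enorm (x w)) -> E P (fun w => enorm (x w)) <= B0 ->
  L1 P (fun w => enorm (x w - x' w)) ->
  E P (fun w => enorm (x w - x' w)) <= c0 * step T N ->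
  let err w := enorm (euler T f (N * m) (x w) (Y ^~ w) (j * m)
                      - euler T f N (x' w) (Y ^~ w) j) in
  L1 P err /\ E P err <= (expR (C * T) * (2 + c0) + K0) * step T N.
Proof.
move=> N0 m0 jN mx mx' ix Bx ixx' Exx' err.
have h0 := step_gt0 T0 N0; set h := step T N in h0 Exx' *.
have NM0 : (0 < N * m)%N by rewrite muln_gt0 N0.
have jM : (j * m <= N * m)%N by rewrite leq_mul2r jN orbT.
have [K EK] := grid_round_approx mx ix h0.
pose z w := grid_point R K (grid_round x K w).
have mz : random_vector z.
  move=> c; apply: (measurable_fin_comp (fun g => grid_point R K g 0 c)).
  exact: measurable_grid_round.
have zx w : enorm (z w) <= enorm (x w) by exact: grid_round_norm.
have iz : L1 P (fun w => enorm (z w)).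
  apply: L1_dom ix; first exact: measurable_enorm.
  by move=> w; rewrite ger0_norm ?enorm_ge0.
have [iG EG] := grid_start N0 m0 (measurable_grid_round mx (K := K))
  (le_trans (E_le iz ix zx) Bx) jN.
set G := fun w => enorm _ in iG EG.
have ixz : L1 P (fun w => enorm (x w - z w)).
  apply: L1_dom (L1D ix iz).
    by apply: measurable_enorm; exact: random_vectorB.
  by move=> w; rewrite ger0_norm ?enorm_ge0// -(enormN (z w)); exact: enormD.
pose e := expR (C * T).
pose bd w := e * (2 * enorm (x w - z w) + enorm (x w - x' w)) + G w.
have ib0 := L1D (L1Z 2 ixz) ixx'.
have ib : L1 P bd by apply: L1D iG; exact: L1Z.
have mE N' j' (v : Omega -> 'rV[R]_d) : (0 < N')%N -> (j' <= N')%N -> random_vector v ->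
    random_vector (fun w => euler T f N' (v w) (Y ^~ w) j').
  move=> N'0 j'N' mv; apply: (random_vector_euler T0 fe N'0 j'N' mv) => i ij.
  by apply: mY; apply: mesh_in => //; exact: leq_trans (ltnW ij) j'N'.
have le_bd w : err w <= bd w.
  rewrite /err /bd /G -/(z w).
  apply: le_trans (enorm_dist_triangle _ (euler T f (N * m) (z w) (Y ^~ w) (j * m)) _) _.
  have h1 := euler_lipschitz T0 fe (x w) (z w) (Y ^~ w) NM0 jM.
  have h2 := euler_lipschitz T0 fe (z w) (x' w) (Y ^~ w) N0 jN.
  have h3 := enorm_dist_triangle (z w) (x w) (x' w).
  rewrite (enormB (z w) (x w)) in h3.
  apply: le_trans (lerD h1 (enorm_dist_triangle _ (euler T f N (z w) (Y ^~ w) j) _)) _.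
  have e0 : 0 <= e by exact: expR_ge0.
  have := ler_wpM2l e0 h3; rewrite -/e in h1 h2 *; lra.
have err0 w : 0 <= err w by exact: enorm_ge0.
have merr : measurable_fun setT err.
  by apply: measurable_enorm; apply: random_vectorB; exact: mE.
have ierr : L1 P err by apply: L1_dom ib => // w; rewrite ger0_norm.
split=> //; apply: le_trans (E_le ierr ib le_bd) _.
rewrite (ED (L1Z _ ib0) iG) (EZ _ ib0) (ED (L1Z _ ixz) ixx') (EZ _ ixz).
have : 2 * E P (fun w => enorm (x w - z w)) + E P (fun w => enorm (x w - x' w)) <= (2 + c0) * h.
  by rewrite [leRHS]mulrDl; apply: lerD Exx'; rewrite ler_wpM2l.
move/(ler_wpM2l (expR_ge0 (C * T))); rewrite -/e => He; apply: le_trans (lerD He EG) _.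
by rewrite -/h [leRHS](_ : _ = e * ((2 + c0) * h) + h * K0)//; ring.
Qed.

End arbitrary_start.

Theorem theorem7p1 (R : realType) (d k : nat) (T : R) (hT : 0 < T)
  (d0 : measure_display) (Omega : measurableType d0) (P : probability Omega R)
  (Filt : R -> set_system Omega)
  (f : R -> 'rV[R]_d -> 'rV[R]_k -> 'rV[R]_d) (L : R -> R)
  (Y : R -> Omega -> 'rV[R]_k) (X0 : Omega -> 'rV[R]_d)
  (hstanding : standing_hypothesis P Filt T f L Y X0)
  (X : R -> Omega -> 'rV[R]_d) (hX : pathwise_solution P T f X0 Y X)
  (X0N : nat -> Omega -> 'rV[R]_d)
  (hX0N : forall N, (0 < N)%N -> random_vector (X0N N))
  (hEX0 : ('E_P[fun w => enorm (X0 w)] < +oo)%E)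
  (hEf : (\int[lebesgue_measure]_(t in `[0%R, T])
            'E_P[fun w => enorm (f t 0%R (Y t w))] < +oo)%E)
  (cL : R) (hcL : 0 <= cL)
  (hL : (ereal_sup [set (L eta)%:E | eta in [set eta : R | (0 <= eta)%R]] <= cL%:E)%E)
  (c_0 : R) (hc_0 : 0 <= c_0)
  (hinit : forall N, (0 < N)%N ->
     ('E_P[fun w => enorm (X0 w - X0N N w)%R] <= (c_0 * step T N)%:E)%E)
  (hC1 : forall x y, C1_in T (fun t => f t x y))
  (hC2 : forall (t : R) (x : 'rV[R]_d), t \in `[0, T] -> C2 (f t x))
  (c1 c2 c3 c4 c7 : R)
  (hc : [/\ 0 <= c1, 0 <= c2, 0 <= c3, 0 <= c4 & 0 <= c7])
  (hft : forall (t : R) (x : 'rV[R]_d) (y : 'rV[R]_k), t \in `[0, T] ->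
     enorm (derive_in T (fun s => f s x y) t) <= c1 + c2 * enorm x + c3 * enorm y)
  (hfy : forall (t : R) (x : 'rV[R]_d) (y : 'rV[R]_k), t \in `[0, T] -> (opnorm ('d (f t x) y) <= c4%:E)%E)
  (hfyy : forall (t : R) (x : 'rV[R]_d) (y : 'rV[R]_k), t \in `[0, T] -> (opnorm2 (diff2 (f t x) y) <= c7%:E)%E)
  (F Z : R -> Omega -> 'rV[R]_k)
  (hdec : decomposition P T Y F Z)
  (hF : FV_process P T F)
  (hZ : martingale P Filt (fun t => Z (Num.min t T)))
  (hEY0 : ('E_P[fun w => enorm (Y 0%R w)] < +oo)%E)
  (hEF : (\int[P]_w (variation_on `[0%R, T] (F ^~ w)) ^+ 2 < +oo)%E)
  (hEZ : ('E_P[fun w => (enorm (Z T w) ^+ 2)%R] < +oo)%E) :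
  exists2 c : R, 0 <= c & forall N, (0 < N)%N ->
    (\big[maxe/0%E]_(j < N.+1)
       'E_P[fun w => enorm (X (mesh T N j) w - euler T f N (X0N N w) (Y ^~ w) j)%R]
     <= (c * step T N)%:E)%E.
Proof.
have [_ [_ flip] [Fs Fm _ _] [YF Ycad _] mX0] := hstanding.
set C := cL + c1 + c2 + c3 + c4 + c7.
pose A l t (x : 'rV[R]_d) (y : 'rV[R]_k) := 'd (f t x) y (delta_mx 0 l).
have fe : field_estimates T C f A.
  apply: smooth_field_estimates => // t x x' y tT.
  apply: le_trans (flip t x x' y tT) _; rewrite ler_wpM2r ?enorm_ge0//.
  rewrite -lee_fin; apply: le_trans hL; apply: ereal_sup_ubound.
  by exists (enorm y) => //; exact: enorm_ge0.
have in0T : 0 \in `[0, T] by rewrite in_itv /= lexx ltW.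
have mY t : t \in `[0, T] -> random_vector (Y t).
  move=> tT i; have := tT; rewrite in_itv /= => /andP[t0 _].
  exact: measurable_wrt_sub (Fs t t0).2 (YF t tT i).
have Zmart s t : 0 <= s -> s <= t -> t <= T -> forall l,
    is_cond_exp P (Filt s) (fun w => Z t w 0 l) (fun w => Z s w 0 l).
  move=> s0 st tT l; have := hZ s t s0 st l.
  by rewrite (min_l tT) (min_l (le_trans st tT)).
have mZ t : t \in `[0, T] -> random_vector (Z t).
  rewrite in_itv /= => /andP[t0 tT] l.
  by have [iZ _ _ _] := Zmart t t t0 (lexx _) tT l; exact: L1_measurable iZ.
have TinT : T \in `[0, T] by rewrite in_itv /= lexx ltW.
have ZT2 l : L2 P (fun w => Z T w 0 l).
  split; first exact: mZ.
  apply: (L1_nonneg_dom (V := fun w => enorm (Z T w) ^+ 2)).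
  - by apply: measurable_funX; exact: mZ.
  - by move=> w; exact: sqr_ge0.
  - move=> w; rewrite -(real_normK (num_real _)) lerXn2r ?nnegrE ?enorm_ge0//.
    exact: le_coord_enorm.
  - apply: L1_ge0 => [|w|]; [|exact: sqr_ge0|by move: hEZ; rewrite unlock].
    by apply: measurable_funX; apply: measurable_enorm; exact: mZ.
pose V1 := 1 + fine (\int[P]_w (variation_on `[0%R, T] (F ^~ w)) ^+ 2)%E.
have FV N m r : (0 < N)%N -> (r < m)%N ->
    E P (fun w => \sum_(i < N) enorm (fv_incr T Y Z N m i r w)) <= V1.
  move=> N0 rm; have m0 : (0 < m)%N by exact: leq_ltn_trans rm.
  have tin (i : 'I_N) : mesh T N i \in `[0, T] by apply: mesh_in => //; exact: ltnW.
  have sin (i : 'I_N) : mesh T (N * m) (i * m + r) \in `[0, T].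
    by apply: (mesh_in hT _ (block_index_leq (ltn_ord i) rm)); rewrite muln_gt0 N0.
  apply: (ae_le_square_integrable _ _ _ hEF).2.
  - apply: measurable_sum => i; apply: measurable_enorm.
    by apply: random_vectorB; apply: random_vectorB; by [exact: mY|exact: mZ].
  - by move=> w; apply: sumr_ge0 => i _; exact: enorm_ge0.
  - apply: filterS hdec => w [_ _ Yw].
    apply: le_trans (block_variation_le hT (F ^~ w) N0 rm); rewrite lee_fin.
    apply: ler_sum => i _; rewrite /fv_incr (Yw _ (sin i)) (Yw _ (tin i)).
    rewrite le_eqVlt; apply/orP; left; apply/eqP; congr enorm.
    by apply/rowP => c; rewrite !mxE; ring.
have iY0 : L1 P (fun w => enorm (Y 0 w)).
  apply: L1_ge0 => [|w|]; [|exact: enorm_ge0|by move: hEY0; rewrite unlock].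
  by apply: measurable_enorm; exact: mY.
(* [|Y_t| <= |Y_0| + |F_t| + |Z_t|], where [|F_t|] is at most the variation and each
   coordinate of [Z_t] at most 1 plus its square *)
pose BY := E P (fun w => enorm (Y 0 w)) + V1 + \sum_(l < k) (1 + energy P Z T l).
have E0 n (V : Omega -> 'rV[R]_n) : 0 <= E P (fun w => enorm (V w)).
  by apply: E_ge0 => w; exact: enorm_ge0.
have YL1 t : t \in `[0, T] ->
    L1 P (fun w => enorm (Y t w)) /\ E P (fun w => enorm (Y t w)) <= BY.
  move=> tT; have := tT; rewrite in_itv /= => /andP[t0 tT'].
  (* a random vector that equals [F t] almost surely *)
  pose G w := Y t w - Y 0 w - Z t w.
  have mG : random_vector G.
    by apply: random_vectorB; [apply: random_vectorB; exact: mY|exact: mZ].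
  have [iG EG] : L1 P (fun w => enorm (G w)) /\ E P (fun w => enorm (G w)) <= V1.
    apply: (ae_le_square_integrable _ _ _ hEF).
    - exact: measurable_enorm.
    - by move=> w; exact: enorm_ge0.
    - apply: filterS hdec => w [F0 _ Yw].
      have := increment_variation_le hT (F ^~ w) tT; rewrite F0 subr0.
      rewrite /G (Yw t tT); congr (_ <= _)%E; congr (enorm _)%:E.
      by apply/rowP => c; rewrite !mxE; ring.
  have iZ l : L1 P (fun w => 1 + Z t w 0 l ^+ 2).
    by apply: L1D (L1_cst P 1) _; have [] := mart_L2 Fs Zmart ZT2 l t0 tT'.
  pose bd w := enorm (Y 0 w) + enorm (G w) + \sum_l (1 + Z t w 0 l ^+ 2).
  have iS : L1 P (fun w => \sum_l (1 + Z t w 0 l ^+ 2)) by exact: L1_sum.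
  have iYG := L1D iY0 iG; have ibd : L1 P bd := L1D iYG iS.
  have Ybd w : enorm (Y t w) <= bd w.
    have -> : Y t w = Y 0 w + G w + Z t w by apply/rowP => c; rewrite !mxE; ring.
    apply: le_trans (enormD _ _) _; apply: lerD (enormD _ _) _.
    apply: le_trans (enorm_le_sum _) _; apply: ler_sum => l _.
    by rewrite -(real_normK (num_real (Z t w 0 l))); nra.
  have iY : L1 P (fun w => enorm (Y t w)).
    apply: L1_nonneg_dom Ybd ibd; last by move=> w; exact: enorm_ge0.
    by apply: measurable_enorm; exact: mY.
  split=> //; apply: le_trans (E_le iY ibd Ybd) _.
  rewrite (ED iYG iS) (ED iY0 iG) E_sum//; apply: lerD; first by rewrite lerD2l.
  apply: ler_sum => l _; have [_ iZ2] := mart_L2 Fs Zmart ZT2 l t0 tT'.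
  rewrite (ED (L1_cst P 1) iZ2) E_cst lerD2l.
  exact: (energy_le Fs Zmart ZT2 l t0 tT' (lexx T)).
have BY0 : 0 <= BY by exact: le_trans (YL1 0 in0T).2.
have iX0 : L1 P (fun w => enorm (X0 w)).
  apply: L1_ge0 => [|w|]; [exact: measurable_enorm|exact: enorm_ge0|].
  by move: hEX0; rewrite unlock.
pose B0 := E P (fun w => enorm (X0 w)).
pose K0 := refinement_const P T C f BY Z V1 B0.
pose c := expR (C * T) * (2 + c_0) + K0.
have grid_start N m (N0 : (0 < N)%N) (m0 : (0 < m)%N) :=
  expected_refinement hT fe mY BY0 YL1 Fs Fm YF Zmart ZT2 FV N0 m0.
have fine_error N m j : (0 < N)%N -> (0 < m)%N -> (j <= N)%N ->
    let err w := enorm (euler T f (N * m) (X0 w) (Y ^~ w) (j * m)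
                        - euler T f N (X0N N w) (Y ^~ w) j) in
    L1 P err /\ E P err <= c * step T N.
  move=> N0 m0 jN; have mX0N := hX0N N N0.
  have mD : measurable_fun setT (fun w => enorm (X0 w - X0N N w)).
    by apply: measurable_enorm; exact: random_vectorB.
  have hi := hinit N N0; rewrite unlock in hi.
  have iD : L1 P (fun w => enorm (X0 w - X0N N w)).
    by apply: L1_ge0 => // [w|]; [exact: enorm_ge0|exact: le_lt_trans hi (ltry _)].
  apply: (expected_refinement_any hT fe mY (B0 := B0)) => //.
    move=> N' m' N'0 m'0 K n zz mzz Bz j' jN'.
    exact: (grid_start N' m' N'0 m'0 K n zz B0 (E0 _ _) mzz Bz j' jN').
  by rewrite -lee_fin EFin_E.
(* the constant dominates an expectation of a norm, for one step and [m = 1] *)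
have c_ge0 : 0 <= c.
  have [_ h] := fine_error 1%N 1%N 0%N isT isT isT.
  rewrite -(pmulr_lge0 _ (step_gt0 hT (isT : (0 < 1)%N))).
  exact: le_trans (E0 _ _) h.
exists c => // N N0.
(* the bound holds for all refinements [m.+1] of the mesh; let [m] tend to infinity *)
apply/bigmax_leP; split=> [|j _].
  by rewrite lee_fin mulr_ge0// ltW// step_gt0.
have jN : (j <= N)%N by rewrite -ltnS.
rewrite unlock; apply: (@fatou_le_ae _ _ _ P (fun m w =>
  enorm (euler T f (N * m.+1) (X0 w) (Y ^~ w) (j * m.+1)
         - euler T f N (X0N N w) (Y ^~ w) j))).
- by move=> w; exact: enorm_ge0.
- by move=> m; have [iE _] := fine_error N m.+1 j N0 isT jN; exact: L1_measurable iE.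
- by move=> m w; exact: enorm_ge0.
- by move=> m; have [iE EE] := fine_error N m.+1 j N0 isT jN; rewrite -EFin_E// lee_fin.
apply: filterS2 Ycad hX => w yw [xw _].
apply/cvgrPdist_le => eps eps0.
have := euler_cvg_path hT fe yw xw eps0 => -[M0 _ HM].
exists M0 => // m /= M0m.
have Mle : (M0 <= N * m.+1)%N by apply: leq_trans M0m _; exact: leq_trans (leqnSn m) (leq_pmull _ N0).
have jM : (j * m.+1 <= N * m.+1)%N by rewrite leq_mul2r jN orbT.
have := HM _ Mle _ jM; rewrite mesh_refine//; apply: le_trans.
set u := euler T f (N * m.+1) _ _ _; set v := euler T f N _ _ _; set x := X _ w.
have h1 := enorm_dist_triangle x u v; have h2 := enorm_dist_triangle u x v.
rewrite (enormB x u) in h1.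
by rewrite ler_norml; apply/andP; split; lra.
Qed.
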